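(* Let $f\colon M^n\to\mathbb{R}^{n+1}$, $n\geq 2$, be an isometric immersion of a Riemannian manifold $M^n$ that admits a nowhere trivial infinitesimal variation $F\colon I\times M^n\to\mathbb{R}^{n+1}$ that infinitesimally preserves the Gauss map. Assume that $M^n$ is free of flat points and that $f$ is not part of a Euclidean cylinder when restricted to any open subset of $M^n$. Then $f$ is a minimal immersion and $M^n$ is a Kaehler manifold (that is, it carries an orthogonal almost complex structure $J$ which is parallel with respect to the Levi-Civita connection). In addition, if $M^n$ is simply connected, then the variational vector field $\mathcal{T}$ of $F$ is, up to constants, the conjugate hypersurface $\bar f\colon M^n\to\mathbb{R}^{n+1}$ to $f$ in its associated family, that is, there exist $c\in\mathbb{R}$ and $w\in\mathbb{R}^{n+1}$ such that $\mathcal{T}=c\bar f+w$.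
   Context: Variations. A smooth variation of $f$ is a smooth map $F\colon I\times M^n\to\mathbb{R}^{n+1}$, where $I\subset\mathbb{R}$ is an interval with $0\in I$, such that $F(0,x)=f(x)$ and $f_t=F(t,\cdot)$ is an immersion for every $t\in I$. Its variational vector field is $\mathcal{T}=\frac{\partial}{\partial t}\big|_{t=0}f_t\in\Gamma(f^*T\mathbb{R}^{n+1})$, regarded as a map $\mathcal{T}\colon M^n\to\mathbb{R}^{n+1}$. The variation $F$ is an infinitesimal variation if $\frac{\partial}{\partial t}\big|_{t=0}\langle f_{t*}X,f_{t*}Y\rangle=0$ for all tangent vector fields $X,Y$ on $M^n$; equivalently, $\mathcal{T}$ is an infinitesimal bending of $f$, that is, $\langle \mathcal{T}_*X,f_*Y\rangle+\langle f_*X,\mathcal{T}_*Y\rangle=0$ for all $X,Y$. Triviality. An infinitesimal bending $\mathcal{T}$ of $f$ is trivial if there are a skew-symmetric linear endomorphism $\mathcal{D}$ of $\mathbb{R}^{n+1}$ and a vector $w\in\mathbb{R}^{n+1}$ such that $\mathcal{T}=\mathcal{D}f+w$. The infinitesimal variation $F$ is nowhere trivial if the restriction of its variational vector field to any nonempty open subset $U\subset M^n$ is not a trivial infinitesimal bending of $f|_U$. Gauss map. Let $N_t$, $t\in I$, be the smooth family of Gauss maps (unit normal vector fields) of $f_t$. The infinitesimal variation $F$ infinitesimally preserves the Gauss map if $\frac{\partial}{\partial t}\big|_{t=0}N_t=0$. Flat points. A point of $M^n$ is flat if the curvature tensor of $M^n$ vanishes at that point (equivalently, the shape operator of $f$ has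 rank at most one there). Cylinders. $f$ restricted to an open subset $U\subset M^n$ is part of a Euclidean cylinder if $U$ is a Riemannian product $N^k\times V$, with $V\subset\mathbb{R}^{n-k}$ open and $n-k\geq 1$, and, up to a Euclidean motion, $f(y,z)=(g(y),z)\in\mathbb{R}^{k+1}\oplus\mathbb{R}^{n-k}$ for an isometric immersion $g\colon N^k\to\mathbb{R}^{k+1}$. Associated family. If $f\colon M^n\to\mathbb{R}^{n+1}$ is a minimal isometric immersion without flat points of a simply connected Kaehler manifold with almost complex structure $J$, then with $J_\theta=\cos\theta\, I+\sin\theta\, J$ and $x_0\in M^n$ a fixed point, the line integral $f_\theta(x)=\int_{x_0}^x f_*\circ J_\theta$ is well defined, and $f_\theta\colon M^n\to\mathbb{R}^{n+1}$, $\theta\in[0,\pi)$, is a one-parameter family of minimal isometric immersions, called the associated family of $f$. The conjugate hypersurface to $f$ is $\bar f=f_{\pi/2}$; thus $\bar f_*=f_*\circ J$, and $\bar f$ is determined up to an additive constant vector (depending on the choice of $x_0$). *)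

(* Defs.v *)
From HB Require Import structures.
From mathcomp Require Import all_boot all_order all_algebra.
From mathcomp Require Import all_classical all_reals all_analysis.
Set Implicit Arguments.
Unset Strict Implicit.
Unset Printing Implicit Defensive.
Import Order.TTheory GRing.Theory Num.Theory.
Import numFieldNormedType.Exports.
Local Open Scope classical_set_scope.
Local Open Scope ring_scope.

(* Points and vectors of R^n are row vectors, and matrices act on the right:
   a linear map L is written v |-> v *m L, in agreement with [jacobian], for
   which 'D_v g x = v *m 'J g x. The Euclidean inner product is u *m v^T (the
   library norm on matrices is the sup norm and is used only as a topology).
   Tensor fields are given by their components in each chart, subject to the
   usual transformation rule under change of charts. *)

Section Smooth.
Context {R : realType} {V W : normedModType R}.

Fixpoint Ck (k : nat) (U : set V) (h : V -> W) : Prop :=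
  match k with
  | 0 => forall x, U x -> {for x, continuous h}
  | k'.+1 => (forall x, U x -> differentiable h x) /\
             forall v, Ck k' U (fun x => 'D_v h x)
  end.

(* On a set A that need not be open, smooth means that h extends to a smooth
   map near each point of A; if A is open this is smoothness on A. *)
Definition smooth_on (A : set V) (h : V -> W) : Prop :=
  forall x, A x -> exists U, exists h' : V -> W,
    [/\ open U, U x, forall k, Ck k U h' & forall y, U y -> A y -> h' y = h y].

End Smooth.

Record chart (R : realType) (n : nat) (T : Type) := Chart {
  cdom : set T;
  coord : T -> 'rV[R]_n;
  cparam : 'rV[R]_n -> T }.

Section Charts.
Context {R : realType} {n : nat} {T : topologicalType}.
Implicit Types c d : chart R n T.

Definition cimg c : set 'rV[R]_n := coord c @` cdom c.

Definition is_chart c : Prop :=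
  [/\ open (cdom c), open (cimg c),
      forall p, cdom c p -> cparam c (coord c p) = p,
      forall p, cdom c p -> {for p, continuous (coord c)} &
      forall x, cimg c x -> {for x, continuous (cparam c)}].

Definition overlap c d : set 'rV[R]_n := coord c @` (cdom c `&` cdom d).

Definition transition c d : 'rV[R]_n -> 'rV[R]_n := coord d \o cparam c.

End Charts.

Record manifold (R : realType) (n : nat) := Manifold {
  mspace :> topologicalType;
  atlas : set (chart R n mspace);
  manifold_hausdorff : hausdorff_space mspace;
  manifold_second_countable : @second_countable mspace;
  manifold_chart : forall c, atlas c -> is_chart c;
  manifold_cover : forall p : mspace, exists2 c, atlas c & cdom c p;
  manifold_transition : forall c d, atlas c -> atlas d ->
    smooth_on (overlap c d) (transition c d) }.

Record riemannian (R : realType) (n : nat) := Riemannian {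
  rmanifold :> manifold R n;
  metric : chart R n rmanifold -> 'rV[R]_n -> 'M[R]_n;
  metric_smooth : forall c, atlas c -> smooth_on (cimg c) (metric c);
  metric_sym : forall c x, atlas c -> cimg c x -> (metric c x)^T = metric c x;
  metric_posdef : forall c x (v : 'rV[R]_n), atlas c -> cimg c x -> v != 0 ->
    0 < (v *m metric c x *m v^T) 0 0;
  metric_change : forall c d x, atlas c -> atlas d -> overlap c d x ->
    metric c x = 'J (transition c d) x *m metric d (transition c d x)
                   *m ('J (transition c d) x)^T }.

Section LocalFormulas.
Context {R : realType} {n : nat}.

Definition partial {W : normedModType R} (i : 'I_n) (h : 'rV[R]_n -> W)
  (x : 'rV[R]_n) : W := 'D_(delta_mx 0 i) h x.

(* nabla_k e_i = \sum_j (christoffel G k x) i j e_j for the Levi-Civita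
   connection of the metric with components G. *)
Definition christoffel (G : 'rV[R]_n -> 'M[R]_n) (k : 'I_n) (x : 'rV[R]_n) :
  'M[R]_n :=
  \matrix_(i, j) (2^-1 * \sum_l
    (partial k G x i l + partial i G x k l - partial l G x k i)
      * invmx (G x) l j).

(* R(e_k, e_l) e_i = \sum_j (curvature G k l x) i j e_j; as matrices act on the
   right, nabla_k (nabla_l e_i) contributes christoffel l *m christoffel k. *)
Definition curvature (G : 'rV[R]_n -> 'M[R]_n) (k l : 'I_n) (x : 'rV[R]_n) :
  'M[R]_n :=
  partial k (christoffel G l) x - partial l (christoffel G k) x
  + christoffel G l x *m christoffel G k x
  - christoffel G k x *m christoffel G l x.

(* (nabla_k L) e_i = \sum_j (cov_deriv G L k x) i j e_j for an endomorphism
   field L, where L e_i = \sum_j (L x) i j e_j. *)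
Definition cov_deriv (G L : 'rV[R]_n -> 'M[R]_n) (k : 'I_n) (x : 'rV[R]_n) :
  'M[R]_n :=
  partial k L x + L x *m christoffel G k x - christoffel G k x *m L x.

End LocalFormulas.

Section Maps.
Context {R : realType} {n m : nat} (M : manifold R n).

Definition smooth_map (g : M -> 'rV[R]_m) : Prop :=
  forall c, atlas c -> smooth_on (cimg c) (g \o cparam c).

(* The differential of g in the chart c, at the point with coordinates x. *)
Definition dmap (g : M -> 'rV[R]_m) (c : chart R n M) (x : 'rV[R]_n) :
  'M[R]_(n, m) := 'J (g \o cparam c) x.

Definition immersion (g : M -> 'rV[R]_m) : Prop :=
  smooth_map g /\
  forall c x, atlas c -> cimg c x -> row_free (dmap g c x).

Definition induced_metric (g : M -> 'rV[R]_m) (c : chart R n M)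
  (x : 'rV[R]_n) : 'M[R]_n := dmap g c x *m (dmap g c x)^T.

(* A family of maps g t, t in the interval I, defined on an open U. *)
Definition smooth_family (I : set R) (U : set M) (g : R -> M -> 'rV[R]_m) :
  Prop :=
  forall c, atlas c ->
    smooth_on (I `*` (cimg c `&` cparam c @^-1` U))
      (fun q : R * 'rV[R]_n => g q.1 (cparam c q.2)).

End Maps.

Definition isometric_immersion (R : realType) (n m : nat) (M : riemannian R n)
  (f : M -> 'rV[R]_m) : Prop :=
  immersion f /\
  forall c x, atlas c -> cimg c x -> induced_metric f c x = metric c x.

Section Variations.
Context {R : realType} {n m : nat} {M : manifold R n}.
Implicit Types (f : M -> 'rV[R]_m) (I : set R) (F : R -> M -> 'rV[R]_m).

(* Derivative at 0 of a function defined on the interval I, which is one-sided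
   if 0 is an end point of I. *)
Definition deriv0 {W : normedModType R} I (h : R -> W) : W :=
  lim ((fun t => t^-1 *: (h t - h 0)) @ within I 0^').

Definition is_variation f I F : Prop :=
  [/\ is_interval I /\ (exists2 t, I t & t != 0), I 0,
      smooth_family I setT F,
      F 0 = f &
      forall t, I t -> immersion (F t)].

Definition variational_field I F (p : M) : 'rV[R]_m :=
  deriv0 I (fun t => F t p).

(* The entries of induced_metric (F t) c x are <f_t* e_i, f_t* e_j> for the
   coordinate fields e_i, which suffice since the condition is tensorial. *)
Definition infinitesimal_variation I F : Prop :=
  forall c x, atlas c -> cimg c x ->
    deriv0 I (fun t => induced_metric (F t) c x) = 0.

Definition trivial_bending f (U : set M) (T : M -> 'rV[R]_m) : Prop :=
  exists (D : 'M[R]_m) (w : 'rV[R]_m),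
    D^T = - D /\ forall p, U p -> T p = f p *m D + w.

Definition nowhere_trivial f I F : Prop :=
  forall U : set M, open U -> U !=set0 ->
    ~ trivial_bending f U (variational_field I F).

Definition unit_normal (g : M -> 'rV[R]_m) (p : M) (nu : 'rV[R]_m) : Prop :=
  nu *m nu^T = 1%:M /\
  forall c, atlas c -> cdom c p -> dmap g c (coord c p) *m nu^T = 0.

Definition gauss_family I F (U : set M) (N : R -> M -> 'rV[R]_m) : Prop :=
  smooth_family I U N /\
  forall t p, I t -> U p -> unit_normal (F t) p (N t p).

(* Gauss maps are taken locally, where they exist and are unique up to sign, so
   that no orientability assumption is hidden here. *)
Definition preserves_gauss_map I F : Prop :=
  forall p : M, exists (U : set M) (N : R -> M -> 'rV[R]_m),
    [/\ open U, U p, gauss_family I F U N &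
        forall q, U q -> deriv0 I (fun t => N t q) = 0].

End Variations.

Section Hypersurfaces.
Context {R : realType} {n : nat} {M : riemannian R n}.
Implicit Types (f : M -> 'rV[R]_n.+1) (c : chart R n M).

Definition flat_point (p : M) : Prop :=
  forall c, atlas c -> cdom c p ->
    forall k l, curvature (metric c) k l (coord c p) = 0.

Definition second_form f c (nu : 'rV[R]_n.+1) (x : 'rV[R]_n) : 'M[R]_n :=
  \matrix_(i, j) (partial i (partial j (f \o cparam c)) x *m nu^T) 0 0.

Definition mean_curvature f c (nu : 'rV[R]_n.+1) (x : 'rV[R]_n) : R :=
  n%:R^-1 * \tr (second_form f c nu x *m invmx (metric c x)).

Definition minimal f : Prop :=
  forall p nu, unit_normal f p nu ->
    forall c, atlas c -> cdom c p -> mean_curvature f c nu (coord c p) = 0.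

Definition kaehler_structure (J : chart R n M -> 'rV[R]_n -> 'M[R]_n) : Prop :=
  [/\ forall c, atlas c -> smooth_on (cimg c) (J c),
      forall c d x, atlas c -> atlas d -> overlap c d x ->
        J c x *m 'J (transition c d) x
        = 'J (transition c d) x *m J d (transition c d x),
      forall c x, atlas c -> cimg c x -> J c x *m J c x = - 1%:M,
      forall c x, atlas c -> cimg c x ->
        J c x *m metric c x *m (J c x)^T = metric c x &
      forall c x k, atlas c -> cimg c x -> cov_deriv (metric c) (J c) k x = 0].

Definition smooth_curve (gam : R -> M) : Prop :=
  continuous gam /\
  forall c, atlas c -> smooth_on (gam @^-1` cdom c) (coord c \o gam).

(* The line integral of om along gam restricted to [0, 1] equals s. Here om is
   an R^m-valued 1-form, v |-> v *m om c x in the chart c, and h t is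
   om (gam' t), computed in any chart around gam t. *)
Definition line_integral {m : nat} (om : chart R n M -> 'rV[R]_n -> 'M[R]_(n, m))
  (gam : R -> M) (s : 'rV[R]_m) : Prop :=
  exists h : R -> 'rV[R]_m,
    (forall c t, `[0, 1]%classic t -> atlas c -> cdom c (gam t) ->
       h t = 'D_1 (coord c \o gam) t *m om c (coord c (gam t))) /\
    forall i, s 0 i =
      (\int[@lebesgue_measure R]_(t in `[0, 1]) (h t 0 i))%R.

(* ftheta x is the integral of f_* o J_theta from x0 to x, along every smooth
   curve. *)
Definition associated_member f (J : chart R n M -> 'rV[R]_n -> 'M[R]_n)
  (theta : R) (x0 : M) (ftheta : M -> 'rV[R]_n.+1) : Prop :=
  forall gam, smooth_curve gam -> gam 0 = x0 ->
    line_integral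
      (fun c x => (cos theta *: 1%:M + sin theta *: J c x) *m dmap f c x)
      gam (ftheta (gam 1)).

Definition conjugate_hypersurface f (J : chart R n M -> 'rV[R]_n -> 'M[R]_n)
  (x0 : M) (fbar : M -> 'rV[R]_n.+1) : Prop :=
  associated_member f J (pi / 2) x0 fbar.

(* p |-> (y p, z p) is an isometry of U onto the Riemannian product N x V: a
   smooth bijection pulling back the product metric to the metric of M (its
   inverse is then smooth by the inverse function theorem). *)
Definition product_isometry {k d : nat} (U : set M) (N : riemannian R k)
  (V : set 'rV[R]_d) (y : M -> N) (z : M -> 'rV[R]_d) : Prop :=
  [/\ set_bij U (setT `*` V) (fun p => (y p, z p)),
      forall p, U p -> {for p, continuous y},
      forall c, atlas c ->
        smooth_on (cimg c `&` cparam c @^-1` U) (z \o cparam c),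
      forall c e, atlas c -> atlas e ->
        smooth_on (cimg c `&` cparam c @^-1` (U `&` y @^-1` cdom e))
          (coord e \o y \o cparam c) &
      forall c e p, atlas c -> atlas e -> U p -> cdom c p -> cdom e (y p) ->
        metric c (coord c p) =
          'J (coord e \o y \o cparam c) (coord c p)
            *m metric e (coord e (y p))
            *m ('J (coord e \o y \o cparam c) (coord c p))^T
          + induced_metric z c (coord c p)].

(* The Euclidean motion (g, z) |-> (g, z) *m Q + b goes from
   R^(k+1) x R^d = R^(n+1), where k + d = n; as the two dimensions agree,
   Q *m Q^T = 1 says that Q is orthogonal. *)
Definition part_of_cylinder f (U : set M) : Prop :=
  exists (k d : nat) (N : riemannian R k) (V : set 'rV[R]_d)
         (y : M -> N) (z : M -> 'rV[R]_d) (g : N -> 'rV[R]_k.+1)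
         (Q : 'M[R]_(k.+1 + d, n.+1)) (b : 'rV[R]_n.+1),
    [/\ (k + d)%N = n /\ (1 <= d)%N, open V /\ product_isometry U V y z,
        isometric_immersion g, Q *m Q^T = 1%:M &
        forall p, U p -> f p = row_mx (g (y p)) (z p) *m Q + b].

End Hypersurfaces.

(* Paths and homotopies are functions on R and R * R considered on [0, 1] and
   [0, 1] x [0, 1] only. *)
Definition simply_connected (R : realType) (T : topologicalType) : Prop :=
  [/\ [set: T] !=set0,
      forall p q : T, exists gam : R -> T,
        [/\ {within `[0, 1], continuous gam}, gam 0 = p & gam 1 = q] &
      forall gam : R -> T, {within `[0, 1], continuous gam} ->
        gam 0 = gam 1 ->
        exists H : R * R -> T,
          {within `[0, 1] `*` `[0, 1], continuous H} /\
          forall t, `[0, 1]%classic t ->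
            [/\ H (0, t) = gam t, H (1, t) = gam 0,
                H (t, 0) = gam 0 & H (t, 1) = gam 0]].

(* Main.v *)
(* In a chart let B and C be the differentials of f and of the variational field
   T, G = B B^T the metric and N the Gauss map. Preserving the Gauss map to first
   order gives C N^T = 0, hence T_* = f_* o L with L = C B^T G^-1, and L is skew.
   Symmetry of the second derivatives of T makes L parallel and makes L H
   symmetric for the second fundamental form H, so L anticommutes with the shape
   operator A. Being parallel, L commutes with the curvature, which by Gauss
   is built from H; as this curvature does not vanish, L^2 = mu on the image of
   A, and the Codazzi equation makes mu locally constant. Then Z = (L^2 - mu) B
   satisfies the linear system dZ = Gam Z, so its row space is a constant space
   of tangent directions; if it were nonzero, f would be locally a cylinder over
   a graph. So L^2 = mu, where mu < 0 because L is skew and does not vanish (a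
   zero of L propagates, making T locally constant, hence trivial). Therefore
   J = L / sqrt(- mu) is a parallel orthogonal complex structure, L A = - A L
   gives trace A = 0, and T_* = sqrt(- mu) f_* o J integrates along curves. *)

Require Import Defs.
From HB Require Import structures.
From mathcomp Require Import all_boot all_order all_algebra.
From mathcomp Require Import all_classical all_reals all_analysis.
From mathcomp Require Import ring lra.
Import Order.TTheory GRing.Theory Num.Theory.
Import numFieldNormedType.Exports.
Local Open Scope classical_set_scope.
Local Open Scope ring_scope.

Set Implicit Arguments.
Unset Strict Implicit.
Unset Printing Implicit Defensive.

(** * Calculus of smooth maps *)

(** A Gauss map, and every neighbourhood obtained from it, exists only near a point, so the argument
    stays local until the last step. Integration of the structure equations is replaced by one
    uniqueness principle: if dU = Gam U + U Del, then a zero of U forces U to vanish on a ball whose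
    radius depends on Gam and Del alone. It is applied to L, to L^2 - mu for every scalar mu, to Z v
    for every constant vector v and, with zero coefficients, to differences X - X(x). The system for
    Z closes up because dB = Gam B + h N and L^2 - mu annihilates the columns h of the second
    fundamental form, so that the normal term disappears. Nonzero curvature means that two of these
    columns are independent; this drives both the eigenvalue argument for L^2 and the constancy of
    mu. The cylinder comes from the inverse function theorem: over its tangent space at one point f
    is a graph, and the height does not change in the directions spanned by Z. The number sqrt(- mu)
    is chosen point by point, and becomes the constant c once points are joined by paths. *)

Section DifferentiabilityCriteria.
Context {R : realType} {V W : normedModType R}.
Implicit Types (h g : V -> W) (x v : V).

(** An epsilon criterion with an explicit candidate for the differential, the form in which a local
    inverse is later shown to be differentiable. *)
Lemma differentiable_littleo h x (A : {linear V -> W}) : continuous A ->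
  (forall e : R, 0 < e ->
     \forall y \near x, `|h y - h x - A (y - x)| <= e * `|y - x|) ->
  differentiable h x.
Proof.
move=> cA hA.
have E : h \o shift x = cst (h x) + A +o_ (0:V) id.
  apply/eqaddoP => e e0; have := hA e e0.
  rewrite (near_shift 0 x) /= subr0 => H; near=> y.
  have : `|h (y + x) - h x - A (y + x - x)| <= e * `|y + x - x| by near: y.
  by rewrite !addrK /= !fctE opprD addrA.
have D := diff_unique cA E.
by apply/diff_locallyP; rewrite D.
Unshelve. all: by end_near. Qed.

Lemma littleo_differentiable h x : differentiable h x ->
  forall e : R, 0 < e ->
     \forall y \near x, `|h y - h x - 'd h x (y - x)| <= e * `|y - x|.
Proof.
move=> /diff_locallyP[_ /eqaddoP H] e e0.
have : \forall y \near (0:V), `|(h \o shift x - (cst (h x) + 'd h x)) y| <= e * `|y|.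
  exact: H.
rewrite (near_shift x 0) /= sub0r => K; near=> y.
have : ((fun x0 : V => `|(h \o shift x - (cst (h x) + 'd h x)) x0| <= e * `|id x0|)
   \o shift (-x)) y by near: y.
by rewrite /= !fctE subrK opprD addrA.
Unshelve. all: by end_near. Qed.

Lemma near_eq_differentiable h g x : (\near x, h x = g x) ->
  differentiable h x -> differentiable g x.
Proof.
move=> hg dh; apply: (@differentiable_littleo _ _ ('d h x)).
  by apply: diff_continuous.
move=> e e0; have H := littleo_differentiable dh e0.
have E := nbhs_singleton hg; near=> y.
have <- : h y = g y by near: y.
by rewrite -E; near: y.
Unshelve. all: by end_near. Qed.

End DifferentiabilityCriteria.

Section CkAlgebra.
Context {R : realType} {V : normedModType R}.
Implicit Types (U : set V) (W : normedModType R).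

(** Openness of [U] turns agreement on [U] into agreement near each point, so that all directional
    derivatives agree too. *)
Lemma Ck_ext W k U (h g : V -> W) : open U -> (forall x, U x -> h x = g x) ->
  Ck k U h -> Ck k U g.
Proof.
move=> oU; elim: k h g => [|k IH] h g hg.
  move=> ch x Ux; have := ch x Ux; rewrite /prop_for /continuous_at -hg //.
  move=> H; apply: cvg_trans H; apply: near_eq_cvg.
  by near=> y; apply: hg; near: y; exact: open_nbhs_nbhs.
have near_hg x : U x -> \near x, h x = g x.
  by move=> Ux; near=> y; apply: hg; near: y; exact: open_nbhs_nbhs.
move=> [dh Dh]; split=> [x Ux|v].
  by apply: near_eq_differentiable (dh x Ux); exact: near_hg.
apply: IH (Dh v) => x Ux; apply: near_eq_derive; exact: near_hg.
Unshelve. all: by end_near. Qed.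

Lemma Ck_sub W k U U' (h : V -> W) : U' `<=` U -> Ck k U h -> Ck k U' h.
Proof.
move=> sU; elim: k h => [|k IH] h /=; first by move=> H x /sU; exact: H.
by move=> [dh Dh]; split=> [x /sU|v]; [exact: dh|exact/IH/Dh].
Qed.

Lemma CkS W k U (h : V -> W) : Ck k.+1 U h -> Ck k U h.
Proof.
elim: k h => [|k IH] h [dh Dh].
  by move=> x Ux; exact/differentiable_continuous/dh.
by split=> // v; exact/IH/Dh.
Qed.

Lemma Ck_cst W k U (a : W) : Ck k U (fun=> a).
Proof.
elim: k a => [|k IH] a /=; first by move=> x _; exact: cvg_cst.
split=> [x _|v]; first exact: differentiable_cst.
have -> : (fun x : V => 'D_v (fun=> a) x) = fun=> 0 by apply/funext => x; exact: derive_cst.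
exact: IH.
Qed.

Lemma CkD W k U (h g : V -> W) : open U -> Ck k U h -> Ck k U g ->
  Ck k U (fun x => h x + g x).
Proof.
move=> oU; elim: k h g => [|k IH] h g /=.
  by move=> ch cg x Ux; apply: cvgD; [exact: ch|exact: cg].
move=> [dh Dh] [dg Dg]; split=> [x Ux|v].
  by apply: differentiableD; [exact: dh|exact: dg].
apply: Ck_ext (IH _ _ (Dh v) (Dg v)) => // x Ux; rewrite deriveD //; apply: diff_derivable; auto.
Qed.

Lemma Ck_linear W W' (A : {linear W -> W'}) k U (h : V -> W) : open U ->
  continuous A -> Ck k U h -> Ck k U (fun x => A (h x)).
Proof.
move=> oU cA; elim: k h => [|k IH] h /=.
  by move=> ch x Ux; apply: continuous_comp; [exact: ch|exact: cA].
have dA y : differentiable A y by exact: linear_differentiable.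
move=> [dh Dh]; split=> [x Ux|v].
  by apply: differentiable_comp; [exact: dh|].
apply: Ck_ext (IH _ (Dh v)) => // x Ux.
have dhx := dh x Ux; rewrite deriveE // -[RHS]/('D_v (A \o h) x).
rewrite [RHS]deriveE; last exact: differentiable_comp.
by rewrite (diff_comp dhx (dA _)) /= diff_lin.
Qed.

Lemma CkM k U (h g : V -> R) : open U -> Ck k U h -> Ck k U g ->
  Ck k U (fun x => h x * g x).
Proof.
move=> oU; elim: k h g => [|k IH] h g.
  by move=> ch cg x Ux; apply: cvgM; [exact: ch|exact: cg].
move=> hk gk; have [dh Dh] := hk; have [dg Dg] := gk; split=> [x Ux|v].
  by apply: differentiableM; [exact: dh|exact: dg].
apply: (@Ck_ext _ _ _ (fun x => h x * 'D_v g x + g x * 'D_v h x)) => //.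
  by move=> x Ux; rewrite deriveM //; apply: diff_derivable; auto.
apply: (CkD (W := R)) => //; apply: IH.
- exact: CkS.
- exact: Dg.
- exact: CkS.
- exact: Dh.
Qed.

Lemma CkN W k U (h : V -> W) : open U -> Ck k U h -> Ck k U (fun x => - h x).
Proof.
move=> oU; elim: k h => [|k IH] h /=.
  by move=> ch x Ux; apply: cvgN; exact: ch.
move=> [dh Dh]; split=> [x Ux|v]; first by apply: differentiableN; exact: dh.
apply: Ck_ext (IH _ (Dh v)) => // x Ux; rewrite deriveN //; apply: diff_derivable; auto.
Qed.

Lemma CkV k U (h : V -> R) : open U -> (forall x, U x -> h x != 0) -> Ck k U h ->
  Ck k U (fun x => (h x)^-1).
Proof.
move=> oU h0; elim: k => [|k IH].
  by move=> ch x Ux; apply: cvgV; [exact: h0|exact: ch].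
move=> hk; have [dh Dh] := hk; split=> [x Ux|v].
  by apply: differentiableV; [exact: dh|exact: h0].
have hV := IH (CkS hk).
apply: (@Ck_ext _ _ _ (fun x => - ((h x)^-1 * (h x)^-1) * 'D_v h x)) => //.
  move=> x Ux; rewrite deriveV ?h0 //; last by apply: diff_derivable; auto.
  by rewrite /GRing.scale /= -expr2 exprVn.
by apply: CkM; [|apply: (CkN (W := R)) => //; apply: CkM|exact: Dh].
Qed.

Lemma Ck_sum W I (r : seq I) (P : pred I) k U (h : I -> V -> W) : open U ->
  (forall i, P i -> Ck k U (h i)) -> Ck k U (fun x => \sum_(i <- r | P i) h i x).
Proof.
move=> oU Hh; elim: r => [|i r IH].
  by under eq_fun do rewrite big_nil; exact: Ck_cst.
have [Pi|Pi] := boolP (P i); last by under eq_fun do rewrite big_cons (negbTE Pi).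
under eq_fun do rewrite big_cons Pi.
by apply: CkD => //; exact: Hh.
Qed.

Lemma Ck_prod I (r : seq I) (P : pred I) k U (h : I -> V -> R) : open U ->
  (forall i, P i -> Ck k U (h i)) -> Ck k U (fun x => \prod_(i <- r | P i) h i x).
Proof.
move=> oU Hh; elim: r => [|i r IH].
  by under eq_fun do rewrite big_nil; exact: Ck_cst.
have [Pi|Pi] := boolP (P i); last by under eq_fun do rewrite big_cons (negbTE Pi).
under eq_fun do rewrite big_cons Pi.
by apply: CkM => //; exact: Hh.
Qed.

End CkAlgebra.

Section CkMatrix.
Context {R : realType} {V : normedModType R}.
Implicit Types U : set V.

Lemma coord_is_linear m n i j : linear (fun A : 'M[R]_(m, n) => A i j).
Proof. by move=> a A B; rewrite !mxE. Qed.

Definition coord_linear m n i j : {linear 'M[R]_(m, n) -> R} :=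
  HB.pack (fun A : 'M[R]_(m, n) => A i j)
    (GRing.isLinear.Build _ _ _ _ _ (@coord_is_linear m n i j)).

Lemma differentiable_mxP m n (h : V -> 'M[R]_(m, n)) x :
  differentiable h x <-> forall i j, differentiable (fun y => h y i j) x.
Proof.
split=> [dh i j|dh].
  apply: (@differentiable_comp _ _ _ _ h (fun A : 'M[R]_(m, n) => A i j)) => //.
  exact: differentiable_coord.
have -> : h = \sum_i \sum_j (fun y => h y i j *: delta_mx i j).
  apply/funext => y; rewrite [LHS]matrix_sum_delta fct_sumE.
  by apply: eq_bigr => i _; rewrite fct_sumE.
apply: differentiable_sum => i; apply: differentiable_sum => j.
exact: differentiableZl.
Qed.

Lemma continuous_mxP m n (h : V -> 'M[R]_(m, n)) x :
  {for x, continuous h} <-> forall i j, {for x, continuous (fun y => h y i j)}.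
Proof.
split=> [ch i j|ch].
  apply: (@continuous_comp _ _ _ h (fun A : 'M[R]_(m, n) => A i j)) => //.
  exact: coord_continuous.
have -> : h = (fun y => \sum_i \sum_j h y i j *: delta_mx i j).
  by apply/funext => y; rewrite [LHS]matrix_sum_delta.
apply: cvg_big => [|i _]; first exact: add_continuous.
apply: cvg_big => [|j _]; first exact: add_continuous.
by apply: cvgZr_tmp; exact: ch.
Qed.

Lemma derive_coord m n (h : V -> 'M[R]_(m, n)) x v i j : derivable h x v ->
  'D_v (fun y => h y i j) x = ('D_v h x) i j.
Proof. by move=> dh; rewrite derive_mx // mxE. Qed.

Lemma Ck_mxP m n k U (h : V -> 'M[R]_(m, n)) : open U ->
  Ck k U h <-> forall i j, Ck k U (fun x => h x i j).
Proof.
move=> oU; split=> [hk i j|].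
  exact: (@Ck_linear _ _ _ _ (coord_linear i j) _ _ _ oU (@coord_continuous _ _ _ i j)).
elim: k h => [|k IH] h hk.
  by move=> x Ux; apply/continuous_mxP => i j; exact: hk.
have dh x : U x -> differentiable h x.
  by move=> Ux; apply/differentiable_mxP => i j; have [+ _] := hk i j; exact.
split=> // v; apply: IH => i j.
have [_ /(_ v)] := hk i j; apply: Ck_ext => // x Ux.
by apply: derive_coord; apply: diff_derivable; exact: dh.
Qed.

End CkMatrix.

(** Unlike [smooth_on], this differentiates the map itself rather than local extensions of it;
    [smooth_onP] identifies the two notions on open sets. *)
Definition smooth {R : realType} {V W : normedModType R} (U : set V) (h : V -> W) : Prop :=
  forall k, Ck k U h.

Section SmoothOpen.
Context {R : realType} {V W : normedModType R}.
Implicit Types (U A : set V) (h : V -> W).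

(** [Ck] on a set is a condition at each of its points on a map defined everywhere, so the sets [U]
    may vary with the point. *)
Lemma Ck_local k A h : (forall x, A x -> exists2 U, U x & Ck k U h) -> Ck k A h.
Proof.
elim: k h => [|k IH] h H; first by move=> x /H[U Ux]; exact.
split=> [x /H[U Ux [dh _]]|v]; first exact: dh.
by apply: IH => x /H[U Ux [_ Dh]]; exists U => //; exact: Dh.
Qed.

Lemma smooth_onP A h : open A -> smooth_on A h <-> smooth A h.
Proof.
move=> oA; split=> [sh k|sh x Ax]; last by exists A, h.
apply: Ck_local => x Ax; have [U [h' [oU Ux h'k h'h]]] := sh x Ax.
exists (U `&` A) => //; apply: (@Ck_ext _ _ _ _ _ h').
- exact: openI.
- by move=> y [Uy Ay]; exact: h'h.
- by apply: Ck_sub (h'k k) => y [].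
Qed.

Lemma smooth_differentiable U h x : smooth U h -> U x -> differentiable h x.
Proof. by move=> /(_ 1)[+ _]; exact. Qed.

Lemma smooth_derivable U h x v : smooth U h -> U x -> derivable h x v.
Proof. by move=> sh Ux; exact/diff_derivable/(smooth_differentiable sh). Qed.

Lemma smooth_continuous U h x : smooth U h -> U x -> {for x, continuous h}.
Proof. by move=> /(_ 0); exact. Qed.

Lemma smooth_derive U h v : smooth U h -> smooth U ('D_v h).
Proof. by move=> sh k; have [_] := sh k.+1; exact. Qed.

Lemma smooth_ext U h g : open U -> (forall x, U x -> h x = g x) ->
  smooth U h -> smooth U g.
Proof. by move=> oU hg sh k; exact: Ck_ext (sh k). Qed.

Lemma smooth_sub U U' h : U' `<=` U -> smooth U h -> smooth U' h.
Proof. by move=> sU sh k; exact: Ck_sub (sh k). Qed.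

Lemma smooth_cst U (a : W) : smooth U (fun=> a).
Proof. by move=> k; exact: Ck_cst. Qed.

Lemma smoothD U h g : open U -> smooth U h -> smooth U g -> smooth U (fun x => h x + g x).
Proof. by move=> oU sh sg k; apply: CkD; [|exact: sh|exact: sg]. Qed.

Lemma smoothN U h : open U -> smooth U h -> smooth U (fun x => - h x).
Proof. by move=> oU sh k; apply: CkN; [|exact: sh]. Qed.

Lemma smoothB U h g : open U -> smooth U h -> smooth U g -> smooth U (fun x => h x - g x).
Proof. by move=> oU sh sg; apply: smoothD => //; exact: smoothN. Qed.

End SmoothOpen.

Lemma smooth_id {R : realType} {V : normedModType R} (U : set V) : smooth U (fun x : V => x).
Proof.
move=> [|k]; first by move=> x _; exact: cvg_id.
split=> [x _|v]; first by have [] := is_diff_id x.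
have -> : (fun x : V => 'D_v id x) = fun=> v by apply/funext => x; exact: derive_id.
exact: Ck_cst.
Qed.

Section SmoothMatrix.
Context {R : realType} {V : normedModType R}.
Implicit Types U : set V.

Lemma smooth_mxP m n U (h : V -> 'M[R]_(m, n)) : open U ->
  smooth U h <-> forall i j, smooth U (fun x => h x i j).
Proof.
move=> oU; split=> [sh i j k|sh k]; first by have /Ck_mxP := sh k; exact.
by apply/Ck_mxP => // i j; exact: sh.
Qed.

Lemma smooth_mulmx m n p U (A : V -> 'M[R]_(m, n)) (B : V -> 'M[R]_(n, p)) :
  open U -> smooth U A -> smooth U B -> smooth U (fun x => A x *m B x).
Proof.
move=> oU /smooth_mxP-/(_ oU) sA /smooth_mxP-/(_ oU) sB.
apply/smooth_mxP => // i j k; under eq_fun do rewrite mxE.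
by apply: Ck_sum => // l _; apply: CkM => //; [exact: sA|exact: sB].
Qed.

Lemma smooth_trmx m n U (A : V -> 'M[R]_(m, n)) :
  open U -> smooth U A -> smooth U (fun x => (A x)^T).
Proof.
move=> oU /smooth_mxP-/(_ oU) sA; apply/smooth_mxP => // i j.
by under eq_fun do rewrite mxE; exact: sA.
Qed.

Lemma smooth_det n U (A : V -> 'M[R]_n) :
  open U -> smooth U A -> smooth U (fun x => \det (A x)).
Proof.
move=> oU /smooth_mxP-/(_ oU) sA k; rewrite /determinant.
apply: Ck_sum => // s _; apply: CkM => //; first exact: Ck_cst.
by apply: Ck_prod => // i _; exact: sA.
Qed.

Lemma smooth_invmx n U (A : V -> 'M[R]_n) : open U ->
  (forall x, U x -> A x \in unitmx) -> smooth U A ->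
  smooth U (fun x => invmx (A x)).
Proof.
move=> oU uA sA.
(* Cramer's rule: the entries of the inverse are polynomials in the entries divided by the
   determinant. *)
apply: (@smooth_ext _ _ _ _ (fun x => (\det (A x))^-1 *: \adj (A x))) => //.
  by move=> x Ux; rewrite /invmx uA.
apply/smooth_mxP => // i j k; under eq_fun do rewrite !mxE.
apply: CkM => //.
  apply: CkV => //; last exact: smooth_det.
  by move=> x Ux; rewrite -unitfE -unitmxE uA.
apply: CkM => //; first exact: Ck_cst.
apply: smooth_det => //; apply/smooth_mxP => // i' j'.
by under eq_fun do rewrite !mxE; have /smooth_mxP := sA; exact.
Qed.

End SmoothMatrix.

Section DerivativeRules.
Context {R : realType} {V : normedModType R}.

Lemma derivable_mulmx m n p (A : V -> 'M[R]_(m, n)) (B : V -> 'M[R]_(n, p)) x v :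
  derivable A x v -> derivable B x v -> derivable (fun y => A y *m B y) x v.
Proof.
move=> /derivable_mxP dA /derivable_mxP dB; apply/derivable_mxP => i j.
have -> : (fun y => (A y *m B y) i j) = \sum_k (fun y => A y i k * B y k j).
  by apply/funext => y; rewrite mxE fct_sumE.
exact: derivable_sum (fun k => derivableM (dA i k) (dB k j)).
Qed.

Lemma derive_mulmx m n p (A : V -> 'M[R]_(m, n)) (B : V -> 'M[R]_(n, p)) x v :
  derivable A x v -> derivable B x v ->
  'D_v (fun y => A y *m B y) x = 'D_v A x *m B x + A x *m 'D_v B x.
Proof.
move=> dA dB; apply/matrixP => i j.
have /derivable_mxP dA' := dA; have /derivable_mxP dB' := dB.
rewrite -derive_coord; last exact: derivable_mulmx.
under [X in 'D_v X _]eq_fun do rewrite mxE.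
rewrite (_ : (fun _ => _) = \sum_k (fun y => A y i k * B y k j)); last first.
  by apply/funext => y; rewrite fct_sumE.
rewrite (derive_sum (fun k => derivableM (dA' i k) (dB' k j))).
rewrite !mxE -big_split /=; apply: eq_bigr => k _.
rewrite deriveM // !derive_coord // addrC /GRing.scale /=.
by rewrite [X in _ + X]mulrC.
Qed.

Lemma derivable_trmx m n (A : V -> 'M[R]_(m, n)) x v :
  derivable A x v -> derivable (fun y => (A y)^T) x v.
Proof.
move=> /derivable_mxP dA; apply/derivable_mxP => i j.
by under eq_fun do rewrite mxE; exact: dA.
Qed.

Lemma derive_trmx m n (A : V -> 'M[R]_(m, n)) x v : derivable A x v ->
  'D_v (fun y => (A y)^T) x = ('D_v A x)^T.
Proof.
move=> dA; apply/matrixP => i j; rewrite -derive_coord; last exact: derivable_trmx.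
by under [X in 'D_v X _]eq_fun do rewrite mxE; rewrite derive_coord // mxE.
Qed.

End DerivativeRules.

Section Jacobian.
Context {R : realType}.

Lemma derive_comp (V V' W : normedModType R) (g : V' -> W) (h : V -> V') x v :
  differentiable h x -> differentiable g (h x) ->
  'D_v (g \o h) x = 'D_('D_v h x) g (h x).
Proof.
move=> dh dg; rewrite deriveE; last exact: differentiable_comp.
by rewrite (diff_comp dh dg) /= (deriveE _ dg) (deriveE _ dh).
Qed.

Lemma derive_dirE n (W : normedModType R) (h : 'rV[R]_n -> W) x v :
  differentiable h x -> 'D_v h x = \sum_k v 0 k *: 'D_(delta_mx 0 k) h x.
Proof.
move=> dh; rewrite deriveE // {1}(row_sum_delta v) linear_sum /=.
by apply: eq_bigr => k _; rewrite linearZ /= deriveE.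
Qed.

Lemma row_jacobian m n (h : 'rV[R]_m -> 'rV[R]_n) x i : differentiable h x ->
  row i ('J h x) = 'D_(delta_mx 0 i) h x.
Proof. by move=> dh; rewrite rowE -deriveEjacobian. Qed.

Lemma jacobianE m n (h : 'rV[R]_m -> 'rV[R]_n) x i j : differentiable h x ->
  'J h x i j = ('D_(delta_mx 0 i) h x) 0 j.
Proof. by move=> dh; rewrite -(row_jacobian _ dh) [RHS]mxE. Qed.

Lemma jacobian_comp m n p (g : 'rV[R]_n -> 'rV[R]_p) (h : 'rV[R]_m -> 'rV[R]_n) x :
  differentiable h x -> differentiable g (h x) ->
  'J (g \o h) x = 'J h x *m 'J g (h x).
Proof.
move=> dh dg; have dgh : differentiable (g \o h) x by exact: differentiable_comp.
apply/row_matrixP => i; rewrite row_mul (row_jacobian _ dgh) (row_jacobian _ dh).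
by rewrite derive_comp // (deriveEjacobian _ dg).
Qed.

Lemma near_eq_jacobian m n (g h : 'rV[R]_m -> 'rV[R]_n) x :
  differentiable g x -> (\near x, g x = h x) -> 'J g x = 'J h x.
Proof.
move=> dg gh; have dh := near_eq_differentiable gh dg.
apply/row_matrixP => i; apply: etrans (row_jacobian i dg) _.
by apply: etrans (esym (row_jacobian i dh)); exact: near_eq_derive.
Qed.

Lemma smooth_jacobian m n U (h : 'rV[R]_m -> 'rV[R]_n) : open U ->
  smooth U h -> smooth U (jacobian h).
Proof.
move=> oU sh; apply/smooth_mxP => // i j.
apply: (@smooth_ext _ _ _ _ (fun x => ('D_(delta_mx 0 i) h x) 0 j)) => //.
  by move=> x Ux; rewrite jacobianE //; exact: smooth_differentiable sh Ux.
by have /smooth_mxP-/(_ oU) := smooth_derive (delta_mx 0 i) sh; exact.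
Qed.

End Jacobian.

Section Composition.
Context {R : realType} {V : normedModType R}.

Lemma smooth_affine {V' W : normedModType R} (A : {linear V -> V'}) (b : V') U (h : V' -> W) :
  continuous A -> open U -> smooth U h ->
  smooth ((fun x => A x + b) @^-1` U) (fun x => h (A x + b)).
Proof.
move=> cA oU sh k; elim: k h sh => [|k IH] h sh.
  move=> x /= Ux; apply: (@continuous_comp _ _ _ (fun x => A x + b) h).
    by apply: cvgD; [exact: cA|exact: cvg_cst].
  exact: smooth_continuous sh Ux.
have dA x : differentiable (fun x => A x + b) x.
  by apply: differentiableD; [exact: linear_differentiable|exact: differentiable_cst].
split=> [x /= Ux|v].
  apply: (@differentiable_comp _ _ _ _ (fun x => A x + b) h) => //.
  exact: smooth_differentiable sh Ux.
have oU' : open ((fun x => A x + b) @^-1` U).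
  apply: open_comp => // x _; exact/differentiable_continuous/dA.
apply: Ck_ext (IH _ (smooth_derive (A v) sh)) => // x Ux.
rewrite (@derive_comp _ _ _ _ h (fun x => A x + b)) //; last first.
  exact: smooth_differentiable sh Ux.
congr ('D_ _ h _); rewrite deriveD ?derive_cst ?addr0; last 2 first.
- exact/diff_derivable/linear_differentiable.
- exact/diff_derivable/differentiable_cst.
by rewrite deriveE ?diff_lin //; exact: linear_differentiable.
Qed.

(** The inner map is only assumed of finite order [k]: the regularity of a local inverse is
    bootstrapped by composing with a map known to be of that order only. The induction runs on the
    chain rule in coordinates, which needs one order less of the inner map. *)
Lemma Ck_comp n k (U : set V) (U' : set 'rV[R]_n) (h : 'rV[R]_n -> R) (u : V -> 'rV[R]_n) :
  open U -> (forall x, U x -> U' (u x)) -> Ck k U u -> smooth U' h -> Ck k U (h \o u).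
Proof.
move=> oU uU; elim: k h => [|k IH] h uk sh.
  move=> x Ux; apply: continuous_comp; first exact: uk.
  by apply: smooth_continuous sh _; exact: uU.
have [du Du] := uk; split=> [x Ux|v].
  apply: differentiable_comp; first exact: du.
  by apply: smooth_differentiable sh _; exact: uU.
apply: (@Ck_ext _ _ _ _ _ (fun x => \sum_i ('D_v u x) 0 i * 'D_(delta_mx 0 i) h (u x))) => //.
  move=> x Ux; have dh : differentiable h (u x).
    by apply: smooth_differentiable sh _; exact: uU.
  by rewrite (derive_comp _ (du _ Ux) dh) (derive_dirE _ dh).
apply: Ck_sum => // i _; apply: CkM => //.
  by have /Ck_mxP-/(_ oU 0 i) := Du v.
exact: IH (CkS uk) (smooth_derive (delta_mx 0 i) sh).
Qed.

Lemma Ck_comp_mx n p q k (U : set V) (U' : set 'rV[R]_n) (h : 'rV[R]_n -> 'M[R]_(p, q))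
    (u : V -> 'rV[R]_n) :
  open U -> open U' -> (forall x, U x -> U' (u x)) -> Ck k U u -> smooth U' h ->
  Ck k U (h \o u).
Proof.
move=> oU oU' uU uk /smooth_mxP-/(_ oU') sh; apply/Ck_mxP => // i j.
exact: (Ck_comp oU uU uk (sh i j)).
Qed.

End Composition.

(** * Symmetry of second derivatives *)

Section Schwarz.
Context {R : realType}.

Lemma derive_line {V W : normedModType R} (h : V -> W) (a v : V) (t : R) :
  derivable h (a + t *: v) v ->
  is_derive t 1 (fun s : R => h (a + s *: v)) ('D_v h (a + t *: v)).
Proof.
move=> dh; have E : (fun s : R => s^-1 *: (((fun s : R => h (a + s *: v)) \o shift t) (s *: 1)
    - h (a + t *: v))) = (fun s : R => s^-1 *: ((h \o shift (a + t *: v)) (s *: v) - h (a + t *: v))).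
  apply/funext => s /=; congr (_ *: (h _ - _)).
  by rewrite -[s *: 1]/(s * 1) mulr1 scalerDl addrCA.
by apply: DeriveDef; rewrite /derivable ?/derive E.
Qed.

Lemma MVT_line {V : normedModType R} (h : V -> R) (a v : V) (t : R) : 0 < t ->
  (forall s, 0 <= s <= t -> differentiable h (a + s *: v)) ->
  exists2 s, 0 <= s <= t & h (a + t *: v) - h a = t * 'D_v h (a + s *: v).
Proof.
move=> t0 dh.
have dl s : 0 <= s <= t -> is_derive s 1 (fun s : R => h (a + s *: v)) ('D_v h (a + s *: v)).
  by move=> st; apply: derive_line; apply: diff_derivable; exact: dh.
have [| |s] := @MVT_segment R (fun s => h (a + s *: v)) (fun s => 'D_v h (a + s *: v)) 0 t (ltW t0).
- by move=> s; rewrite in_itv /= => /andP[s0 s1]; apply: dl; rewrite !ltW.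
- apply: derivable_within_continuous => s; rewrite in_itv /= => st.
  by have [] := dl s st.
rewrite in_itv /= => st; rewrite scale0r addr0 subr0 mulrC => E.
by exists s.
Qed.

(** The mean value theorem is used twice: along [u] for y -> h (y + t v) - h y, then along [v] for
    the derivative of [h] in direction [u]. *)
Lemma second_difference {V : normedModType R} (U : set V) (h : V -> R) (x u v : V) (t : R) :
  smooth U h -> 0 < t ->
  (forall a b, 0 <= a <= t -> 0 <= b <= t -> U (x + a *: u + b *: v)) ->
  exists a b, [/\ 0 <= a <= t, 0 <= b <= t &
    h (x + t *: u + t *: v) - h (x + t *: u) - (h (x + t *: v) - h x)
    = t * (t * 'D_v ('D_u h) (x + a *: u + b *: v))].
Proof.
move=> sh t0 HU; have t01 : 0 <= t <= t by rewrite lexx ltW.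
have z01 : 0 <= (0 : R) <= t by rewrite lexx ltW.
have su := smooth_derive u sh.
pose g := fun y => h (y + t *: v) - h y.
have dshift a : 0 <= a <= t -> differentiable (fun y => h (y + t *: v)) (x + a *: u).
  move=> a01; apply: (@differentiable_comp _ _ _ _ (fun y => y + t *: v) h).
    by apply: differentiableD.
  by apply: smooth_differentiable sh _; exact: HU.
have d0 a : 0 <= a <= t -> differentiable h (x + a *: u).
  move=> a01; apply: smooth_differentiable sh _.
  by rewrite -[_ + _]addr0 -(scale0r v); exact: HU.
have [|a a01 Ea] := @MVT_line V g x u t t0.
  by move=> s s01; apply: differentiableB; [exact: dshift|exact: d0].
have [|b b01 Eb] := @MVT_line V ('D_u h) (x + a *: u) v t t0.
  by move=> s s01; apply: smooth_differentiable su _; exact: HU.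
exists a, b; split=> //; rewrite -Eb -[LHS]/(g (x + t *: u) - g x) Ea.
congr (_ * _); rewrite deriveB; last 2 first.
- exact/diff_derivable/dshift.
- exact/diff_derivable/d0.
congr (_ - _).
rewrite (@derive_comp _ _ _ _ h (fun y => y + t *: v)).
- by rewrite deriveD // derive_id derive_cst addr0.
- exact: differentiableD.
- by apply: smooth_differentiable sh _; exact: HU.
Qed.

(** The second difference is symmetric in [u] and [v], and divided by t^2 it is a value of either
    mixed derivative near [x]. Continuity of both mixed derivatives does the rest. *)
Lemma smooth_derive_comm_scalar {V : normedModType R} (U : set V) (h : V -> R) (x u v : V) :
  open U -> U x -> smooth U h -> 'D_v ('D_u h) x = 'D_u ('D_v h) x.
Proof.
move=> oU Ux sh; apply/eqP; rewrite -subr_eq0 -normr_le0; apply/ler_addgt0Pr => e e0.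
have e2 : 0 < e / 2 by rewrite divr_gt0.
(* For small t the whole parallelogram with sides t w and t w' type vectors at [x] lies in [U], and
   a mixed derivative varies there by less than e / 2. *)
have near_square w w' : \forall t \near (0 : R)^'+, forall a b, 0 <= a <= t -> 0 <= b <= t ->
    U (x + a *: u + b *: v) /\
    `|'D_w ('D_w' h) x - 'D_w ('D_w' h) (x + a *: u + b *: v)| < e / 2.
  have c := smooth_continuous (smooth_derive w (smooth_derive w' sh)) Ux.
  have /nbhs_ballP[d /= d0 Hd] : nbhs x (U `&`
      [set y | `|'D_w ('D_w' h) x - 'D_w ('D_w' h) y| < e / 2]).
    apply: filterI; first exact: open_nbhs_nbhs.
    by move/cvgrPdist_lt : c; exact.
  near=> t => a b /andP[a0 at1] /andP[b0 bt].
  apply: Hd; rewrite -ball_normE /= -addrA opprD addNKr normrN.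
  have t0 : 0 < t by [].
  apply: (@le_lt_trans _ _ (t * (`|u| + `|v|))).
    rewrite (le_trans (ler_normD _ _)) // mulrDr !normrZ !ger0_norm //.
    by apply: lerD; apply: ler_wpM2r.
  have n0 : 0 < `|u| + `|v| + 1 by rewrite ltr_wpDl // addr_ge0.
  apply: (@le_lt_trans _ _ (t * (`|u| + `|v| + 1))); first by rewrite ler_pM2l // lerDl.
  rewrite -ltr_pdivlMr //; near: t; apply: nbhs_right_lt; exact: divr_gt0.
have := filterI (@nbhs_right_gt R 0) (filterI (near_square v u) (near_square u v)).
move=> /(_ _ _)/filter_ex[t [/= t0 [H1 H2]]].
have [a b a01 b01|a [b [a01 b01 E1]]] := @second_difference V U h x u v t sh t0.
  by have [] := H1 a b a01 b01.
have [b' a' b01' a01'|b' [a' [b01' a01' E2]]] := @second_difference V U h x v u t sh t0.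
  by rewrite addrAC; have [] := H2 a' b' a01' b01'.
(* Both expressions equal the same second difference; dividing twice by t equates the mixed
   derivatives at two, possibly different, points. *)
have {E1 E2}E : 'D_v ('D_u h) (x + a *: u + b *: v) = 'D_u ('D_v h) (x + a' *: u + b' *: v).
  have tN0 : t != 0 by rewrite gt_eqF.
  apply: (mulfI tN0); apply: (mulfI tN0).
  rewrite [x + b' *: v + _]addrAC [x + t *: v + _]addrAC in E2.
  apply: etrans (esym E1) _; apply: etrans E2.
  by ring.
have [_ L1] := H1 a b a01 b01; have [_ L2] := H2 a' b' a01' b01'.
have tri (p q r s : R) : `|p - r| < e / 2 -> `|q - s| < e / 2 -> r = s -> `|p - q| <= 0 + e.
  move=> pr qs rs; rewrite add0r (splitr e) -(subrKA r); apply: le_trans (ler_normD _ _) _.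
  by apply: lerD; [exact: ltW|rewrite rs distrC ltW].
exact: tri L1 L2 E.
Unshelve. all: by end_near. Qed.

Lemma smooth_derive_comm {V : normedModType R} m n (U : set V) (h : V -> 'M[R]_(m, n)) (x u v : V) :
  open U -> U x -> smooth U h -> 'D_v ('D_u h) x = 'D_u ('D_v h) x.
Proof.
move=> oU Ux sh; apply/matrixP => i j.
have D w w' : ('D_w ('D_w' h) x) i j = 'D_w ('D_w' (fun y => h y i j)) x.
  rewrite -derive_coord; last exact: smooth_derivable (smooth_derive w' sh) Ux.
  apply: near_eq_derive; near=> y; have Uy : U y by near: y; exact: open_nbhs_nbhs.
  by rewrite derive_coord //; exact: smooth_derivable sh Uy.
have /smooth_mxP-/(_ oU i j) sij := sh.
apply: etrans (D v u) _; apply: etrans (esym (D u v)).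
exact: (@smooth_derive_comm_scalar V U (fun y => h y i j) x u v oU Ux sij).
Unshelve. all: by end_near. Qed.

End Schwarz.

(** * Linear systems and the inverse function theorem *)

Section MatrixNorm.
Context {R : realType}.

Lemma mx_norm_le m n (A : 'M[R]_(m, n)) c : 0 <= c ->
  (forall i j, `|A i j| <= c) -> `|A| <= c.
Proof.
move=> c0 Ac; rewrite /Num.Def.normr /= mx_normrE.
by apply: bigmax_le => // -[i j] _; exact: Ac.
Qed.

Lemma coord_norm_le m n (A : 'M[R]_(m, n)) i j : `|A i j| <= `|A|.
Proof. by rewrite [leRHS]/Num.Def.normr /= mx_normrE; apply: (le_bigmax _ _ (i, j)). Qed.

Lemma sum_le_const n (E : 'I_n -> R) c : (forall k, E k <= c) -> \sum_k E k <= n%:R * c.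
Proof.
move=> Ec; apply: (@le_trans _ _ (\sum_(k < n) c)); first exact: ler_sum.
by rewrite sumr_const card_ord mulr_natl.
Qed.

(** Radii chosen below have denominators of the form t + 1, positive even when the norm t vanishes;
    this bound absorbs such a fraction. *)
Lemma mul_frac_le (c t : R) : 0 <= c -> 0 <= t -> c * (t / (t + 1)) <= c.
Proof. by move=> c0 t0; rewrite ler_piMr // ler_pdivrMr ?ltr_wpDl // mul1r lerDl. Qed.

(** The norm is the sup norm of the entries, which is not submultiplicative; the factor counts the
    terms in an entry of the product. It is the source of the dimension factors in later
    constants. *)
Lemma mulmx_norm_le m n p (A : 'M[R]_(m, n)) (B : 'M[R]_(n, p)) :
  `|A *m B| <= n%:R * `|A| * `|B|.
Proof.
apply: mx_norm_le => [|i j]; first by rewrite !mulr_ge0.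
rewrite mxE; apply: le_trans (ler_norm_sum _ _ _) _.
by rewrite -mulrA; apply: sum_le_const => k; rewrite normrM ler_pM // coord_norm_le.
Qed.

End MatrixNorm.

Section MeanValue.
Context {R : realType}.

Definition convex_set {V : lmodType R} (A : set V) : Prop :=
  forall x y s, A x -> A y -> 0 <= s <= 1 -> A (x + s *: (y - x)).

Lemma closed_ball_convex {V : normedModType R} (p : V) (r : R) :
  convex_set [set x | `|p - x| <= r].
Proof.
move=> x y s /= px py /andP[s0 s1].
have -> : p - (x + s *: (y - x)) = (1 - s) *: (p - x) + s *: (p - y).
  rewrite scalerBl scale1r -addrA [- _ + _]addrC -scalerBr opprD addrA; congr (_ + _).
  by rewrite -scalerN; congr (_ *: _); rewrite !opprB [RHS]addrC subrKA.
apply: le_trans (ler_normD _ _) _; rewrite !normrZ !ger0_norm ?subr_ge0 //.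
rewrite -[leRHS]mul1r -[X in _ <= X * r](subrK s) [leRHS]mulrDl.
by apply: lerD; rewrite ler_wpM2l ?subr_ge0.
Qed.

Lemma mean_value_coord {V : normedModType R} m n (A : set V) (h : V -> 'M[R]_(m, n)) x y i j :
  convex_set A -> (forall z, A z -> differentiable h z) -> A x -> A y ->
  exists2 z, A z & h y i j - h x i j = ('D_(y - x) h z) i j.
Proof.
move=> cA dh Ax Ay.
have dhij z : A z -> differentiable (fun z => h z i j) z.
  by move=> Az; have /differentiable_mxP := dh z Az; exact.
have [|s s01] := @MVT_line R V (fun z => h z i j) x (y - x) 1 ltr01.
  by move=> s s01; apply: dhij; exact: cA.
rewrite scale1r [x + (y - x)]addrC subrK mul1r => E.
exists (x + s *: (y - x)); first exact: cA.
rewrite E derive_coord //; apply: diff_derivable; exact/dh/cA.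
Qed.

(** The intermediate point depends on the entry, which costs nothing since the norm is the largest
    entry. *)
Lemma mean_value_le {V : normedModType R} m n (A : set V) (h : V -> 'M[R]_(m, n)) x y K :
  convex_set A -> (forall z, A z -> differentiable h z) -> A x -> A y -> 0 <= K ->
  (forall z, A z -> `|'D_(y - x) h z| <= K) ->
  `|h y - h x| <= K.
Proof.
move=> cA dh Ax Ay K0 hK; apply: mx_norm_le => // i j; rewrite !mxE.
have [z Az ->] := mean_value_coord i j cA dh Ax Ay.
by apply: le_trans (hK z Az); exact: coord_norm_le.
Qed.

Lemma derive_norm_le n a b (h : 'rV[R]_n -> 'M[R]_(a, b)) x v K : differentiable h x ->
  (forall k, `|partial k h x| <= K) -> `|'D_v h x| <= n%:R * `|v| * K.
Proof.
move=> dh hK; rewrite (derive_dirE _ dh).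
apply: le_trans (ler_norm_sum _ _ _) _.
rewrite -mulrA; apply: sum_le_const => k; rewrite normrZ ler_pM // ?coord_norm_le //; exact: hK.
Qed.

End MeanValue.

Section LinearODE.
Context {R : realType}.

(** Let |u| be largest on the compact closed ball at c. The mean value inequality between x and c
    gives |u c| <= n (2 s) K |u c| <= |u c| / 2, hence u vanishes on the ball. *)
Lemma zero_propagation n a b (u : 'rV[R]_n -> 'M[R]_(a, b)) (p : 'rV[R]_n) (s K : R) :
  0 <= K -> n%:R * (2 * s) * K <= 2^-1 ->
  (forall x, `|p - x| <= s -> differentiable u x) ->
  (forall x k, `|p - x| <= s -> `|partial k u x| <= K * `|u x|) ->
  forall x y, `|p - x| <= s -> `|p - y| <= s -> u x = 0 -> u y = 0.
Proof.
move=> K0 sK du Du x y px py ux.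
pose B := [set z : 'rV[R]_n | `|p - z| <= s].
have Bx : B x by [].
have cB : compact B.
  apply: bounded_closed_compact.
    exists (`|p| + s); split; first exact: num_real.
    move=> c pc z Bz; apply: ltW; apply: le_lt_trans pc.
    by rewrite -[z](subKr p); apply: le_trans (ler_normB _ _) _; rewrite lerD2l.
  have -> : B = closed_ball_ (fun z : 'rV[R]_n => `|z|) p s by [].
  exact: closed_closed_ball_.
have [c] : exists2 c : 'rV[R]_n, c \in B & forall t, t \in B -> `|u t| <= `|u c|.
  apply: EVT_max_rV => //; first by exists x.
  apply: continuous_in_subspaceT => z Bz.
  apply: (@continuous_comp _ _ _ u (fun w => `|w|)).
    by apply/differentiable_continuous/du; exact/set_mem.
  exact: norm_continuous.
rewrite inE => Bc maxc.
have le2s z w : B z -> B w -> `|w - z| <= 2 * s.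
  move=> Bz Bw; have -> : w - z = (p - z) - (p - w) by rewrite opprB [RHS]addrC subrKA.
  by apply: le_trans (ler_normB _ _) _; rewrite mulrDl mul1r lerD.
have H : `|u c - u x| <= n%:R * (2 * s) * (K * `|u c|).
  have s0 : 0 <= s by apply: le_trans px.
  apply: (mean_value_le (@closed_ball_convex _ _ p s)) => //.
    by rewrite !mulr_ge0.
  move=> z Bz; apply: le_trans (@derive_norm_le _ _ _ _ u z _ (K * `|u c|) (du z Bz) _) _.
    move=> k; apply: le_trans (Du z k Bz) _.
    by apply: ler_wpM2l => //; apply: maxc; rewrite inE.
  by apply: ler_wpM2r; [rewrite mulr_ge0|apply: ler_wpM2l => //; exact: le2s].
have uc : u c = 0.
  apply/eqP; rewrite -normr_le0.
  move: H; rewrite ux subr0 mulrA => H.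
  have : `|u c| <= 2^-1 * `|u c| by apply: le_trans H _; exact: ler_wpM2r.
  by lra.
by apply/eqP; rewrite -normr_le0 -(normr0 'M[R]_(a,b)) -uc; apply: maxc; rewrite inE.
Qed.

(** The radius is fixed before [u]: it depends only on bounds for the coefficients near [p]. One
    ball therefore serves a whole family of solutions, such as L^2 - mu for all mu or Z v for all
    v. *)
Lemma linear_ode_zero n a b (U : set 'rV[R]_n) (p : 'rV[R]_n)
    (Gam : 'I_n -> 'rV[R]_n -> 'M[R]_a) (Del : 'I_n -> 'rV[R]_n -> 'M[R]_b) :
  open U -> U p -> (forall k, {for p, continuous (Gam k)}) ->
  (forall k, {for p, continuous (Del k)}) ->
  exists r : R, [/\ 0 < r, ball p r `<=` U &
    forall u : 'rV[R]_n -> 'M[R]_(a, b),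
      (forall x, ball p r x -> differentiable u x) ->
      (forall x k, ball p r x ->
         partial k u x = Gam k x *m u x + u x *m Del k x) ->
      forall x y, ball p r x -> ball p r y -> u x = 0 -> u y = 0].
Proof.
move=> oU Up cG cD.
have near_bound m (E : 'I_n -> 'rV[R]_n -> 'M[R]_m) :
    (forall k, {for p, continuous (E k)}) ->
    \forall x \near p, forall k, `|E k x| <= \sum_k (`|E k p| + 1).
  move=> cE; suff H k : \forall x \near p, `|E k x| <= \sum_k (`|E k p| + 1).
    exact: (filter_forall _ H).
  have /cvgrPdist_le/(_ 1 ltr01) H := cE k; near=> x.
  have Hx : `|E k p - E k x| <= 1 by near: x.
  rewrite (bigD1 k) //=; apply: (@le_trans _ _ (`|E k p| + 1)); last first.
    by rewrite lerDl; apply: sumr_ge0 => *; rewrite addr_ge0.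
  rewrite -[E k x](subKr (E k p)); apply: le_trans (ler_normB _ _) _.
  by rewrite lerD2l.
set g := \sum_k (`|Gam k p| + 1); set d := \sum_k (`|Del k p| + 1).
have g0 : 0 <= g by apply: sumr_ge0 => *; rewrite addr_ge0.
have d0 : 0 <= d by apply: sumr_ge0 => *; rewrite addr_ge0.
pose K := a%:R * g + b%:R * d.
have K0 : 0 <= K by rewrite addr_ge0 // mulr_ge0.
have [e /= e0 He] : exists2 e : R, 0 < e & ball p e `<=` U `&`
   [set x | (forall k, `|Gam k x| <= g) /\ (forall k, `|Del k x| <= d)].
  apply/nbhs_ballP; apply: filterI; first exact: open_nbhs_nbhs.
  by apply: filterI; exact: near_bound.
(* With this radius n (2 q) K <= 1/2, the smallness asked for by [zero_propagation]; the [+ 1]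
   covers the case n K = 0. *)
pose q := (4 * (n%:R * K + 1))^-1.
have nK : 0 < n%:R * K + 1 by rewrite ltr_wpDl // mulr_ge0.
have q0 : 0 < q by rewrite invr_gt0 mulr_gt0.
have ge_min_l : Num.min e q <= e by rewrite ge_min lexx.
exists (Num.min e q); split; first by rewrite lt_min e0.
  by move=> x xr; have [] := He x (le_ball ge_min_l xr).
move=> u du Du x y px py.
(* The closed ball just reaching x and y is compact, and lies in the open ball because s is strictly
   below its radius. *)
pose s := Num.max `|p - x| `|p - y|.
have sr : s < Num.min e q.
  by move: px py; rewrite -ball_normE /= => px py; rewrite /s gt_max px.
have Bs z : `|p - z| <= s -> ball p (Num.min e q) z.
  by rewrite -ball_normE /= => /le_lt_trans; exact.
apply: (@zero_propagation n a b u p s K) => //.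
- have sq : s <= q by apply: ltW; apply: lt_le_trans sr _; rewrite ge_min lexx orbT.
  apply: (@le_trans _ _ (n%:R * (2 * q) * K)).
    by apply: ler_wpM2r => //; apply: ler_wpM2l => //; apply: ler_wpM2l.
  have -> : n%:R * (2 * q) * K = 2^-1 * ((n%:R * K) / (n%:R * K + 1)).
    by rewrite /q; field; rewrite ?gt_eqF.
  by apply: mul_frac_le => //; exact: mulr_ge0.
- by move=> z /Bs; exact: du.
- move=> z k pz; have Bz := Bs z pz; rewrite Du //.
  have [_ [Hg Hd]] := He z (le_ball ge_min_l Bz).
  apply: le_trans (ler_normD _ _) _; rewrite /K mulrDl.
  apply: lerD; apply: le_trans (mulmx_norm_le _ _) _.
    by apply: ler_wpM2r => //; apply: ler_wpM2l.
  by rewrite mulrAC; apply: ler_wpM2r => //; apply: ler_wpM2l.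
- by rewrite le_max lexx.
- by rewrite le_max lexx orbT.
Unshelve. all: by end_near. Qed.

End LinearODE.

Section InverseFunction.
Context {R : realType} {n : nat}.

Lemma mulmxr_continuous m p (A : 'M[R]_(m, p)) :
  continuous (mulmxr A : 'rV[R]_m -> 'rV[R]_p).
Proof.
move=> x; apply: (@smooth_continuous R _ _ setT) => //.
by apply: smooth_mulmx; [exact: openT|exact: smooth_id|exact: smooth_cst].
Qed.

Lemma lipschitz_continuous_at {V W : normedModType R} (h : V -> W) (A : set V) (C : R) x :
  0 <= C -> open A -> A x -> (forall y, A y -> `|h y - h x| <= C * `|y - x|) ->
  {for x, continuous h}.
Proof.
move=> C0 oA Ax hC; apply/cvgrPdist_le => d d0; have C1 : 0 < C + 1 by rewrite ltr_wpDl.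
near=> t; apply: (@le_trans _ _ (C * `|x - t|)).
  by rewrite distrC [X in C * X]distrC; apply: hC; near: t; exact: open_nbhs_nbhs.
have Ht : `|x - t| <= d / (C + 1).
  near: t; apply/nbhs_ballP; exists (d / (C + 1)); first exact: divr_gt0.
  by move=> y; rewrite -ball_normE /= => /ltW.
apply: le_trans (ler_wpM2l C0 Ht) _.
by rewrite mulrCA; apply: mul_frac_le => //; exact: ltW.
Unshelve. all: by end_near. Qed.

Lemma near_unitmx {V : normedModType R} m (U : set V) (A : V -> 'M[R]_m) x :
  open U -> smooth U A -> U x -> A x \in unitmx -> \forall y \near x, A y \in unitmx.
Proof.
move=> oU sA Ux uA; have c := smooth_continuous (smooth_det oU sA) Ux.
have d0 : \det (A x) != 0 by rewrite -unitfE -unitmxE.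
near=> y; rewrite unitmxE unitfE; near: y.
exact: (cvgr_neq0 _ c d0).
Unshelve. all: by end_near. Qed.

(** Solving psi x = s is a fixed point problem for a contraction. The fixed point is found as a
    minimiser of the displacement on a compact ball. The Jacobian is passed as a separate function
    [J], smooth by hypothesis. *)
Lemma inverse_function (U : set 'rV[R]_n) (psi : 'rV[R]_n -> 'rV[R]_n)
    (J : 'rV[R]_n -> 'M[R]_n) (p : 'rV[R]_n) :
  open U -> U p -> smooth U psi -> smooth U J ->
  (forall x v, U x -> 'D_v psi x = v *m J x) -> J p \in unitmx ->
  exists (r rho : R) (chi : 'rV[R]_n -> 'rV[R]_n),
    [/\ 0 < r, 0 < rho, ball p r `<=` U,
      forall x y, ball p r x -> ball p r y -> psi x = psi y -> x = y &
      (forall s, ball (psi p) rho s -> ball p r (chi s) /\ psi (chi s) = s) /\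
      smooth (ball (psi p) rho) chi].
Proof.
move=> oU Up spsi sJ psiJ uJ; set A := invmx (J p).
(* Newton's map with frozen derivative: its differential 1 - J A vanishes at [p], so it contracts
   near [p]. *)
pose g := fun x => x - psi x *m A.
have dpsi x : U x -> differentiable psi x by exact: smooth_differentiable.
have sg : smooth U g.
  apply: smoothB => //; first exact: smooth_id.
  by apply: smooth_mulmx => //; exact: smooth_cst.
have dg x : U x -> differentiable g x by exact: smooth_differentiable.
have Dg x v : U x -> 'D_v g x = v *m (1%:M - J x *m A).
  move=> Ux; have dx := @diff_derivable _ _ _ psi x v (dpsi x Ux).
  have d1 := derivable_mulmx dx (derivable_cst A x v).
  have d2 : derivable (fun y : 'rV[R]_n => y) x v by exact: derivable_id.
  rewrite (deriveB d2 d1) (derive_mulmx dx (derivable_cst A x v)).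
  rewrite derive_id derive_cst mulmx0 addr0 mulmxBr mulmx1.
  by rewrite psiJ // mulmxA.
(* The bound with the factor n, which compensates [mulmx_norm_le], makes g a contraction by 1/2. *)
have [e /= e0 He] : exists2 e : R, 0 < e & ball p e `<=` U `&`
   [set x | J x \in unitmx /\ n%:R * `|1%:M - J x *m A| <= 2^-1].
  apply/nbhs_ballP; apply: filterI; first exact: open_nbhs_nbhs.
  apply: filterI.
    exact: near_unitmx oU sJ Up uJ.
  have s1 : smooth U (fun x => 1%:M - J x *m A).
    apply: smoothB => //; first exact: smooth_cst.
    by apply: smooth_mulmx => //; exact: smooth_cst.
  have c := smooth_continuous s1 Up.
  have e1 : 0 < (2 * (n%:R + 1))^-1 :> R by rewrite invr_gt0 mulr_gt0 // ltr_wpDl.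
  have /cvgrPdist_lt/(_ _ e1) H := c; near=> x.
  have : `|(1%:M - J p *m A) - (1%:M - J x *m A)| < (2 * (n%:R + 1))^-1 by near: x.
  rewrite mulmxV // subrr sub0r normrN => /ltW Hx /=.
  apply: le_trans (ler_wpM2l _ Hx) _ => //.
  by rewrite ler_pdivrMr ?mulr_gt0 // ?ltr_wpDl // mulKf // lerDl.
pose r := e / 2.
have r0 : 0 < r by rewrite divr_gt0.
have reE x : `|p - x| <= r -> ball p e x.
  rewrite -ball_normE /= => /le_lt_trans; apply; rewrite /r; lra.
have contr x y : `|p - x| <= r -> `|p - y| <= r -> `|g y - g x| <= 2^-1 * `|y - x|.
  move=> px py; apply: (mean_value_le (@closed_ball_convex _ _ p r) _ px py).
  - by move=> z /reE/He[Uz _]; exact: dg.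
  - by rewrite mulr_ge0.
  - move=> z /reE/He[Uz [_ Hz]]; rewrite Dg //.
    apply: le_trans (mulmx_norm_le _ _) _; rewrite mulrAC.
    by apply: ler_wpM2r.
(* Since y - x = (g y - g x) + (psi y - psi x) A and the first term is at most half of |y - x|, the
   other term controls y - x. This gives injectivity of psi and the Lipschitz bound for its
   inverse. *)
have lip x y : `|p - x| <= r -> `|p - y| <= r -> `|y - x| <= 2 * n%:R * `|A| * `|psi y - psi x|.
  move=> px py; have := contr x y px py; set G := g y - g x => HG.
  have E : y - x = G + (psi y - psi x) *m A.
    rewrite /G /g mulmxBl; move: (psi x *m A) (psi y *m A) => a b.
    by apply/rowP => i; rewrite !mxE; ring.
  have := ler_normD G ((psi y - psi x) *m A); rewrite -E.
  have := mulmx_norm_le (psi y - psi x) A.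
  set a := `|y - x| in HG *; set b := `|_ *m _|; set c := `|G| in HG *.
  move=> H1 H2; have -> : 2 * n%:R * `|A| * `|psi y - psi x| = 2 * (n%:R * `|psi y - psi x| * `|A|) by ring.
  lra.
pose C := 2 * n%:R * `|A|.
have C0 : 0 <= C by rewrite /C !mulr_ge0.
(* The minimiser is sought in a closed ball strictly inside the open ball of radius r. *)
pose r2 := r / 2.
have r20 : 0 < r2 by rewrite divr_gt0.
pose B := [set x | `|p - x| <= r2].
have Br x : B x -> `|p - x| < r by move=> /le_lt_trans; apply; rewrite /r2; lra.
have nA : 0 < n%:R * `|A| + 1 by rewrite ltr_wpDl // mulr_ge0.
(* Chosen so that n rho |A| <= r2 / 2; together with the contraction by 1/2, the map T below sends
   the closed ball B into itself. *)
pose rho := r2 / (2 * (n%:R * `|A| + 1)).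
have rho0 : 0 < rho by rewrite divr_gt0 // mulr_gt0.
have ex_sol (s : 'rV[R]_n) : ball (psi p) rho s -> exists x, ball p r x /\ psi x = s.
  rewrite -ball_normE /= => ps.
  (* As T x - x = (s - psi x) A with A invertible, the fixed points of T are the solutions of psi x
     = s. *)
  pose T := fun x => g x + s *m A.
  have Tx x : T x - x = (s - psi x) *m A.
    rewrite /T /g mulmxBl; move: (psi x *m A) (s *m A) => a b.
    by apply/rowP => i; rewrite !mxE; ring.
  have Tp x : B x -> B (T x).
    move=> Bx; rewrite /B /=; have -> : p - T x = (g p - g x) - (s - psi p) *m A.
      rewrite /T /g mulmxBl; move: (psi x *m A) (psi p *m A) (s *m A) => a b c.
      by apply/rowP => i; rewrite !mxE; ring.
    apply: le_trans (ler_normB _ _) _.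
    have H1 := contr x p (ltW (Br x Bx)) _.
    have {}H1 : `|g p - g x| <= 2^-1 * `|p - x| by apply: H1; rewrite subrr normr0 ltW.
    have H2 := mulmx_norm_le (s - psi p) A.
    have H3 : n%:R * `|s - psi p| * `|A| <= r2 / 2.
      apply: (@le_trans _ _ (n%:R * rho * `|A|)).
        by apply: ler_wpM2r => //; apply: ler_wpM2l => //; rewrite distrC ltW.
      have -> : n%:R * rho * `|A| = r2 / 2 * ((n%:R * `|A|) / (n%:R * `|A| + 1)).
        by rewrite /rho; field; rewrite ?gt_eqF.
      by apply: mul_frac_le; [apply: divr_ge0 => //; exact: ltW|exact: mulr_ge0].
    have H4 : `|p - x| <= r2 by [].
    set a := `|g p - g x| in H1 *; set b := `|_ *m A| in H2 *.
    by apply: (@le_trans _ _ (2^-1 * r2 + r2 / 2)); [apply: lerD; lra|lra].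
  have [c] : exists2 c : 'rV[R]_n, c \in B & forall t, t \in B -> `|T c - c| <= `|T t - t|.
    apply: EVT_min_rV.
    - by exists p; rewrite /B /= subrr normr0 ltW.
    - apply: bounded_closed_compact.
        exists (`|p| + r2); split; first exact: num_real.
        move=> c pc z Bz; apply: ltW; apply: le_lt_trans pc.
        by rewrite -[z](subKr p); apply: le_trans (ler_normB _ _) _; rewrite lerD2l.
      have -> : B = closed_ball_ (fun z : 'rV[R]_n => `|z|) p r2 by [].
      exact: closed_closed_ball_.
    - apply: continuous_in_subspaceT => z /set_mem Bz.
      have [Uz _] := He z (reE z (ltW (Br z Bz))).
      apply: (@continuous_comp _ _ _ (fun w => T w - w) (fun w => `|w|)).
        apply: (@smooth_continuous _ _ _ U) => //.
        apply: smoothB => //; last exact: smooth_id.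
        by apply: smoothD => //; exact: smooth_cst.
      exact: norm_continuous.
  rewrite inE => Bc minc.
  have BTc := Tp c Bc.
  (* Minimality at c meets the contraction: the displacement at T c is at most half of that at c, so
     both vanish. *)
  have : `|T c - c| <= `|T (T c) - T c| by apply: minc; rewrite inE.
  have -> : T (T c) - T c = g (T c) - g c by rewrite /T opprD addrACA subrr addr0.
  move=> H1; have H2 := contr c (T c) (ltW (Br c Bc)) (ltW (Br _ BTc)).
  have : `|T c - c| <= 0 by have := normr_ge0 (T c - c); lra.
  rewrite normr_le0 Tx => /eqP H.
  exists c; split; first exact: Br.
  apply/esym/eqP; rewrite -subr_eq0; apply/eqP.
  by rewrite -[LHS](mulmxK (_ : A \in unitmx)) ?unitmx_inv // H mul0mx.
pose chi (s : 'rV[R]_n) : 'rV[R]_n := get [set x | ball p r x /\ psi x = s].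
have chiP (s : 'rV[R]_n) : ball (psi p) rho s -> ball p r (chi s) /\ psi (chi s) = s.
  by move=> /ex_sol/getPex.
have chi_lip (s t : 'rV[R]_n) : ball (psi p) rho s -> ball (psi p) rho t -> `|chi t - chi s| <= C * `|t - s|.
  move=> Bs Bt; have [+ s2] := chiP s Bs; have [+ t2] := chiP t Bt.
  rewrite -ball_normE /= => t1 s1.
  by rewrite -{2}s2 -{2}t2; apply: lip; exact: ltW.
have oB : open (ball (psi p) rho) by exact: ball_open.
have chi_cont (s : 'rV[R]_n) : ball (psi p) rho s -> {for s, continuous chi}.
  move=> Bs; apply: (lipschitz_continuous_at C0 oB Bs) => t Bt.
  exact: chi_lip.
have unitJ (s : 'rV[R]_n) : ball (psi p) rho s -> U (chi s) /\ J (chi s) \in unitmx.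
  move=> Bs; have [+ _] := chiP s Bs.
  by rewrite -ball_normE /= => /ltW/reE/He[Us [uJs _]].
have chi_diff (s : 'rV[R]_n) : ball (psi p) rho s -> differentiable chi s.
  move=> Bs; have [Us uJs] := unitJ s Bs.
  set Ji := invmx (J (chi s)).
  apply: (@differentiable_littleo _ _ _ _ _ (mulmxr Ji)).
    exact: mulmxr_continuous.
  move=> d d0.
  have dpos : 0 < n%:R * `|Ji| * C + 1 by rewrite ltr_wpDl // !mulr_ge0.
  have := littleo_differentiable (dpsi _ Us) (divr_gt0 d0 dpos).
  set d' := d / _ => /(chi_cont s Bs) H.
  near=> t.
  have Bt : ball (psi p) rho t by near: t; exact: open_nbhs_nbhs.
  have [_ Et] := chiP t Bt; have [_ Es] := chiP s Bs.
  have : `|psi (chi t) - psi (chi s) - 'd psi (chi s) (chi t - chi s)| <= d' * `|chi t - chi s|.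
    by near: t; exact: H.
  rewrite -(deriveE _ (dpsi _ Us)) psiJ // Et Es /= => Ht.
  (* The remainder of chi is, up to sign, that of psi times the inverse Jacobian; the Lipschitz
     bound converts |chi t - chi s| into |t - s|. *)
  have -> : chi t - chi s - (t - s) *m Ji = - ((t - s - (chi t - chi s) *m J (chi s)) *m Ji).
    by rewrite [(t - s - _) *m Ji]mulmxBl mulmxK // opprB.
  rewrite normrN; apply: le_trans (mulmx_norm_le _ _) _.
  apply: (@le_trans _ _ (n%:R * (d' * (C * `|t - s|)) * `|Ji|)).
    apply: ler_wpM2r => //; apply: ler_wpM2l => //; apply: le_trans Ht _.
    by apply: ler_wpM2l; [rewrite divr_ge0 // ltW|exact: chi_lip].
  have -> : n%:R * (d' * (C * `|t - s|)) * `|Ji| =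
      d * ((n%:R * `|Ji| * C) / (n%:R * `|Ji| * C + 1)) * `|t - s|.
    by rewrite /d'; field; rewrite gt_eqF.
  by apply: ler_wpM2r => //; apply: mul_frac_le; [exact: ltW|rewrite !mulr_ge0].
have Dchi (s v : 'rV[R]_n) : ball (psi p) rho s -> 'D_v chi s = v *m invmx (J (chi s)).
  move=> Bs; have [Us uJs] := unitJ s Bs.
  have E : v = 'D_v chi s *m J (chi s).
    rewrite -psiJ // -(derive_comp _ (chi_diff s Bs) (dpsi _ Us)).
    rewrite -[LHS](derive_id s v); apply: near_eq_derive; near=> t.
    have Bt : ball (psi p) rho t by near: t; exact: open_nbhs_nbhs.
    by have [_ Et] := chiP t Bt; rewrite /= Et.
  by rewrite {2}E mulmxK.
exists r, rho, chi; split=> //.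
- move=> x; rewrite -ball_normE /= => /ltW/reE/He[Ux _]; exact: Ux.
- move=> x y; rewrite -ball_normE /= => px py E.
  have := lip x y (ltW px) (ltW py); rewrite E subrr normr0 mulr0 normr_le0 subr_eq0.
  by move=> /eqP.
(* Bootstrap: the derivatives of chi are those of v J(chi)^-1 type, so if chi is of class C^k they
   are too, and chi is of class C^(k+1). *)
split=> //; elim=> [|k IH]; first exact: chi_cont.
split=> [|v]; first exact: chi_diff.
pose W := U `&` [set x | J x \in unitmx].
have oW : open W.
  rewrite openE => x [Ux ux]; apply: filterI; first exact: open_nbhs_nbhs.
  exact: near_unitmx oU sJ Ux ux.
apply: (@Ck_ext _ _ _ _ _ ((fun x => v *m invmx (J x)) \o chi)) => //.
  by move=> s Bs; rewrite Dchi.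
have sW : smooth W (fun x => v *m invmx (J x)).
  apply: smooth_mulmx => //; first exact: smooth_cst.
  apply: smooth_invmx => //; first by move=> x [].
  by apply: smooth_sub sJ => x [].
have chiW s : ball (psi p) rho s -> W (chi s) by move=> /unitJ.
exact: (Ck_comp_mx oB oW chiW IH sW).
Unshelve. all: by end_near. Qed.

End InverseFunction.

(** * Algebra of the structure equations at a point *)

Section MatrixEntries.
Context {R : pzRingType} {m n : nat}.
Implicit Types A B : 'M[R]_(m, n).

Lemma mxDE A B i j : (A + B) i j = A i j + B i j. Proof. by rewrite mxE. Qed.
Lemma mxNE A i j : (- A) i j = - A i j. Proof. by rewrite mxE. Qed.
Lemma mxZE a A i j : (a *: A) i j = a * A i j. Proof. by rewrite mxE. Qed.
Definition mx_linE := (mxDE, mxNE, mxZE).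

Lemma row_mulE p (X : 'I_m -> 'M[R]_(m, n)) (Y : 'M[R]_(n, p)) a i j :
  (forall i k, row i (X k) = row k (X i)) -> (X a *m Y) i j = (X i *m Y) a j.
Proof.
move=> X_sym; have -> : (X a *m Y) i j = (row i (X a) *m Y) 0 j by rewrite -row_mul [RHS]mxE.
by rewrite X_sym -row_mul mxE.
Qed.

End MatrixEntries.

Section PointwiseAlgebra.
Context {R : realFieldType} {n : nat}.

(** The orthogonal projections to the tangent space and to the normal line add up to the identity.
    Stacking N on B gives a square matrix F, invertible because F F^T is, and the sum P satisfies F
    P = F. *)
Lemma tangent_normal_split (B : 'M[R]_(n, n.+1)) (N : 'rV[R]_n.+1) :
  B *m B^T \in unitmx -> B *m N^T = 0 -> N *m N^T = 1%:M ->
  B^T *m invmx (B *m B^T) *m B + N^T *m N = 1%:M.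
Proof.
move=> uG BN NN; set P := _ + _.
pose F : 'M[R]_(1 + n, n.+1) := col_mx N B.
have NB : N *m B^T = 0 by rewrite -[LHS]trmxK trmx_mul trmxK BN trmx0.
have FF : F *m F^T = block_mx 1%:M 0 0 (B *m B^T).
  by rewrite /F tr_col_mx mul_col_row NN NB BN.
have dF : \det (F *m F^T) != 0.
  by rewrite FF det_ublock det1 mul1r; move: uG; rewrite unitmxE unitfE.
have uF : (F : 'M[R]_(n.+1)) \in unitmx.
  have : \det ((F : 'M[R]_(n.+1)) *m F^T) != 0 by [].
  by rewrite det_mulmx mulf_eq0 negb_or unitmxE unitfE => /andP[].
have : F *m (P - 1%:M) = 0.
  rewrite mulmxBr mulmx1 mulmxDr /F !mulmxA !mul_col_mx NB BN NN mulmxV //.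
  by rewrite !mul0mx !mul1mx add_col_mx addr0 add0r subrr.
move=> H; apply/eqP; rewrite -subr_eq0; apply/eqP.
by rewrite -[LHS](mulKmx uF); apply: etrans (congr1 _ H) _; rewrite mulmx0.
Qed.

End PointwiseAlgebra.

Section LinearAlgebraLemmas.
Context {R : realFieldType} {n : nat}.

Definition dotc (a b : 'cV[R]_n) : R := (a^T *m b) 0 0.

Lemma dotcD (x y c : 'cV[R]_n) : dotc (x + y) c = dotc x c + dotc y c.
Proof. by rewrite /dotc !mxE -big_split; apply: eq_bigr => i _; rewrite !mxE /= mulrDl. Qed.

Lemma dotcZ (x c : 'cV[R]_n) a : dotc (a *: x) c = a * dotc x c.
Proof. by rewrite /dotc !mxE mulr_sumr; apply: eq_bigr => i _; rewrite !mxE mulrA. Qed.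

Lemma mul_outer (a b c : 'cV[R]_n) : a *m b^T *m c = dotc b c *: a.
Proof. by rewrite -mulmxA [b^T *m c]mx11_scalar mul_mx_scalar. Qed.

(** The hypothesis says that u and v are independent, so some 2 x 2 minor is nonzero; dividing its
    entries by it gives the dual vectors. *)
Lemma dual_pair (u v : 'cV[R]_n) : v *m u^T != u *m v^T ->
  exists w z : 'cV[R]_n, [/\ dotc u w = 1, dotc v w = 0, dotc u z = 0 & dotc v z = 1].
Proof.
move=> uv; have [i [j ij]] : exists i j, u i 0 * v j 0 - u j 0 * v i 0 != 0.
  apply: contrapT => H; move/eqP: uv; apply; apply/matrixP => i j.
  have E : u i 0 * v j 0 = u j 0 * v i 0.
    by apply/eqP; rewrite -subr_eq0; apply/negPn/negP => nz; apply: H; exists i, j.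
  by rewrite !mxE !big_ord_recl !big_ord0 !mxE !addr0 mulrC -E mulrC.
set d := _ - _ in ij.
have dot_delta (x : 'cV[R]_n) a k : dotc x (a *: delta_mx k 0) = a * x k 0.
  by rewrite /dotc -scalemxAr -colE !mxE.
have dotD (x y z : 'cV[R]_n) : dotc x (y + z) = dotc x y + dotc x z.
  by rewrite /dotc mulmxDr mxE.
exists ((v j 0 / d) *: delta_mx i 0 + (- v i 0 / d) *: delta_mx j 0).
exists ((- u j 0 / d) *: delta_mx i 0 + (u i 0 / d) *: delta_mx j 0).
by split; rewrite dotD !dot_delta; (try (rewrite -[RHS](mulfV ij) /d)); field.
Qed.

(** In the symmetric algebra the equation reads v u' = u v'. As u and v are independent, u divides
    u' and v divides v' with the same quotient mu. The proof contracts with a dual pair instead of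
    invoking factorisation. *)
Lemma symmetric_product_eigen (u v u' v' : 'cV[R]_n) : v *m u^T != u *m v^T ->
  v *m u'^T + u' *m v^T = v' *m u^T + u *m v'^T ->
  exists mu, u' = mu *: u /\ v' = mu *: v.
Proof.
move=> /dual_pair[w [z [uw vw uz vz]]] E.
have mulE c : dotc u' c *: v + dotc v c *: u' = dotc u c *: v' + dotc v' c *: u.
  by rewrite -!mul_outer -!mulmxDl E.
have Ev' : v' = dotc u' w *: v - dotc v' w *: u.
  have := mulE w; rewrite uw vw scale0r addr0 scale1r => ->; by rewrite addrK.
have Eu' : u' = dotc v' z *: u - dotc u' z *: v.
  have := mulE z; rewrite uz vz scale0r add0r scale1r => <-; by rewrite addrC addKr.
have dotB (x y c : 'cV[R]_n) a b : dotc (a *: x - b *: y) c = a * dotc x c - b * dotc y c.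
  by rewrite -scaleNr dotcD !dotcZ mulNr.
have H1 : dotc v' w = 0.
  have : dotc v' w = - dotc v' w by rewrite {1}Ev' dotB vw uw mulr0 mulr1 sub0r.
  by lra.
have H2 : dotc u' z = 0.
  have : dotc u' z = - dotc u' z by rewrite {1}Eu' dotB vz uz mulr0 mulr1 sub0r.
  by lra.
rewrite H1 scale0r subr0 in Ev'; rewrite H2 scale0r subr0 in Eu'.
exists (dotc u' w); split=> //.
rewrite [LHS]Eu'; congr (_ *: _).
by rewrite Ev' dotcZ vz mulr1.
Qed.

(** Here q may depend on u: the equation says that the symmetric product of q' - mu q with the
    nonzero vector u vanishes, so the first factor is zero. *)
Lemma symmetric_product_eigen1 (u q q' w : 'cV[R]_n) mu : dotc u w = 1 ->
  q *m (mu *: u)^T + (mu *: u) *m q^T = q' *m u^T + u *m q'^T -> q' = mu *: q.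
Proof.
move=> uw E; pose e := q' - mu *: q.
have E0 : e *m u^T + u *m e^T = 0.
  rewrite /e mulmxBl linearB /= mulmxBr addrACA -E linearZ /= -opprD.
  by rewrite [(mu *: q)^T]linearZ /= -!scalemxAl -!scalemxAr subrr.
have E1 : e + dotc e w *: u = 0.
  have := congr1 (fun X => X *m w) E0.
  by rewrite mul0mx mulmxDl !mul_outer uw scale1r.
have E2 : dotc e w = 0.
  have : dotc (e + dotc e w *: u) w = 0 by rewrite E1 /dotc linear0 mul0mx mxE.
  by rewrite dotcD dotcZ uw; lra.
by move: E1; rewrite E2 scale0r addr0 => /subr0_eq.
Qed.

(* [H] has the h_k as columns: the second fundamental form. *)
Lemma commuting_eigen (S G H : 'M[R]_n) : G \in unitmx ->
  (S *m G)^T = S *m G -> G^T = G ->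
  (forall k l, S *m ((col l H *m (col k H)^T - col k H *m (col l H)^T) *m invmx G)
    = (col l H *m (col k H)^T - col k H *m (col l H)^T) *m invmx G *m S) ->
  (exists k l, col l H *m (col k H)^T != col k H *m (col l H)^T) ->
  exists mu, S *m H = mu *: H.
Proof.
move=> uG sSG sG comm [k0 [l0 kl]].
have GS : invmx G *m S = S^T *m invmx G.
  apply: (can_inj (mulKmx uG)); rewrite !mulmxA mulmxV // mul1mx.
  by rewrite -{1}sG -trmx_mul sSG mulmxK.
(* With u, v two columns of H, commuting with the rank-two operator built from them becomes, after
   removing [invmx G], S (v u^T - u v^T) = (v u^T - u v^T) S^T, an equality of symmetric
   products. *)
have E k l : col l H *m (S *m col k H)^T + (S *m col k H) *m (col l H)^T =
             (S *m col l H) *m (col k H)^T + col k H *m (S *m col l H)^T.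
  have := comm k l; set u := col k H; set v := col l H => C.
  have {}C : S *m (v *m u^T - u *m v^T) = (v *m u^T - u *m v^T) *m S^T.
    apply: (can_inj (mulmxK (_ : invmx G \in unitmx))); first by rewrite unitmx_inv.
    by rewrite -mulmxA C -!mulmxA GS.
  rewrite !trmx_mul !mulmxA.
  move: C; rewrite mulmxBr mulmxBl !mulmxA => C.
  move: C; move: (S *m v *m _) (S *m u *m _) (_ *m S^T) (_ *m S^T) => c b a d C.
  by rewrite -[c](subrK b) C addrAC subrK.
have [mu [Hk Hl]] := symmetric_product_eigen kl (E k0 l0).
have [w [z [uw _ _ _]]] := dual_pair kl.
(* The pair k0, l0 fixes mu; every other column is then compared with column k0 alone. *)
exists mu; apply/matrixP => i m.
have := @symmetric_product_eigen1 (col k0 H) (col m H) (S *m col m H) w mu uw.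
rewrite -Hk => /(_ (E k0 m)).
move=> /(congr1 (fun X : 'cV[R]_n => X i 0)); rewrite !mxE => <-.
by apply: eq_bigr => j _; rewrite mxE.
Qed.

End LinearAlgebraLemmas.

Section PointwiseGeometry.
Context {R : realFieldType} {n : nat}.
Variables (B C : 'M[R]_(n, n.+1)) (N : 'rV[R]_n.+1) (G iG L : 'M[R]_n).
Hypothesis GE : G = B *m B^T.
Hypothesis iGE : iG = invmx G.
Hypothesis LE : L = C *m B^T *m iG.
Hypothesis uG : G \in unitmx.

Lemma tr_gram : G^T = G. Proof. by rewrite GE trmx_mul trmxK. Qed.

Lemma gramV : G *m iG = 1%:M. Proof. by rewrite iGE mulmxV. Qed.

Lemma gramVl : iG *m G = 1%:M. Proof. by rewrite iGE mulVmx. Qed.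

Lemma LG : L *m G = C *m B^T.
Proof. by rewrite LE -mulmxA gramVl mulmx1. Qed.

Section SecondForm.
Variables (dB : 'I_n -> 'M[R]_(n, n.+1)) (Gam dG : 'I_n -> 'M[R]_n).
Hypothesis dB_sym : forall i k, row i (dB k) = row k (dB i).
Hypothesis GamE : forall k, Gam k = dB k *m B^T *m iG.
Hypothesis dGE : forall k, dG k = dB k *m B^T + B *m (dB k)^T.

(** Koszul's formula: with dG expanded by the product rule and the symmetry of second derivatives,
    four of the six terms cancel. What is left is the tangential component of the second
    derivatives. *)
Lemma christoffel_formula k :
  \matrix_(i, j) (2^-1 * \sum_l
    (dG k i l + dG i k l - dG l k i) * iG l j) = Gam k.
Proof.
apply/matrixP => i j; rewrite GamE [RHS]mxE mxE mulr_sumr; apply: eq_bigr => l _.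
rewrite mulrA; congr (_ * _).
have BdB a b c : (B *m (dB a)^T) b c = (dB a *m B^T) c b.
  have -> : B *m (dB a)^T = (dB a *m B^T)^T by rewrite trmx_mul trmxK.
  by rewrite [LHS]mxE.
rewrite !dGE !mx_linE !BdB (row_mulE _ i k l dB_sym) (row_mulE _ k l i dB_sym).
by rewrite (row_mulE _ i l k dB_sym); field.
Qed.

Lemma GamG k : Gam k *m G = dB k *m B^T.
Proof. by rewrite GamE -mulmxA gramVl mulmx1. Qed.

Lemma second_form_sym (nu : 'rV[R]_n.+1) (H : 'M[R]_n) :
  (forall i j, H i j = (dB j *m nu^T) i 0) -> H^T = H.
Proof. by move=> HE; apply/matrixP => i j; rewrite mxE !HE (row_mulE _ i j 0 dB_sym). Qed.

Variables (dC : 'I_n -> 'M[R]_(n, n.+1)) (dL : 'I_n -> 'M[R]_n).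
Hypothesis dC_sym : forall i k, row i (dC k) = row k (dC i).
Hypothesis dCE : forall k, dC k = dL k *m B + L *m dB k.

(** The normal component of dC = dL B + L dB is L H, because B is tangent; it inherits the symmetry
    of the second derivatives of the bending. The normal [nu] is arbitrary, as minimality is tested
    on every unit normal. *)
Lemma bending_second_form (nu : 'rV[R]_n.+1) (H : 'M[R]_n) : B *m nu^T = 0 ->
  (forall i j, H i j = (dB j *m nu^T) i 0) -> (L *m H)^T = L *m H.
Proof.
move=> Bnu HE.
have E i k : (L *m H) i k = (dC k *m nu^T) i 0.
  rewrite dCE mulmxDl -!mulmxA Bnu mulmx0 add0r !mxE.
  by apply: eq_bigr => j _; rewrite HE.
by apply/matrixP => i k; rewrite mxE !E (row_mulE _ i k 0 dC_sym).
Qed.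

Hypothesis skewLG : (L *m G)^T = - (L *m G).
Hypothesis skew_dLG : forall k,
  (dL k *m G + L *m dG k)^T = - (dL k *m G + L *m dG k).

(* With [D k] the covariant derivative of [L], the entries of [D k *m G] are
   symmetric in the first two indices and skew in the last two, hence zero. *)
Lemma bending_parallel k : dL k + L *m Gam k - Gam k *m L = 0.
Proof.
pose D k := dL k + L *m Gam k - Gam k *m L.
have DG a : D a *m G = dC a *m B^T - dB a *m (B^T *m iG *m L *m G).
  rewrite /D mulmxBl mulmxDl -(mulmxA L) GamG dCE mulmxDl -(mulmxA _ B) -GE -(mulmxA L (dB a)).
  by rewrite GamE -!mulmxA.
have sym a i j : (D a *m G) i j = (D i *m G) a j.
  by rewrite !DG !mx_linE (row_mulE _ a i j dC_sym) (row_mulE _ a i j dB_sym).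
have GGam a : (Gam a *m G)^T = G *m (Gam a)^T by rewrite trmx_mul tr_gram.
have skew a i j : (D a *m G) i j = - (D a *m G) j i.
  have E : D a *m G = (dL a *m G + L *m dG a) - (L *m G *m (Gam a)^T + Gam a *m (L *m G)).
    rewrite /D dGE -GamG; have -> : B *m (dB a)^T = (Gam a *m G)^T by rewrite GamG trmx_mul trmxK.
    rewrite GGam mulmxBl mulmxDl mulmxDr !mulmxA.
    by apply/matrixP => i' j'; rewrite !mx_linE; ring.
  have S : (D a *m G)^T = - (D a *m G).
    have T : (L *m G *m (Gam a)^T + Gam a *m (L *m G))^T =
        - (L *m G *m (Gam a)^T + Gam a *m (L *m G)).
      rewrite linearD /= (trmx_mul (L *m G)) (trmx_mul (Gam a)) skewLG trmxK.
      by rewrite mulmxN mulNmx opprD addrC.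
    by rewrite E linearB /= skew_dLG T opprB addrC opprK.
  by have /matrixP/(_ j i) := S; rewrite [LHS]mxE mxNE.
have D0 a : D a *m G = 0.
  apply/matrixP => i j; rewrite [RHS]mxE.
  (* Alternating the two symmetries runs through all six orders of the indices and returns each
     entry to its own negative. *)
  have E1 := skew a i j; have E2 := sym a j i; have E3 := skew j a i.
  have E4 := sym j i a; have E5 := skew i j a; have E6 := sym i a j.
  by lra.
by rewrite -[LHS]mulmx1 -gramV mulmxA D0 mul0mx.
Qed.

Hypothesis BN : B *m N^T = 0.
Hypothesis NN : N *m N^T = 1%:M.

Lemma split_mx p (X : 'M[R]_(p, n.+1)) : X = X *m B^T *m iG *m B + X *m N^T *m N.
Proof.
have uBB : B *m B^T \in unitmx by rewrite -GE.
have := tangent_normal_split uBB BN NN => /(congr1 (mulmx X)).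
by rewrite mulmx1 mulmxDr !mulmxA -GE -iGE => ->.
Qed.

Lemma bending_factor : C *m N^T = 0 -> C = L *m B.
Proof. by move=> CN; rewrite {1}[C]split_mx CN mul0mx addr0 LE. Qed.

Variable h : 'I_n -> 'cV[R]_n.
Hypothesis hE : forall k, h k = dB k *m N^T.

Lemma structure_eq k : dB k = Gam k *m B + h k *m N.
Proof. by rewrite hE GamE; exact: split_mx. Qed.

Variables (ddB : 'I_n -> 'I_n -> 'M[R]_(n, n.+1)) (dGam : 'I_n -> 'I_n -> 'M[R]_n).
Variables (dh : 'I_n -> 'I_n -> 'cV[R]_n) (dN : 'I_n -> 'rV[R]_n.+1).
Hypothesis ddB_sym : forall k l, ddB l k = ddB k l.
Hypothesis ddBE : forall l k,
  ddB l k = dGam l k *m B + Gam k *m dB l + (dh l k *m N + h k *m dN l).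
Hypothesis dNB : forall l, dN l *m B^T = - (h l)^T.
Hypothesis dNN : forall l, dN l *m N^T = 0.

(** Tangential component of the symmetry of the second derivatives of B; the quadratic term enters
    through dN B^T = - h^T. *)
Lemma gauss_equation k l :
  dGam k l - dGam l k + Gam l *m Gam k - Gam k *m Gam l =
  (h l *m (h k)^T - h k *m (h l)^T) *m iG.
Proof.
have NB : N *m B^T = 0 by rewrite -[LHS]trmxK trmx_mul trmxK BN trmx0.
have E a b : ddB a b *m B^T *m iG = dGam a b + Gam b *m Gam a - h b *m (h a)^T *m iG.
  rewrite ddBE !mulmxDl -(mulmxA _ B) -GE -(mulmxA _ G) gramV mulmx1.
  rewrite -(mulmxA _ N) NB mulmx0 mul0mx add0r -(mulmxA (h b)) dNB mulmxN mulNmx.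
  by rewrite -!(mulmxA (Gam b)) -GamE.
have := E k l; rewrite ddB_sym E mulmxBl => /matrixP H.
by apply/matrixP => i j; have := H i j; rewrite !mx_linE; lra.
Qed.

(** Normal component of the same symmetry. *)
Lemma codazzi_equation k l : dh l k + Gam k *m h l = dh k l + Gam l *m h k.
Proof.
have E a b : ddB a b *m N^T = dh a b + Gam b *m h a.
  rewrite ddBE !mulmxDl -!mulmxA BN NN dNN !mulmx0 mulmx1 addr0 add0r addrC.
  by rewrite hE.
by rewrite -!E ddB_sym.
Qed.

End SecondForm.
End PointwiseGeometry.

Section ParallelAlgebra.
Context {R : realFieldType} {n : nat}.
Variables (Gam : 'I_n -> 'M[R]_n) (dGam : 'I_n -> 'I_n -> 'M[R]_n).

(** The Ricci identity: the second derivatives of L computed from the parallel equation commute only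
    if L commutes with the curvature. *)
Lemma parallel_commute_curvature (L : 'M[R]_n) (dL : 'I_n -> 'M[R]_n) (ddL : 'I_n -> 'I_n -> 'M[R]_n) k l :
  (forall k, dL k = Gam k *m L - L *m Gam k) ->
  (forall l k, ddL l k = dGam l k *m L + Gam k *m dL l - (dL l *m Gam k + L *m dGam l k)) ->
  ddL l k = ddL k l ->
  L *m (dGam k l - dGam l k + Gam l *m Gam k - Gam k *m Gam l) =
  (dGam k l - dGam l k + Gam l *m Gam k - Gam k *m Gam l) *m L.
Proof.
move=> dLE ddLE; rewrite !ddLE !dLE.
rewrite !(mulmxBr, mulmxBl, mulmxDr, mulmxDl, mulmxN, mulNmx) !mulmxA => /matrixP H.
by apply/matrixP => i j; have := H i j; rewrite !mx_linE; lra.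
Qed.

(** Write E l k for the covariant derivative of h, symmetric by Codazzi. Differentiating S h_k = mu
    h_k with S parallel gives dmu_l h_k = (S - mu) E l k, so dmu_l h_k = dmu_k h_l. Pairing with
    vectors dual to two independent columns removes all dmu. *)
Lemma eigenvalue_constant (S : 'M[R]_n) (dS : 'I_n -> 'M[R]_n) (h : 'I_n -> 'cV[R]_n)
    (dh : 'I_n -> 'I_n -> 'cV[R]_n) (mu : R) (dmu : 'I_n -> R) :
  (forall l, dS l = Gam l *m S - S *m Gam l) ->
  (forall k, S *m h k = mu *: h k) ->
  (forall k l, dh l k + Gam k *m h l = dh k l + Gam l *m h k) ->
  (forall l k, dS l *m h k + S *m dh l k = dmu l *: h k + mu *: dh l k) ->
  (exists k l, h l *m (h k)^T != h k *m (h l)^T) ->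
  forall l, dmu l = 0.
Proof.
move=> dSE Sh cod dSh [k0 [l0 kl]].
pose E l k := dh l k - Gam l *m h k.
have Esym l k : E l k = E k l.
  by apply/eqP; rewrite subr_eq addrAC -cod addrK.
have dmuE l k : dmu l *: h k = S *m E l k - mu *: E l k.
  have := dSh l k; rewrite dSE mulmxBl -!mulmxA Sh /E mulmxBr scalerBr -scalemxAr.
  move=> /matrixP H; apply/matrixP => i j; have := H i j; rewrite !mx_linE.
  by lra.
have dmu_sym l k : dmu l *: h k = dmu k *: h l by rewrite dmuE Esym -dmuE.
have [w [z [uw vw uz vz]]] := dual_pair kl.
have dk : dmu k0 = 0.
  have : dotc (dmu l0 *: h k0) z = dotc (dmu k0 *: h l0) z by rewrite dmu_sym.
  by rewrite !dotcZ uz vz mulr0 mulr1 => <-.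
move=> m; have : dotc (dmu m *: h k0) w = dotc (dmu k0 *: h m) w by rewrite dmu_sym.
by rewrite dk scale0r dotcZ uw mulr1 => ->; rewrite /dotc trmx0 mul0mx mxE.
Qed.

End ParallelAlgebra.

(** * Local geometry of normal bendings *)

Section HasPartials.
Context {R : realType} {n : nat}.

(* Keeping the derivative [dX] abstract stops unification from comparing the
   limits hidden in two occurrences of [partial]. *)
Definition has_partials (Om : set 'rV[R]_n) {W : normedModType R}
    (X : 'rV[R]_n -> W) (dX : 'I_n -> 'rV[R]_n -> W) : Prop :=
  smooth Om X /\ forall k x, Om x -> partial k X x = dX k x.

Variable Om : set 'rV[R]_n.
Hypothesis oOm : open Om.

Lemma has_partials_ex {W : normedModType R} (X : 'rV[R]_n -> W) :
  smooth Om X -> exists dX, has_partials Om X dX.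
Proof. by move=> sX; exists (fun k => partial k X). Qed.

Lemma has_partials_smooth {W : normedModType R} (X : 'rV[R]_n -> W) dX k :
  has_partials Om X dX -> smooth Om (dX k).
Proof.
move=> [sX XE]; apply: smooth_ext (smooth_derive (delta_mx 0 k) sX) => // x Ox.
exact: XE.
Qed.

Lemma has_partials_eq {W : normedModType R} (X Y : 'rV[R]_n -> W) dX dY :
  has_partials Om X dX -> has_partials Om Y dY -> (forall x, Om x -> X x = Y x) ->
  forall k x, Om x -> dX k x = dY k x.
Proof.
move=> [sX XE] [sY YE] XY k x Ox; rewrite -XE // -YE //.
apply: near_eq_derive; near=> y; apply: XY; near: y; exact: open_nbhs_nbhs.
Unshelve. all: by end_near. Qed.

Lemma has_partials_mul m p q (X : 'rV[R]_n -> 'M[R]_(m, p)) (Y : 'rV[R]_n -> 'M[R]_(p, q)) dX dY :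
  has_partials Om X dX -> has_partials Om Y dY ->
  has_partials Om (fun x => X x *m Y x) (fun k x => dX k x *m Y x + X x *m dY k x).
Proof.
move=> [sX XE] [sY YE]; split; first exact: smooth_mulmx.
move=> k x Ox; rewrite -XE // -YE //.
apply: derive_mulmx; [exact: smooth_derivable sX Ox|exact: smooth_derivable sY Ox].
Qed.

Lemma has_partials_tr m p (X : 'rV[R]_n -> 'M[R]_(m, p)) dX :
  has_partials Om X dX -> has_partials Om (fun x => (X x)^T) (fun k x => (dX k x)^T).
Proof.
move=> [sX XE]; split; first exact: smooth_trmx.
move=> k x Ox; rewrite -XE //; apply: derive_trmx; exact: smooth_derivable sX Ox.
Qed.

Lemma has_partials_add {W : normedModType R} (X Y : 'rV[R]_n -> W) dX dY :
  has_partials Om X dX -> has_partials Om Y dY ->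
  has_partials Om (fun x => X x + Y x) (fun k x => dX k x + dY k x).
Proof.
move=> [sX XE] [sY YE]; split; first exact: smoothD.
move=> k x Ox; rewrite -XE // -YE //.
apply: deriveD; [exact: smooth_derivable sX Ox|exact: smooth_derivable sY Ox].
Qed.

Lemma has_partials_opp {W : normedModType R} (X : 'rV[R]_n -> W) dX :
  has_partials Om X dX -> has_partials Om (fun x => - X x) (fun k x => - dX k x).
Proof.
move=> [sX XE]; split; first exact: smoothN.
move=> k x Ox; rewrite -XE //; apply: deriveN; exact: smooth_derivable sX Ox.
Qed.

Lemma has_partials_cst {W : normedModType R} (a : W) : has_partials Om (fun=> a) (fun _ _ => 0).
Proof. by split=> [|k x _]; [exact: smooth_cst|exact: derive_cst]. Qed.

Lemma has_partials_comm m p (X : 'rV[R]_n -> 'M[R]_(m, p)) dX ddX :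
  has_partials Om X dX -> (forall k, has_partials Om (dX k) (ddX k)) ->
  forall k l x, Om x -> ddX k l x = ddX l k x.
Proof.
move=> [sX XE] hd k l x Ox.
have E a b : ddX a b x = 'D_(delta_mx 0 b) ('D_(delta_mx 0 a) X) x.
  have [_ /(_ b x Ox) <-] := hd a; apply: near_eq_derive; near=> y.
  apply/esym/XE; near: y; exact: open_nbhs_nbhs.
apply: etrans (E k l) _; apply: etrans (esym (E l k)).
exact: (@smooth_derive_comm R _ m p Om X x (delta_mx 0 k) (delta_mx 0 l) oOm Ox sX).
Unshelve. all: by end_near. Qed.

Lemma has_partials_sub (Om' : set 'rV[R]_n) {W : normedModType R} (X : 'rV[R]_n -> W) dX :
  Om' `<=` Om -> has_partials Om X dX -> has_partials Om' X dX.
Proof.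
by move=> sO [sX XE]; split=> [|k x /sO]; [exact: smooth_sub sX|exact: XE].
Qed.

(** Uniqueness for the system with zero coefficients, applied to the difference with the value at
    [x]. *)
Lemma has_partials_zero_const m p (X : 'rV[R]_n -> 'M[R]_(m, p)) x :
  has_partials Om X (fun _ _ => 0) -> Om x ->
  exists r : R, [/\ 0 < r, ball x r `<=` Om & forall y, ball x r y -> X y = X x].
Proof.
move=> hX Ox.
have [||r [r0 rOm H]] := @linear_ode_zero R n m p Om x (fun _ _ => 0) (fun _ _ => 0) oOm Ox.
- by move=> k; apply: differentiable_continuous; exact: differentiable_cst.
- by move=> k; apply: differentiable_continuous; exact: differentiable_cst.
exists r; split=> // y By.
have [sY YE] := has_partials_add hX (has_partials_opp (has_partials_cst (X x))).
have dY z : ball x r z -> differentiable (fun y => X y - X x) z.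
  by move=> /rOm; exact: smooth_differentiable.
have DY z k : ball x r z -> partial k (fun y => X y - X x) z
    = 0 *m (X z - X x) + (X z - X x) *m 0.
  by move=> /rOm Oz; rewrite YE // mul0mx mulmx0 oppr0.
by have /subr0_eq := H _ dY DY x y (ballxx _ r0) By (subrr _).
Qed.

End HasPartials.

Section ChristoffelCurvature.
Context {R : realType} {n : nat}.

Lemma christoffelE (g : 'rV[R]_n -> 'M[R]_n) (dg : 'I_n -> 'M[R]_n) x k :
  (forall k, partial k g x = dg k) ->
  christoffel g k x = \matrix_(i, j) (2^-1 * \sum_l
    (dg k i l + dg i k l - dg l k i) * invmx (g x) l j).
Proof.
move=> gE; pose T (d : 'I_n -> 'M[R]_n) := \matrix_(i, j) (2^-1 * \sum_l
    (d k i l + d i k l - d l k i) * invmx (g x) l j).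
have -> : christoffel g k x = T (fun k => partial k g x) by [].
by rewrite (_ : (fun k => partial k g x) = dg) //; apply/funext.
Qed.

Lemma curvatureE (Om : set 'rV[R]_n) (g : 'rV[R]_n -> 'M[R]_n) (Gam : 'I_n -> 'rV[R]_n -> 'M[R]_n)
    (dGam : 'I_n -> 'I_n -> 'rV[R]_n -> 'M[R]_n) x k l :
  open Om -> (forall k y, Om y -> christoffel g k y = Gam k y) ->
  (forall k, has_partials Om (Gam k) (dGam k)) -> Om x ->
  curvature g k l x = dGam l k x - dGam k l x + Gam l x *m Gam k x - Gam k x *m Gam l x.
Proof.
move=> oOm gE hG Ox; rewrite /curvature !gE //.
have E a b : partial a (christoffel g b) x = dGam b a x.
  have [_ /(_ a x Ox) <-] := hG b; apply: near_eq_derive; near=> y.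
  apply: gE; near: y; exact: open_nbhs_nbhs.
by congr (_ - _ + _ - _); exact: E.
Unshelve. all: by end_near. Qed.

End ChristoffelCurvature.

Section LocalGeometry.
Context {R : realType} {n : nat}.
(* In a chart, [B] and [C] are the differentials of the hypersurface and of its
   bending, [N] is the Gauss map, and the endomorphism [L] below is the one
   with [C = L B]. *)
Variables (Om : set 'rV[R]_n) (B C : 'rV[R]_n -> 'M[R]_(n, n.+1)) (N : 'rV[R]_n -> 'rV[R]_n.+1).
Variables (dB dC : 'I_n -> 'rV[R]_n -> 'M[R]_(n, n.+1)) (dN : 'I_n -> 'rV[R]_n -> 'rV[R]_n.+1).
Hypothesis oOm : open Om.
Hypothesis hB : has_partials Om B dB.
Hypothesis hC : has_partials Om C dC.
Hypothesis hN : has_partials Om N dN.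
Hypothesis dB_sym : forall x i k, Om x -> row i (dB k x) = row k (dB i x).
Hypothesis dC_sym : forall x i k, Om x -> row i (dC k x) = row k (dC i x).
Hypothesis uBB : forall x, Om x -> B x *m (B x)^T \in unitmx.
Hypothesis BN : forall x, Om x -> B x *m (N x)^T = 0.
Hypothesis NN : forall x, Om x -> N x *m (N x)^T = 1%:M.
Hypothesis CN : forall x, Om x -> C x *m (N x)^T = 0.
Hypothesis BC : forall x, Om x -> B x *m (C x)^T + C x *m (B x)^T = 0.

Let G x := B x *m (B x)^T.
Let iG x := invmx (G x).
Let L x := C x *m (B x)^T *m iG x.
Let dG k x := dB k x *m (B x)^T + B x *m (dB k x)^T.
Let Gam k x := dB k x *m (B x)^T *m iG x.
Let h k x := dB k x *m (N x)^T.

Let hG : has_partials Om G dG.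
Proof. by have := has_partials_mul oOm hB (has_partials_tr oOm hB). Qed.

Let siG : smooth Om iG.
Proof. by apply: smooth_invmx => //; have [] := hG. Qed.

Let sL : smooth Om L.
Proof.
by apply: smooth_mulmx => //; apply: smooth_mulmx => //;
  [have [] := hC|apply: smooth_trmx => //; have [] := hB].
Qed.

Let sGam k : smooth Om (Gam k).
Proof.
apply: smooth_mulmx => //; apply: smooth_mulmx => //; first exact: has_partials_smooth hB.
by apply: smooth_trmx => //; have [] := hB.
Qed.

Let sh k : smooth Om (h k).
Proof.
apply: smooth_mulmx => //; first exact: has_partials_smooth hB.
by apply: smooth_trmx => //; have [] := hN.
Qed.

Lemma local_christoffel (g : 'rV[R]_n -> 'M[R]_n) k x :
  (forall y, Om y -> g y = G y) -> Om x -> christoffel g k x = Gam k x.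
Proof.
move=> gG Ox; rewrite (@christoffelE _ _ g (fun k => dG k x)).
  rewrite (gG x Ox); apply: (@christoffel_formula R n (B x) (iG x) (dB ^~ x) (Gam ^~ x) (dG ^~ x)) => //.
  by move=> i j; exact: dB_sym.
move=> a; have [_ /(_ a x Ox) <-] := hG.
by apply: near_eq_derive; near=> y; apply: gG; near: y; exact: open_nbhs_nbhs.
Unshelve. all: by end_near. Qed.

Lemma local_factor x : Om x -> C x = L x *m B x.
Proof.
move=> Ox; apply: (@bending_factor R n (B x) (C x) (N x) (G x) (iG x) (L x)) => //.
- exact: uBB.
- exact: BN.
- exact: NN.
- exact: CN.
Qed.

Lemma local_skew x : Om x -> (L x *m G x)^T = - (L x *m G x).
Proof.
move=> Ox; rewrite (@LG R n (B x) (C x) (G x) (iG x) (L x) erefl erefl (uBB Ox)).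
by rewrite trmx_mul trmxK; apply/eqP; rewrite -addr_eq0 BC.
Qed.

Lemma local_parallel dL : has_partials Om L dL ->
  forall k x, Om x -> dL k x + L x *m Gam k x - Gam k x *m L x = 0.
Proof.
move=> hL k x Ox.
apply: (@bending_parallel R n (B x) (G x) (iG x) (L x) erefl erefl (uBB Ox) (dB ^~ x)
  (Gam ^~ x) (dG ^~ x) _ _ _ (dC ^~ x) (dL ^~ x)) => //.
- by move=> i j; exact: dB_sym.
- by move=> i j; exact: dC_sym.
- move=> a.
  exact: (has_partials_eq oOm hC (has_partials_mul oOm hL hB) local_factor a Ox).
- exact: local_skew.
- move=> a; have hLG := has_partials_mul oOm hL hG.
  have := has_partials_eq oOm (has_partials_tr oOm hLG) (has_partials_opp oOm hLG) local_skew a Ox.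
  by [].
Qed.

Lemma local_second_form x (nu : 'rV[R]_n.+1) (H : 'M[R]_n) : Om x -> B x *m nu^T = 0 ->
  (forall i j, H i j = (dB j x *m nu^T) i 0) -> H^T = H /\ (L x *m H)^T = L x *m H.
Proof.
move=> Ox Bnu HE; split.
  by apply: (@second_form_sym R n (dB ^~ x) _ nu) => // i j; exact: dB_sym.
have [dL hL] := has_partials_ex sL.
apply: (@bending_second_form R n (B x) (L x) (dB ^~ x) (dC ^~ x) (dL ^~ x) _ _ nu) => //.
- by move=> i j; exact: dC_sym.
- move=> a.
  exact: (has_partials_eq oOm hC (has_partials_mul oOm hL hB) local_factor a Ox).
Qed.

Let local_structure k x : Om x -> dB k x = Gam k x *m B x + h k x *m N x.
Proof.
move=> Ox; exact: (@structure_eq R n (B x) (N x) (G x) (iG x) erefl erefl (uBB Ox) (dB ^~ x)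
  (Gam ^~ x) (fun=> erefl) (BN Ox) (NN Ox) (h ^~ x) (fun=> erefl)).
Qed.

Let local_dNB l x : Om x -> dN l x *m (B x)^T = - (h l x)^T.
Proof.
move=> Ox; have NB y : Om y -> N y *m (B y)^T = 0.
  by move=> Oy; rewrite -[LHS]trmxK trmx_mul trmxK BN // trmx0.
have := has_partials_eq oOm (has_partials_mul oOm hN (has_partials_tr oOm hB))
  (has_partials_cst _ 0) NB l Ox.
by rewrite /h trmx_mul trmxK => /eqP; rewrite addr_eq0 => /eqP.
Qed.

Let local_dNN l x : Om x -> dN l x *m (N x)^T = 0.
Proof.
move=> Ox; have := has_partials_eq oOm (has_partials_mul oOm hN (has_partials_tr oOm hN))
  (has_partials_cst _ 1%:M) NN l Ox.
have -> : N x *m (dN l x)^T = dN l x *m (N x)^T.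
  have T (a : 'M[R]_1) : a^T = a by rewrite [a]mx11_scalar tr_scalar_mx.
  by rewrite -[LHS]T trmx_mul trmxK.
move=> /matrixP H; apply/matrixP => i j; have := H i j.
by rewrite !mxE; lra.
Qed.

Section SecondOrder.
Variables (ddB : 'I_n -> 'I_n -> 'rV[R]_n -> 'M[R]_(n, n.+1)) (dGam : 'I_n -> 'I_n -> 'rV[R]_n -> 'M[R]_n).
Variables (dh : 'I_n -> 'I_n -> 'rV[R]_n -> 'cV[R]_n).
Hypothesis hdB : forall k, has_partials Om (dB k) (ddB k).
Hypothesis hGam : forall k, has_partials Om (Gam k) (dGam k).
Hypothesis hh : forall k, has_partials Om (h k) (dh k).

Let local_ddB k l x : Om x ->
  ddB k l x = dGam k l x *m B x + Gam k x *m dB l x + (dh k l x *m N x + h k x *m dN l x).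
Proof.
exact: (has_partials_eq oOm (hdB k) (has_partials_add oOm (has_partials_mul oOm (hGam k) hB)
  (has_partials_mul oOm (hh k) hN)) (@local_structure k) l).
Qed.

Lemma local_gauss k l x : Om x ->
  dGam l k x - dGam k l x + Gam l x *m Gam k x - Gam k x *m Gam l x =
  (h l x *m (h k x)^T - h k x *m (h l x)^T) *m iG x.
Proof.
move=> Ox; apply: (@gauss_equation R n (B x) (N x) (G x) (iG x) erefl erefl (uBB Ox) (dB ^~ x)
  (Gam ^~ x) (fun=> erefl) (BN Ox) (h ^~ x) (fun l k => ddB k l x) (fun l k => dGam k l x)
  (fun l k => dh k l x) (dN ^~ x)).
- by move=> a b; exact: (has_partials_comm oOm hB hdB).
- by move=> a b; exact: local_ddB.
- by move=> a; exact: local_dNB.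
Qed.

Lemma local_codazzi k l x : Om x ->
  dh k l x + Gam k x *m h l x = dh l k x + Gam l x *m h k x.
Proof.
move=> Ox; apply: (@codazzi_equation R n (B x) (N x) (dB ^~ x)
  (Gam ^~ x) (BN Ox) (NN Ox) (h ^~ x) (fun=> erefl) (fun l k => ddB k l x) (fun l k => dGam k l x)
  (fun l k => dh k l x) (dN ^~ x)).
- by move=> a b; exact: (has_partials_comm oOm hB hdB).
- by move=> a b; exact: local_ddB.
- by move=> a; exact: local_dNN.
Qed.

End SecondOrder.

Let L_commutes_curvature dL dGam : has_partials Om L dL -> (forall k, has_partials Om (Gam k) (dGam k)) ->
  forall k l x, Om x ->
  let Rm := dGam l k x - dGam k l x + Gam l x *m Gam k x - Gam k x *m Gam l x in
  L x *m Rm = Rm *m L x.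
Proof.
move=> hL hGam k l x Ox.
have dLE a y : Om y -> dL a y = Gam a y *m L y - L y *m Gam a y.
  by move=> Oy; have := local_parallel hL a Oy => /eqP; rewrite subr_eq0 => /eqP <-; rewrite addrK.
have [ddL hdL] : exists ddL, forall k, has_partials Om (dL k) (ddL k).
  have sdL a : exists d, has_partials Om (dL a) d.
    by apply: has_partials_ex; exact: has_partials_smooth hL.
  by exists (fun a => sval (cid (sdL a))) => a; exact: svalP (cid (sdL a)).
apply: (@parallel_commute_curvature R n (Gam ^~ x) (fun l k => dGam k l x) (L x) (dL ^~ x)
  (fun l k => ddL k l x)).
- by move=> a; exact: dLE.
- move=> b a; apply: (has_partials_eq oOm (hdL a) (has_partials_add oOm
    (has_partials_mul oOm (hGam a) hL)
    (has_partials_opp oOm (has_partials_mul oOm hL (hGam a)))) (dLE a) b Ox).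
- exact: (has_partials_comm oOm hL hdL).
Qed.

Let partials_ex2 p q (X : 'I_n -> 'rV[R]_n -> 'M[R]_(p, q)) : (forall k, smooth Om (X k)) ->
  exists dX, forall k, has_partials Om (X k) (dX k).
Proof.
move=> sX; exists (fun a => sval (cid (has_partials_ex (sX a)))) => a.
exact: svalP (cid (has_partials_ex (sX a))).
Qed.

Let sdB k : smooth Om (dB k). Proof. exact: has_partials_smooth hB. Qed.

Lemma local_curvature (g : 'rV[R]_n -> 'M[R]_n) k l x :
  (forall y, Om y -> g y = G y) -> Om x ->
  curvature g k l x = (h l x *m (h k x)^T - h k x *m (h l x)^T) *m iG x.
Proof.
move=> gG Ox; have [ddB hdB] := partials_ex2 sdB.
have [dGam hGam] := partials_ex2 sGam; have [dh hh] := partials_ex2 sh.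
rewrite (@curvatureE R n Om g Gam dGam) //; first exact: local_gauss hdB hGam hh _ _ _ Ox.
by move=> a y; exact: local_christoffel.
Qed.

(** By the Gauss equation this is the curvature up to the invertible factor G; it is nonzero exactly
    when columns k and l of the second fundamental form are independent. *)
Let wedge k l x := h l x *m (h k x)^T - h k x *m (h l x)^T.

Lemma local_eigen x : Om x -> (exists k l, wedge k l x != 0) ->
  exists mu, forall k, L x *m L x *m h k x = mu *: h k x.
Proof.
move=> Ox [k0 [l0 kl]]; have [ddB hdB] := partials_ex2 sdB.
have [dGam hGam] := partials_ex2 sGam; have [dh hh] := partials_ex2 sh.
have [dL hL] := has_partials_ex sL.
pose H := \matrix_(i, j) h j x i 0.
have colH k : col k H = h k x by apply/colP => i; rewrite !mxE.
have tG : (G x)^T = G x by rewrite /G trmx_mul trmxK.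
have [||||mu Hmu] := @commuting_eigen R n (L x *m L x) (G x) H (uBB Ox).
(* L is skew for G, so L^2 is self-adjoint: L^2 G is symmetric. *)
- have sk := local_skew Ox; have GL : G x *m (L x)^T = - (L x *m G x).
    by rewrite -sk (trmx_mul (L x) (G x)) tG.
  by rewrite -mulmxA (trmx_mul (L x) (L x *m G x)) sk mulNmx -mulmxA GL mulmxN opprK.
- exact: tG.
- move=> k l; rewrite !colH.
  have := L_commutes_curvature hL hGam k l Ox; rewrite /= (local_gauss hdB hGam hh) // => E.
  move: E; rewrite -/(iG x); move: (L x) (_ *m iG x) => A W E.
  by rewrite -mulmxA E mulmxA E -mulmxA.
- by exists k0, l0; rewrite !colH -subr_eq0.
exists mu => k; rewrite -colH; have /matrixP HH := Hmu; apply/colP => i.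
have := HH i k; rewrite [LHS]mxE [RHS]mxE => E.
by rewrite [LHS]mxE [RHS]mxE [X in _ * X]mxE -E; apply: eq_bigr => j _; rewrite [X in _ * X]mxE.
Qed.

(** Pointwise eigenvalues must first form a smooth function before they can be differentiated. Near
    [x0] one entry of one column stays nonzero, and mu is read off as a quotient of entries. *)
Lemma local_eigen_const x0 : Om x0 -> (exists k l, wedge k l x0 != 0) ->
  exists mu r, [/\ 0 < r, ball x0 r `<=` Om &
    forall x k, ball x0 r x -> L x *m L x *m h k x = mu *: h k x].
Proof.
move=> Ox0 [k0 [l0 kl]].
have [a [b ab]] : exists a b, (wedge k0 l0 x0) a b != 0.
  apply: contrapT => H; move/eqP: kl; apply; apply/matrixP => a b; rewrite [RHS]mxE.
  by apply/eqP/negPn/negP => ab; apply: H; exists a, b.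
have [i hi] : exists i, h k0 x0 i 0 != 0.
  apply: contrapT => H; move/eqP: kl; apply.
  have -> : wedge k0 l0 x0 = h l0 x0 *m (h k0 x0)^T - h k0 x0 *m (h l0 x0)^T by [].
  have -> : h k0 x0 = 0.
    apply/colP => i; rewrite [RHS]mxE; apply/eqP/negPn/negP => hi; apply: H.
    by exists i.
  by rewrite trmx0 mulmx0 mul0mx subrr.
have swedge : smooth Om (wedge k0 l0).
  by apply: smoothB => //; apply: smooth_mulmx => //; apply: smooth_trmx.
have near_coord p q (X : 'rV[R]_n -> 'M[R]_(p, q)) c d : smooth Om X -> X x0 c d != 0 ->
    \forall x \near x0, X x c d != 0.
  move=> /smooth_mxP-/(_ oOm c d) sX X0.
  exact: (cvgr_neq0 _ (smooth_continuous sX Ox0) X0).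
have [r0 /= r00 Hr0] : exists2 r : R, 0 < r & ball x0 r `<=` Om `&`
    ([set x | wedge k0 l0 x a b != 0] `&` [set x | h k0 x i 0 != 0]).
  apply/nbhs_ballP; apply: filterI; first exact: open_nbhs_nbhs.
  by apply: filterI; [exact: near_coord swedge ab|exact: near_coord (sh k0) hi].
pose Om' := ball x0 r0.
have oOm' : open Om' by exact: ball_open.
have sOm' : Om' `<=` Om by move=> x /Hr0[].
pose S x := L x *m L x.
pose mu x := (S x *m h k0 x) i 0 / h k0 x i 0.
have muE x k : Om' x -> S x *m h k x = mu x *: h k x.
  move=> Ox; have [Omx [wx hx]] := Hr0 x Ox.
  have [|m Hm] := local_eigen Omx.
    by exists k0, l0; apply: contra_neq wx => ->; rewrite mxE.
  have -> : mu x = m.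
    rewrite /mu; have -> : S x *m h k0 x = m *: h k0 x by exact: Hm.
    by rewrite mxZE mulfK.
  exact: Hm.
have smu : smooth Om' mu.
  have sS : smooth Om (fun x => S x *m h k0 x).
    by apply: smooth_mulmx => //; apply: smooth_mulmx.
  have sS' := smooth_sub sOm' sS; have sh' := smooth_sub sOm' (sh k0).
  move=> k; apply: CkM => //.
    by have /smooth_mxP-/(_ oOm' i 0) := sS'; exact.
  apply: CkV => //; first by move=> x /Hr0[_ []].
  by have /smooth_mxP-/(_ oOm' i 0) := sh'; exact.
(* As a 1 x 1 matrix mu fits the product rule for matrices: S h = h Mu. *)
pose Mu x : 'M[R]_1 := (mu x)%:M.
have sMu : smooth Om' Mu.
  apply/smooth_mxP => // c d; under eq_fun do rewrite !ord1 mxE eqxx mulr1n.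
  exact: smu.
have [dMu hMu] := has_partials_ex sMu.
have [ddB hdB] := partials_ex2 sdB.
have [dGam hGam] := partials_ex2 sGam; have [dh hh] := partials_ex2 sh.
have [dL hL] := has_partials_ex sL.
have hS := has_partials_mul oOm hL hL.
have hMuE x k : Om' x -> S x *m h k x = h k x *m Mu x.
  by move=> Ox; rewrite muE // mul_mx_scalar.
have dMu0 x : Om' x -> forall l, dMu l x = 0.
  move=> Ox l; have Omx := sOm' x Ox.
  suff H : dMu l x 0 0 = 0 by apply/matrixP => c d; rewrite !ord1 H mxE.
  apply: (@eigenvalue_constant R n (Gam ^~ x) (S x) (fun l => dL l x *m L x + L x *m dL l x)
    (h ^~ x) (fun l k => dh k l x) (mu x) (fun l => dMu l x 0 0)).
  - move=> c; have /eqP := local_parallel hL c Omx.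
    rewrite subr_eq0 => /eqP /(canRL (addrK _)) ->.
    by rewrite /S mulmxBl mulmxBr !mulmxA addrA subrK.
  - by move=> k; exact: muE.
  - by move=> k c; exact: (local_codazzi hdB hGam hh).
  - move=> c k; have := has_partials_eq oOm' (has_partials_mul oOm' (has_partials_sub sOm' hS)
      (has_partials_sub sOm' (hh k))) (has_partials_mul oOm' (has_partials_sub sOm' (hh k)) hMu)
      (fun x Ox => hMuE x k Ox) c Ox.
    move=> ->; rewrite mul_mx_scalar addrC; congr (_ + _).
    have E11 : dMu c x = (dMu c x 0 0)%:M by exact: mx11_scalar.
    by rewrite {1}E11 mul_mx_scalar.
  - exists k0, l0; have [_ [wx _]] := Hr0 x Ox.
    by rewrite -subr_eq0; apply: contra_neq wx => H; rewrite /wedge H mxE.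
have hMu0 : has_partials Om' Mu (fun _ _ => 0).
  by split=> // k x Ox; rewrite -(dMu0 x Ox k); have [_] := hMu; exact.
have [|r [rp rOm H]] := has_partials_zero_const oOm' hMu0 (x := x0); first exact: ballxx.
exists (mu x0), r; split=> // [x /rOm/sOm'//|x k Bx].
have Ox := rOm x Bx; rewrite -/(S x) muE //; congr (_ *: _).
by have /matrixP/(_ 0 0) := H x Bx; rewrite !mxE eqxx !mulr1n.
Qed.

(** Both L and L^2 - mu solve du = Gam u - u Gam, with coefficients that do not involve mu; hence
    one ball for all mu. *)
Lemma local_zero_parallel x0 : Om x0 ->
  exists r, [/\ 0 < r, ball x0 r `<=` Om &
    forall mu x y, ball x0 r x -> ball x0 r y ->
      (L x = 0 -> L y = 0) /\ (L x *m L x = mu%:M -> L y *m L y = mu%:M)].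
Proof.
move=> Ox0; have [dL hL] := has_partials_ex sL.
have cG k : {for x0, continuous (Gam k)} by exact: smooth_continuous (sGam k) Ox0.
have cGN k : {for x0, continuous (fun x => - Gam k x)}.
  exact: smooth_continuous (smoothN oOm (sGam k)) Ox0.
have [r [r0 rOm H]] := linear_ode_zero oOm Ox0 cG cGN.
exists r; split=> // mu x y Bx By.
have dLE a z : Om z -> dL a z = Gam a z *m L z + L z *m - Gam a z.
  move=> Oz; have := local_parallel hL a Oz => /eqP.
  by rewrite subr_eq0 mulmxN => /eqP <-; rewrite addrK.
split.
  apply: (H L) Bx By => [z /rOm|z k /rOm Oz]; first exact: smooth_differentiable sL.
  by have [_ ->] := hL; rewrite ?dLE.
have hS := has_partials_add oOm (has_partials_mul oOm hL hL) (has_partials_cst Om (- mu%:M)).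
move=> /eqP; rewrite -subr_eq0 => /eqP Sx; apply/eqP; rewrite -subr_eq0; apply/eqP.
move: Bx By Sx; apply: (H (fun z => L z *m L z + - mu%:M)) => [z /rOm|z k /rOm Oz].
  by apply: smooth_differentiable; have [] := hS.
have [_ ->] := hS => //; rewrite dLE // addr0; move: (L z) (Gam k z) => A D.
rewrite !(mulmxDl, mulmxDr, mulmxN, mulNmx) !mulmxA mul_mx_scalar mul_scalar_mx.
by apply/matrixP => c d; rewrite !mx_linE; ring.
Qed.

(* The rows of [(L ^ 2 - mu) B] span a subspace that does not depend on the
   point, since this matrix satisfies the linear system [dZ = Gam Z]. *)
Lemma local_constant_span x0 mu r0 : 0 < r0 -> ball x0 r0 `<=` Om ->
  (forall x k, ball x0 r0 x -> L x *m L x *m h k x = mu *: h k x) ->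
  exists r, [/\ 0 < r, ball x0 r `<=` ball x0 r0 &
    forall (v : 'cV[R]_n.+1) x y, ball x0 r x -> ball x0 r y ->
      (L x *m L x - mu%:M) *m B x *m v = 0 -> (L y *m L y - mu%:M) *m B y *m v = 0].
Proof.
move=> r00 sOm' muE; set Om' := ball x0 r0 in sOm' *.
have oOm' : open Om' by exact: ball_open.
have Ox0 : Om' x0 by exact: ballxx.
have [dL hL] := has_partials_ex sL.
have cG k : {for x0, continuous (Gam k)} by exact: smooth_continuous (sGam k) (sOm' _ Ox0).
(* Z v is a column, so the coefficient on its right is a 1 x 1 matrix, here zero. *)
have c0 (k : 'I_n) : {for x0, continuous (fun _ : 'rV[R]_n => 0 : 'M[R]_1)}.
  by apply: differentiable_continuous; exact: differentiable_cst.
have [r [rp rOm H]] := linear_ode_zero oOm' Ox0 cG c0.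
exists r; split=> // v x y; apply: (H (fun z => (L z *m L z - mu%:M) *m B z *m v)).
  move=> z /rOm/sOm'; apply: smooth_differentiable; apply: smooth_mulmx => //; last exact: smooth_cst.
  apply: smooth_mulmx => //; last by have [] := hB.
  by apply: smoothB => //; [apply: smooth_mulmx|exact: smooth_cst].
move=> z k /rOm Oz'; have Oz := sOm' z Oz'.
have dLE : dL k z = Gam k z *m L z - L z *m Gam k z.
  by have := local_parallel hL k Oz => /eqP; rewrite subr_eq0 => /eqP <-; rewrite addrK.
have hS := has_partials_add oOm (has_partials_mul oOm hL hL) (has_partials_cst Om (- mu%:M)).
have [_ ->] := has_partials_mul oOm (has_partials_mul oOm hS hB) (has_partials_cst Om v) => //.
rewrite !mulmx0 !addr0 local_structure // dLE.
(* This removes the normal term h N of dB, the only term that is not a multiple of Z. *)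
have E : (L z *m L z - mu%:M) *m h k z = 0.
  by rewrite mulmxBl mul_scalar_mx muE // subrr.
move: E; move: (L z) (Gam k z) (h k z) => A D c E.
rewrite (mulmxDr (A *m A - mu%:M)) (mulmxA _ c) E mul0mx addr0 !mulmxA -mulmxDl; congr (_ *m _ *m v).
rewrite !(mulmxDl, mulmxDr, mulmxN, mulNmx) !mulmxA mul_mx_scalar mul_scalar_mx.
by apply/matrixP => a b; rewrite !mx_linE; ring.
Qed.

End LocalGeometry.

(** * Cylinders *)

Section Orthonormal.
Context {R : rcfType}.

Lemma sqnorm_gt0 m (v : 'rV[R]_m) : v != 0 -> 0 < (v *m v^T) 0 0.
Proof.
move=> v0; rewrite mxE lt_def; apply/andP; split; last first.
  by apply: sumr_ge0 => i _; rewrite mxE -expr2 sqr_ge0.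
apply: contra v0; rewrite psumr_eq0 => [/allP H|i _]; last by rewrite mxE -expr2 sqr_ge0.
apply/eqP/rowP => i; rewrite [RHS]mxE; have := H i (mem_index_enum i).
by rewrite /= mxE mulf_eq0 orbb => /eqP.
Qed.

Lemma gram_unitmx p m (A : 'M[R]_(p, m)) : row_free A -> A *m A^T \in unitmx.
Proof.
move=> fA; rewrite -row_free_unit -kermx_eq0; apply/rowV0P => v /sub_kermxP H.
apply: (row_free_inj fA); rewrite mul0mx; apply: contraTeq isT => vA0.
have := sqnorm_gt0 vA0; rewrite trmx_mul -!mulmxA (mulmxA A) (mulmxA v) H mul0mx mxE.
by rewrite ltxx.
Qed.

(** Gram-Schmidt by recursion on the rank: a unit vector e of the row space is split off, and the
    rest is the intersection of that space with the orthogonal complement of e. *)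
Lemma orthonormal_basis d p m (A : 'M[R]_(p, m)) : \rank A = d ->
  exists O : 'M[R]_(d, m), O *m O^T = 1%:M /\ (O :=: A)%MS.
Proof.
elim: d p A => [|d IH] p A rA.
  exists 0; split; first by apply/matrixP => -[].
  move/eqP: rA; rewrite mxrank_eq0 => /eqP ->.
  by apply/eqmxP; rewrite !sub0mx.
have A0 : A != 0 by rewrite -mxrank_eq0 rA.
have [u [uA u0]] : exists u : 'rV[R]_m, (u <= A)%MS /\ u != 0.
  by exists (nz_row A); rewrite nz_row_sub nz_row_eq0.
pose s := Num.sqrt ((u *m u^T) 0 0).
have s0 : 0 < s by rewrite sqrtr_gt0 sqnorm_gt0.
pose e := s^-1 *: u.
have ee : e *m e^T = 1%:M.
  rewrite /e linearZ /= -scalemxAl -scalemxAr scalerA [u *m u^T]mx11_scalar.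
  rewrite scale_scalar_mx -expr2 exprVn sqr_sqrtr ?mulVf //; last exact/ltW/sqnorm_gt0.
  by rewrite gt_eqF // sqnorm_gt0.
have eA : (e <= A)%MS by rewrite scalemx_sub.
clearbody e.
have e0 : \rank e = 1%N.
  by rewrite rank_rV; case: eqP ee => // ->; rewrite mul0mx => /matrixP/(_ 0 0); rewrite !mxE eqxx => /esym/eqP; rewrite oner_eq0.
pose K := kermx e^T.
have AeK : (A :=: e + (A :&: K))%MS.
  apply/eqmxP/andP; split; last by rewrite addsmx_sub eA capmxSl.
  apply/row_subP => i; set v := row i A.
  have vA : (v <= A)%MS by exact: row_sub.
  have -> : v = (v *m e^T) *m e + (v - (v *m e^T) *m e) by rewrite addrC subrK.
  apply: addmx_sub_adds; first exact: submxMl.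
  rewrite sub_capmx; apply/andP; split.
    by rewrite addmx_sub // eqmx_opp mulmx_sub.
  by apply/sub_kermxP; rewrite mulmxBl -(mulmxA _ e) ee mulmx1 subrr.
have capE : (e :&: (A :&: K) = 0)%MS.
  apply/eqP; rewrite -submx0; apply/rV_subP => v; rewrite sub_capmx => /andP[/sub_rVP[a ->]].
  rewrite sub_capmx => /andP[_ /sub_kermxP]; rewrite -scalemxAl ee scalemx1 => /matrixP/(_ 0 0).
  by rewrite !mxE eqxx mulr1n => ->; rewrite scale0r sub0mx.
have rAK : \rank (A :&: K)%MS = d.
  by have := mxrank_disjoint_sum capE; rewrite -AeK rA e0 add1n => -[].
have [Q [QQ QA]] := IH _ _ rAK.
have Qe : Q *m e^T = 0.
  by apply/sub_kermxP; rewrite QA capmxSr.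
pose F : 'M[R]_(1 + d, m) := col_mx e Q.
have FF : F *m F^T = 1%:M.
  rewrite tr_col_mx mul_col_row ee QQ Qe.
  have -> : e *m Q^T = 0 by rewrite -[LHS]trmxK trmx_mul trmxK Qe trmx0.
  by rewrite -scalar_mx_block.
exists F; split; first exact: FF.
apply: (eqmx_trans _ (eqmx_sym AeK)); apply: (eqmx_trans (eqmx_sym (addsmxE e Q))).
exact: adds_eqmx.
Qed.

Lemma orthonormal_complement d k m (P : 'M[R]_(d, m)) : P *m P^T = 1%:M -> (k + d)%N = m ->
  exists Q : 'M[R]_(k, m), [/\ Q *m Q^T = 1%:M, Q *m P^T = 0 & Q^T *m Q + P^T *m P = 1%:M].
Proof.
move=> PP kd.
have rP : \rank P^T = d by rewrite mxrank_tr; apply/eqP/row_freeP; exists P^T.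
have rK : \rank (kermx P^T) = k by rewrite mxrank_ker rP -kd addnK.
have [Q [QQ QK]] := orthonormal_basis rK.
have QP : Q *m P^T = 0 by apply/sub_kermxP; rewrite QK.
have PQ : P *m Q^T = 0 by rewrite -[LHS]trmxK trmx_mul trmxK QP trmx0.
exists Q; split=> //; set X := _ + _.
pose F := col_mx Q P.
have FF : F *m F^T = 1%:M by rewrite tr_col_mx mul_col_row QQ PP QP PQ -scalar_mx_block.
have fF : row_full F.
  by rewrite /row_full -{2}kd; apply/row_freeP; exists F^T.
have FX : F *m (X - 1%:M) = 0.
  rewrite mulmxBr mulmx1 mulmxDr /F !mulmxA !mul_col_mx QQ PQ QP PP.
  by rewrite !mul0mx !mul1mx add_col_mx addr0 add0r subrr.
have [D DF] := row_fullP fF.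
by apply/eqP; rewrite -subr_eq0; apply/eqP; rewrite -[LHS]mul1mx -{1}DF -mulmxA FX mulmx0.
Qed.

End Orthonormal.

(** * Splitting an immersion along constant tangent directions *)

Section GraphOverTangent.
Context {R : realType} {n : nat}.

(** Orthogonal projection to the tangent space at [x0] is a local diffeomorphism psi, so the image
    is a graph over that space. Since W is tangent at every point, moving psi along W moves phi by
    the same vector, and the height over the tangent space depends only on the coordinates Y
    orthogonal to W. The map [chi0] parametrises the slice Z = 0. *)
Lemma graph_over_tangent p (U : set 'rV[R]_n) (phi : 'rV[R]_n -> 'rV[R]_n.+1)
    (B : 'rV[R]_n -> 'M[R]_(n, n.+1)) (W : 'M[R]_(p, n.+1)) (x0 : 'rV[R]_n) :
  open U -> U x0 -> smooth U phi -> smooth U B ->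
  (forall x v, U x -> 'D_v phi x = v *m B x) -> row_free (B x0) ->
  (forall x, U x -> (W <= B x)%MS) -> W != 0 ->
  exists (k d : nat) (N0 : 'rV[R]_n.+1) (Q2 : 'M[R]_(k, n.+1)) (Qw : 'M[R]_(d, n.+1))
    (rho r : R) (eta : 'rV[R]_k -> 'rV[R]_1) (chi0 : 'rV[R]_k -> 'rV[R]_n),
  let Y x := (phi x - phi x0) *m Q2^T in
  let Z x := (phi x - phi x0) *m Qw^T in
  [/\ [/\ (k + d)%N = n, (1 <= d)%N, 0 < rho, 0 < r & ball x0 r `<=` U],
    [/\ N0 *m N0^T = 1%:M, Q2 *m Q2^T = 1%:M & Qw *m Qw^T = 1%:M] /\
    [/\ Q2 *m N0^T = 0, Qw *m N0^T = 0 & Q2 *m Qw^T = 0],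
    smooth (ball 0 rho) eta,
    [/\ forall x x', ball x0 r x -> ball x0 r x' -> Y x = Y x' -> Z x = Z x' -> x = x',
      forall y z, ball 0 rho y -> ball 0 rho z -> exists x, [/\ ball x0 r x, Y x = y & Z x = z] &
      forall x, ball x0 r x -> ball 0 rho (Y x) -> ball 0 rho (Z x) ->
        phi x = eta (Y x) *m N0 + Y x *m Q2 + Z x *m Qw + phi x0] &
    forall y, ball 0 rho y ->
      [/\ {for y, continuous chi0}, ball x0 r (chi0 y), Y (chi0 y) = y & Z (chi0 y) = 0]].
Proof.
move=> oU Ux0 sphi sB phiB fB WB W0.
(* E is an orthonormal frame of the tangent space at x0, and N0 the unit normal there. *)
have [E [EE EB]] := orthonormal_basis (eqP fB).
have [N0 [NN NE ENsum]] := orthonormal_complement EE (erefl (1 + n)%N).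
have EN : E *m N0^T = 0 by rewrite -[LHS]trmxK trmx_mul trmxK NE trmx0.
have inE q (X : 'M[R]_(q, n.+1)) : (X <= E)%MS -> X *m E^T *m E = X.
  by move=> /submxP[D ->]; rewrite -(mulmxA D E) EE mulmx1.
have WE : (W <= E)%MS by rewrite EB; exact: WB.
(* In the coordinates of E, Ow spans W and Oc its orthogonal complement; so d is the rank of W and k
   = n - d. *)
have [Ow [OwOw OwW]] := orthonormal_basis (erefl (\rank (W *m E^T))).
set d := \rank _ in Ow OwOw OwW.
have dn : (n - d + d)%N = n by rewrite subnK // rank_leq_col.
have [Oc [OcOc OcOw Osum]] := orthonormal_complement OwOw dn.
set k := (n - d)%N in dn Oc OcOc OcOw Osum.
have d1 : (1 <= d)%N.
  rewrite lt0n mxrank_eq0; apply: contra_neq W0 => WE0.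
  by rewrite -(inE _ _ WE) WE0 mul0mx.
pose Qw := Ow *m E; pose Q2 := Oc *m E.
have QwN : Qw *m N0^T = 0 by rewrite /Qw -mulmxA EN mulmx0.
have QwB x : U x -> (Qw <= B x)%MS.
  move=> Ux; apply: submx_trans (WB x Ux).
  have /submxP[D DE] : (Ow <= W *m E^T)%MS by rewrite OwW.
  by rewrite /Qw DE -mulmxA inE // submxMl.
pose psi x := (phi x - phi x0) *m E^T.
pose J x := B x *m E^T.
have spsi : smooth U psi.
  apply: smooth_mulmx => //; last exact: smooth_cst.
  by apply: smoothB => //; exact: smooth_cst.
have sJ : smooth U J by apply: smooth_mulmx => //; exact: smooth_cst.
have psiJ x v : U x -> 'D_v psi x = v *m J x.
  move=> Ux; have dphi : derivable phi x v by exact: smooth_derivable sphi Ux.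
  have dsub := derivableB dphi (derivable_cst (phi x0) x v).
  rewrite (derive_mulmx dsub (derivable_cst E^T x v)) (deriveB dphi (derivable_cst (phi x0) x v)).
  by rewrite !derive_cst mulmx0 addr0 subr0 phiB // mulmxA.
have uJ : J x0 \in unitmx.
  rewrite -row_free_unit -kermx_eq0; apply/rowV0P => v /sub_kermxP H.
  apply: (row_free_inj fB); rewrite mul0mx -[LHS](inE _ _ _); last by rewrite EB submxMl.
  by rewrite -(mulmxA v) -/(J x0) H mul0mx.
have [r [rho0 [chi [r0 rho00 rU psi_inj [chiP schi]]]]] :=
  inverse_function oU Ux0 spsi sJ psiJ uJ.
have psi0 : psi x0 = 0 by rewrite /psi subrr mul0mx.
rewrite psi0 in chiP schi; set D := ball 0 rho0 in chiP schi.
have oD : open D by exact: ball_open.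
(* This scale ensures that |y|, |z| < rho put y Oc + z Ow in the ball where chi is defined. *)
pose K := k%:R * `|Oc| + d%:R * `|Ow| + 1.
have K0 : 0 < K by rewrite ltr_wpDl // addr_ge0 // mulr_ge0.
pose rho := rho0 / K.
have rhop : 0 < rho by rewrite divr_gt0.
have ball0P m (y : 'rV[R]_m) e : ball 0 e y <-> `|y| < e.
  by rewrite -ball_normE /= sub0r normrN.
have inD (y : 'rV[R]_k) (z : 'rV[R]_d) : `|y| < rho -> `|z| < rho -> D (y *m Oc + z *m Ow).
  move=> y1 z1; apply/ball0P; apply: le_lt_trans (ler_normD _ _) _.
  apply: (@le_lt_trans _ _ (rho * (k%:R * `|Oc| + d%:R * `|Ow|))).
    rewrite mulrDr; apply: lerD; apply: le_trans (mulmx_norm_le _ _) _.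
      by rewrite mulrAC mulrC; apply: ler_wpM2r; [rewrite mulr_ge0|exact: ltW].
    by rewrite mulrAC mulrC; apply: ler_wpM2r; [rewrite mulr_ge0|exact: ltW].
  by rewrite /rho mulrAC ltr_pdivrMr // ltr_pM2l // ltrDl.
have Yproj (y : 'rV[R]_k) (z : 'rV[R]_d) : (y *m Oc + z *m Ow) *m Oc^T = y.
  rewrite mulmxDl -!mulmxA OcOc mulmx1.
  have -> : Ow *m Oc^T = 0 by rewrite -[LHS]trmxK trmx_mul trmxK OcOw trmx0.
  by rewrite mulmx0 addr0.
have Zproj (y : 'rV[R]_k) (z : 'rV[R]_d) : (y *m Oc + z *m Ow) *m Ow^T = z.
  by rewrite mulmxDl -!mulmxA OcOw OwOw mulmx1 mulmx0 add0r.
have YE x : (phi x - phi x0) *m Q2^T = psi x *m Oc^T by rewrite /Q2 trmx_mul mulmxA.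
have ZE x : (phi x - phi x0) *m Qw^T = psi x *m Ow^T by rewrite /Qw trmx_mul mulmxA.
have split_s (s : 'rV[R]_n) : s = s *m Oc^T *m Oc + s *m Ow^T *m Ow.
  by rewrite -!mulmxA -mulmxDr Osum mulmx1.
pose theta := phi \o chi.
have stheta : smooth D theta.
  move=> j; apply: (Ck_comp_mx oD oU _ (schi j) sphi) => s /chiP[+ _]; exact: rU.
(* Qw is tangent at chi s, say Qw = M B. The derivative of chi along z Ow must then be z M, both
   having the same image under the invertible J. *)
have Dtheta s (z : 'rV[R]_d) : D s -> 'D_(z *m Ow) theta s = z *m Qw.
  move=> Ds; have [Bs Es] := chiP s Ds; have Us := rU _ Bs.
  have dchi : differentiable chi s by exact: smooth_differentiable schi Ds.
  have dphi : differentiable phi (chi s) by exact: smooth_differentiable sphi Us.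
  have dpsi : differentiable psi (chi s) by exact: smooth_differentiable spsi Us.
  rewrite (derive_comp _ dchi dphi) phiB //.
  have H v : 'D_v chi s *m J (chi s) = v.
    rewrite -psiJ // -(derive_comp _ dchi dpsi) -[RHS](derive_id s v).
    apply: near_eq_derive; near=> t; have Dt : D t by near: t; exact: open_nbhs_nbhs.
    by have [] := chiP t Dt.
  have uJs : J (chi s) \in unitmx.
    apply: (proj2 (@mulmx1_unit R n (jacobian chi s) _ _)).
    apply/row_matrixP => i; rewrite row_mul (row_jacobian _ dchi) H.
    by rewrite rowE mulmx1.
  have /submxP[M ME] := QwB _ Us.
  have E1 : z *m M *m J (chi s) = z *m Ow.
    by rewrite /J -mulmxA (mulmxA M) -ME /Qw -!mulmxA EE mulmx1.
  suff -> : 'D_(z *m Ow) chi s = z *m M by rewrite -mulmxA -ME.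
  by apply: (can_inj (mulmxK uJs)); rewrite H E1.
pose eta (y : 'rV[R]_k) := (theta (y *m Oc) - phi x0) *m N0^T.
(* The height is constant along the segment in the direction z Ow, by the mean value theorem and the
   orthogonality of Qw to N0. *)
have theta_inv (y : 'rV[R]_k) (z : 'rV[R]_d) : `|y| < rho -> `|z| < rho ->
    (theta (y *m Oc + z *m Ow) - phi x0) *m N0^T = eta y.
  move=> y1 z1.
  have Dseg s : 0 <= s <= 1 -> D (y *m Oc + s *: (z *m Ow)).
    move=> /andP[s0 s1]; rewrite scalemxAl; apply: inD => //.
    by rewrite normrZ ger0_norm //; apply: le_lt_trans z1; rewrite ler_piMl.
  pose H s := (theta s *m N0^T) 0 0.
  have sH : smooth D H.
    have : smooth D (fun s => theta s *m N0^T).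
      by apply: smooth_mulmx => //; exact: smooth_cst.
    by move=> /smooth_mxP-/(_ oD 0 0).
  have [|s s01] := @MVT_line R _ H (y *m Oc) (z *m Ow) 1 ltr01.
    by move=> s s01; apply: smooth_differentiable sH _; exact: Dseg.
  have dt : derivable theta (y *m Oc + s *: (z *m Ow)) (z *m Ow).
    exact: smooth_derivable stheta (Dseg s s01).
  have dm := derivable_mulmx dt (derivable_cst N0^T _ (z *m Ow)).
  have -> : 'D_(z *m Ow) H (y *m Oc + s *: (z *m Ow)) = 0.
    rewrite (derive_coord 0 0 dm) (derive_mulmx dt (derivable_cst N0^T _ (z *m Ow))).
    rewrite derive_cst mulmx0 addr0 (Dtheta _ _ (Dseg s s01)) -[cst N0^T _]/(N0^T).
    by rewrite -(mulmxA z) QwN mulmx0 mxE.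
  rewrite mulr0 scale1r => /eqP; rewrite subr_eq0 => /eqP HE.
  rewrite /eta !mulmxBl; congr (_ - _); apply/matrixP => i j; rewrite !ord1; exact: HE.
exists k, d, N0, Q2, Qw, rho, r, eta, (fun y => chi (y *m Oc)).
split.
- by split.
- split; split=> //.
  + by rewrite /Q2 trmx_mul !mulmxA -(mulmxA Oc) EE mulmx1 OcOc.
  + by rewrite /Qw trmx_mul !mulmxA -(mulmxA Ow) EE mulmx1 OwOw.
  + by rewrite /Q2 -mulmxA EN mulmx0.
  + by rewrite /Q2 /Qw trmx_mul !mulmxA -(mulmxA Oc) EE mulmx1 OcOw.
- apply: smooth_mulmx => //; [exact: ball_open| |exact: smooth_cst].
  apply: smoothB; [exact: ball_open| |exact: smooth_cst].
  have cO : continuous (mulmxr Oc : 'rV[R]_k -> 'rV[R]_n) by exact: mulmxr_continuous.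
  have := smooth_affine (A := mulmxr Oc) 0 cO oD stheta.
  have -> : (fun x : 'rV[R]_k => theta (mulmxr Oc x + 0)) = (fun x => theta (x *m Oc)).
    by apply/funext => x; rewrite addr0.
  apply: smooth_sub => y /ball0P y1 /=.
  have := inD y 0 y1; rewrite mul0mx; apply; by rewrite normr0.
- split.
  + move=> x x' Bx Bx'; rewrite !YE !ZE => Ey Ez; apply: psi_inj => //.
    by rewrite (split_s (psi x)) Ey Ez -split_s.
  + move=> y z /ball0P y1 /ball0P z1; have Ds := inD y z y1 z1.
    have [Bs Es] := chiP _ Ds; exists (chi (y *m Oc + z *m Ow)).
    by rewrite YE ZE Es Yproj Zproj.
  + move=> x Bx; rewrite YE ZE => /ball0P y1 /ball0P z1.
    set y := psi x *m Oc^T in y1 *; set z := psi x *m Ow^T in z1 *.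
    have Es : psi x = y *m Oc + z *m Ow by exact: split_s.
    have Ds : D (psi x) by rewrite Es; exact: inD.
    have xE : x = chi (psi x) by have [Bs Es'] := chiP _ Ds; apply: psi_inj.
    rewrite -(theta_inv y z y1 z1) -Es /theta /= -xE.
    have E2 : y *m Q2 + z *m Qw = psi x *m E by rewrite /Q2 /Qw !mulmxA -mulmxDl -Es.
    rewrite -(addrA (_ *m N0)) E2.
    rewrite /psi -!mulmxA -mulmxDr ENsum mulmx1 subrK //.
- move=> y /ball0P y1; have Ds : D (y *m Oc).
    by have := inD y 0 y1; rewrite mul0mx addr0; apply; rewrite normr0.
  have [Bs Es] := chiP _ Ds; split=> //.
  + apply: (@continuous_comp _ _ _ (mulmxr Oc : 'rV[R]_k -> 'rV[R]_n) chi).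
      exact: mulmxr_continuous.
    exact: smooth_continuous schi Ds.
  + by rewrite YE Es; have := Yproj y 0; rewrite mul0mx addr0.
  + by rewrite ZE Es; have := Zproj y 0; rewrite mul0mx addr0.
Unshelve. all: by end_near. Qed.

End GraphOverTangent.

Lemma smooth_on_sub {R : realType} {V W : normedModType R} (A U : set V) (h h' : V -> W) :
  open U -> A `<=` U -> smooth U h' -> (forall x, A x -> h' x = h x) -> smooth_on A h.
Proof.
move=> oU AU sh hE x Ax; exists U, h'; split=> //; [exact: AU|by move=> y _ Ay; exact: hE].
Qed.

(** * The base of the cylinder: a graph over a ball as a Riemannian manifold *)

Section BallManifold.
Context {R : realType} {k : nat}.
Variables (rho : R) (eta : 'rV[R]_k -> 'rV[R]_1).
Hypothesis rho0 : 0 < rho.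
Let Y : set 'rV[R]_k := ball 0 rho.
Hypothesis seta : smooth Y eta.

Let Y0 : Y 0. Proof. exact: ballxx. Qed.
Let oY : open Y. Proof. exact: ball_open. Qed.

(** A retraction to the subtype, total because chart parametrisations are total; the centre is its
    value outside the ball. *)
Definition to_ball (x : 'rV[R]_k) : Y :=
  match pselect (Y x) with
  | left h => exist _ x (mem_set h)
  | right _ => exist _ 0 (mem_set Y0)
  end.

Lemma to_ballK x : Y x -> set_val (to_ball x) = x.
Proof. by rewrite /to_ball; case: pselect. Qed.

Lemma set_val_ball (y : Y) : Y (set_val y).
Proof. by case: y => y Yy; apply: set_mem. Qed.

Lemma set_valK (y : Y) : to_ball (set_val y) = y.
Proof. by apply: val_inj; exact: to_ballK (set_val_ball y). Qed.

Lemma to_ball_continuous_at {T : topologicalType} (u : T -> 'rV[R]_k) (p : T) :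
  (\forall q \near p, Y (u q)) -> {for p, continuous u} -> {for p, continuous (to_ball \o u)}.
Proof.
move=> Yu cu A [B [[Q oQ QB] BP BA]].
have Yp := nbhs_singleton Yu.
have Qp : Q (u p) by move: BP; rewrite -QB /= to_ballK.
have NQ : \forall q \near p, Q (u q) by apply: cu; exact: open_nbhs_nbhs.
suff : \forall q \near p, A (to_ball (u q)) by [].
near=> q; apply: BA; rewrite -QB.
have Yq : Y (u q) by near: q.
have : Q (u q) by near: q.
by rewrite -{1}(to_ballK Yq).
Unshelve. all: by end_near. Qed.

Definition ball_chart : chart R k Y := Chart setT set_val to_ball.

Lemma ball_chart_img : cimg ball_chart = Y.
Proof.
apply/seteqP; split=> [x [y _ <-]|x Yx]; first exact: set_val_ball.
by exists (to_ball x) => //; exact: to_ballK.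
Qed.

Lemma is_chart_ball : is_chart ball_chart.
Proof.
split; rewrite ?ball_chart_img; [exact: openT|exact: oY| | |].
- by move=> y _; exact: set_valK.
- by move=> y _; exact: initial_continuous.
- move=> x Yx; apply: (@to_ball_continuous_at 'rV[R]_k id) => //.
  by near=> z; near: z; exact: open_nbhs_nbhs.
Unshelve. all: by end_near. Qed.

Lemma ball_hausdorff_space : hausdorff_space Y.
Proof.
move=> p q pq; apply: val_inj; apply: (@norm_hausdorff R 'rV[R]_k).
move=> A B Ap Bq.
have [z [Az Bz]] := pq _ _ (@initial_continuous _ _ set_val p _ Ap) (@initial_continuous _ _ set_val q _ Bq).
by exists (set_val z).
Qed.

(** For the cylinder this is obtained by embedding the ball in M, whose topology is second
    countable. *)
Hypothesis Y_second_countable : @second_countable Y.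

Lemma ball_transition (c d : chart R k Y) : c = ball_chart -> d = ball_chart ->
  smooth_on (overlap c d) (transition c d).
Proof.
move=> -> ->; apply: (smooth_on_sub oY _ (@smooth_id R _ Y)).
  by move=> x [y _ <-]; exact: set_val_ball.
by move=> x [y _ <-]; rewrite /transition /= to_ballK //; exact: set_val_ball.
Qed.

Definition ball_manifold : manifold R k :=
  @Manifold R k Y [set ball_chart] ball_hausdorff_space Y_second_countable
    (fun c (hc : c = ball_chart) => let: erefl := esym hc in is_chart_ball)
    (fun p => ex_intro2 _ _ ball_chart erefl I) ball_transition.

(** The graph x -> (eta x, x), written with constant matrices so that the rules for products apply.
    The height comes first, to match a frame with the normal on top. *)
Definition graph_param (x : 'rV[R]_k) : 'rV[R]_(1 + k) :=
  eta x *m (row_mx 1%:M 0 : 'M[R]_(1, 1 + k)) + x *m (row_mx 0 1%:M : 'M[R]_(k, 1 + k)).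

Lemma smooth_graph_param : smooth Y graph_param.
Proof.
apply: smoothD => //; apply: smooth_mulmx => //; [exact: smooth_cst|exact: smooth_id|exact: smooth_cst].
Qed.

(** Forgetting the height undoes the graph map, which gives a right inverse of the Jacobian. *)
Lemma row_free_graph x : Y x -> row_free (jacobian graph_param x).
Proof.
move=> Yx; apply/row_freeP; exists (row_mx 0 1%:M : 'M[R]_(k, 1 + k))^T.
have dg : differentiable graph_param x := smooth_differentiable smooth_graph_param Yx.
apply/row_matrixP => i; rewrite row_mul (row_jacobian _ dg).
have dd := diff_derivable (v := delta_mx 0 i) dg.
have := derive_mulmx dd (derivable_cst (row_mx 0 1%:M : 'M[R]_(k, 1 + k))^T x _).
rewrite derive_cst mulmx0 addr0 => <-.
have -> : (fun y => graph_param y *m (row_mx 0 1%:M : 'M[R]_(k, 1 + k))^T) = id.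
  apply/funext => y; rewrite /graph_param mulmxDl -!mulmxA tr_row_mx !mul_row_col.
  by rewrite !(trmx0, trmx1, mul1mx, mul0mx, mulmx0, mulmx1, addr0, add0r).
by rewrite derive_id rowE mulmx1.
Qed.

Let J := jacobian graph_param.
Let sJ : smooth Y J. Proof. exact: smooth_jacobian oY smooth_graph_param. Qed.

Lemma graph_metric_smooth (c : chart R k ball_manifold) : atlas c ->
  smooth_on (cimg c) (fun x => J x *m (J x)^T).
Proof.
move=> ->; rewrite ball_chart_img; apply/smooth_onP => //.
by apply: smooth_mulmx => //; apply: smooth_trmx.
Qed.

Lemma graph_metric_sym (c : chart R k ball_manifold) (x : 'rV[R]_k) : atlas c -> cimg c x ->
  (J x *m (J x)^T)^T = J x *m (J x)^T.
Proof. by move=> _ _; rewrite trmx_mul trmxK. Qed.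

Lemma graph_metric_posdef (c : chart R k ball_manifold) (x v : 'rV[R]_k) : atlas c -> cimg c x ->
  v != 0 -> 0 < (v *m (J x *m (J x)^T) *m v^T) 0 0.
Proof.
move=> ->; rewrite ball_chart_img => Yx v0.
rewrite mulmxA -mulmxA -trmx_mul; apply: sqnorm_gt0.
apply: contra_neq v0 => vJ; apply: (row_free_inj (row_free_graph Yx)).
by rewrite mul0mx; exact: vJ.
Qed.

Lemma graph_metric_change (c d : chart R k ball_manifold) x : atlas c -> atlas d -> overlap c d x ->
  J x *m (J x)^T = 'J (transition c d) x *m (J (transition c d x) *m (J (transition c d x))^T)
    *m ('J (transition c d) x)^T.
Proof.
move=> -> -> [y _ <-]; set z := set_val y.
have Yz : Y z by exact: set_val_ball.
have E : \forall w \near z, w = transition ball_chart ball_chart w.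
  near=> w; rewrite /transition /= to_ballK //; near: w; exact: open_nbhs_nbhs.
have <- : z = transition ball_chart ball_chart z by exact: nbhs_singleton E.
have -> : 'J (transition ball_chart ball_chart) z = 1%:M.
  have did : differentiable (fun x : 'rV[R]_k => x) z by have [] := is_diff_id z.
  rewrite -(near_eq_jacobian did E); apply/row_matrixP => i.
  by rewrite (row_jacobian _ did) derive_id rowE mulmx1.
by rewrite mul1mx trmx1 mulmx1.
Unshelve. all: by end_near. Qed.

(** The metric is the one induced by the graph, so that [graph_map] is isometric by construction.
    With a single chart in the atlas, it need not look at the chart. *)
Definition graph_riemannian : riemannian R k :=
  @Riemannian R k ball_manifold (fun _ x => J x *m (J x)^T) graph_metric_smooth
    graph_metric_sym graph_metric_posdef graph_metric_change.

Definition graph_map (y : graph_riemannian) : 'rV[R]_(1 + k) := graph_param (set_val y).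

Lemma graph_isometric : isometric_immersion graph_map.
Proof.
have gE x : Y x -> (graph_map \o to_ball) x = graph_param x.
  by move=> Yx; rewrite /graph_map /= to_ballK.
have JE (c : chart R k graph_riemannian) x : atlas c -> cimg c x -> dmap graph_map c x = J x.
  move=> ->; rewrite ball_chart_img => Yx; apply/esym; apply: near_eq_jacobian.
    exact: smooth_differentiable smooth_graph_param Yx.
  by near=> z; apply/esym/gE; near: z; exact: open_nbhs_nbhs.
split; last by move=> c x ac cx; rewrite /induced_metric JE.
split=> [c ->|c x ac cx].
  rewrite ball_chart_img; apply: (smooth_on_sub oY _ smooth_graph_param) => //.
  by move=> x Yx; rewrite -gE.
by rewrite JE //; move: ac cx => ->; rewrite ball_chart_img; exact: row_free_graph.
Unshelve. all: by end_near. Qed.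

End BallManifold.

Lemma jacobian_split {R : realType} n p q m (Phi : 'rV[R]_n -> 'rV[R]_m) (a : 'rV[R]_n -> 'rV[R]_p)
    (z : 'rV[R]_n -> 'rV[R]_q) (A : 'M[R]_(p, m)) (D : 'M[R]_(q, m)) b x :
  differentiable a x -> differentiable z x -> differentiable Phi x ->
  (\forall y \near x, Phi y = a y *m A + z y *m D + b) ->
  'J Phi x = 'J a x *m A + 'J z x *m D.
Proof.
move=> da dz dP E; apply/row_matrixP => i.
rewrite linearD /= !row_mul !row_jacobian //.
have da' := diff_derivable (v := delta_mx 0 i) da.
have dz' := diff_derivable (v := delta_mx 0 i) dz.
have dA := derivable_mulmx da' (derivable_cst A x (delta_mx 0 i)).
have dD := derivable_mulmx dz' (derivable_cst D x (delta_mx 0 i)).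
have EA := derive_mulmx da' (derivable_cst A x (delta_mx 0 i)).
have ED := derive_mulmx dz' (derivable_cst D x (delta_mx 0 i)).
rewrite derive_cst mulmx0 addr0 in EA.
rewrite derive_cst mulmx0 addr0 in ED.
rewrite -EA -ED.
rewrite (near_eq_derive _ E).
rewrite (deriveD (derivableD dA dD) (derivable_cst b x (delta_mx 0 i))) derive_cst addr0.
exact: (deriveD dA dD).
Qed.

(** * Local cylinders from constant tangent directions *)

Section Cylinder.
Context {R : realType} {n : nat} {M : riemannian R n}.

Lemma chart_imgP (c : chart R n M) x : atlas c -> cimg c x ->
  cdom c (cparam c x) /\ Defs.coord c (cparam c x) = x.
Proof.
move=> /manifold_chart[_ _ cK _ _] [p cp <-]; by rewrite cK.
Qed.

Lemma smooth_map_continuous m (f : M -> 'rV[R]_m) : smooth_map f -> continuous f.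
Proof.
move=> sf p; have [c ac cp] := manifold_cover p.
have [od oi cK cc cpc] := manifold_chart ac.
have ci : cimg c (Defs.coord c p) by exists p.
have := smooth_continuous (proj1 (smooth_onP _ oi) (sf c ac)) ci => fc.
have : {for p, continuous ((f \o cparam c) \o Defs.coord c)}.
  by apply: continuous_comp; [exact: cc|exact: fc].
rewrite /prop_for /continuous_at /= cK //; apply: cvg_trans.
apply: near_eq_cvg; near=> q; rewrite /= cK //; near: q; exact: open_nbhs_nbhs.
Unshelve. all: by end_near. Qed.

(** The last hypothesis says that neighbourhoods in S come from T, so a countable base of T pulls
    back to one of S. *)
Lemma second_countable_pullback (S T : topologicalType) (i : S -> T) :
  @second_countable T -> continuous i ->
  (forall y A, nbhs y A -> exists2 V, nbhs (i y) V & i @^-1` V `<=` A) ->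
  @second_countable S.
Proof.
move=> [B cB [Bo Bb]] ci H; exists [set i @^-1` b | b in B].
  by apply: sub_countable cB; exact: card_image_le.
split=> [_ [b /Bo ob <-]|y A /H[V Vy VA]].
  by apply: open_comp => // y _; exact: ci.
have [b [Bb' by'] bV] := Bb _ _ Vy.
by exists (i @^-1` b); [split=> //; exists b|move=> z /bV/VA].
Qed.

(** Near [x0] the graph coordinates write f as a graph in the Y variables plus a linear term in Z,
    along orthogonal subspaces. Orthogonality makes the metric the sum of the graph metric and the
    flat one. *)
Lemma cylinder_of_constant_span (f : M -> 'rV[R]_n.+1) (c : chart R n M) (U : set 'rV[R]_n)
    (x0 : 'rV[R]_n) p (W : 'M[R]_(p, n.+1)) :
  isometric_immersion f -> atlas c -> open U -> U x0 -> U `<=` cimg c ->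
  (forall x, U x -> (W <= dmap f c x)%MS) -> W != 0 ->
  exists U' : set M, [/\ open U', U' !=set0 & part_of_cylinder f U'].
Proof.
move=> isof ac oU Ux0 Uc WB W0.
have [[sf ff] isom] := isof.
have [od oi cK cc cpc] := manifold_chart ac.
pose phi := f \o cparam c.
have sphi : smooth U phi := smooth_sub Uc (proj1 (smooth_onP _ oi) (sf c ac)).
have phiB x v : U x -> 'D_v phi x = v *m dmap f c x.
  by move=> Ux; apply: deriveEjacobian; exact: smooth_differentiable sphi Ux.
have [k [d [N0 [Q2 [Qw [rho [r [eta [chi0 []]]]]]]]]] := graph_over_tangent oU Ux0 sphi
  (smooth_jacobian oU sphi) phiB (ff c x0 ac (Uc _ Ux0)) WB W0.
move=> [kd d1 rho0 r0 rU] [[NN QQ2 QQw] [QN QwN Q2w]] seta [inj surj graphE] chi0P.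
set b := phi x0 in inj surj graphE chi0P.
pose ycoord (q : M) := (f q - b) *m Q2^T.
pose zcoord (q : M) := (f q - b) *m Qw^T.
have cf : continuous f := smooth_map_continuous sf.
have caff m (A : 'M[R]_(n.+1, m)) : continuous (fun q : M => (f q - b) *m A).
  move=> q; apply: (@continuous_comp _ _ _ (fun q => f q - b) (mulmxr A)).
    by apply: cvgB; [exact: cf|exact: cvg_cst].
  exact: mulmxr_continuous.
have cy : continuous ycoord by exact: caff.
have cz : continuous zcoord by exact: caff.
have imgr x : ball x0 r x -> cdom c (cparam c x) /\ Defs.coord c (cparam c x) = x.
  by move=> /rU/Uc; exact: chart_imgP.
(* The slice Z = 0 embeds the ball in M, with [ycoord] as inverse; the ball inherits second
   countability from it. *)
pose iota (y : (ball 0 rho : set 'rV[R]_k)) := cparam c (chi0 (set_val y)).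
have iotaP y : [/\ cdom c (iota y), ycoord (iota y) = set_val y & {for y, continuous iota}].
  have Yy := set_val_ball y; have [cchi Br yE _] := chi0P _ Yy.
  have [cdy _] := imgr _ Br; split=> //.
  apply: (@continuous_comp _ _ _ (chi0 \o set_val) (cparam c)).
    apply: (@continuous_comp _ _ _ (set_val : (ball 0 rho : set 'rV[R]_k) -> _) chi0).
      exact: initial_continuous.
    exact: cchi.
  by apply: cpc; apply: Uc; exact: rU.
have sc : @second_countable (ball 0 rho : set 'rV[R]_k).
  apply: (second_countable_pullback (@manifold_second_countable R n M) (i := iota)).
    by move=> y; have [] := iotaP y.
  move=> y A [B [[Q oQ QB] By BA]].
  exists (ycoord @^-1` Q).
    apply: cy; have [_ -> _] := iotaP y; apply: open_nbhs_nbhs; split=> //.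
    by move: By; rewrite -QB.
  by move=> z /=; have [_ -> _] := iotaP z => Qz; apply: BA; rewrite -QB.
pose N := graph_riemannian rho0 seta sc.
pose ys (q : M) : N := to_ball rho0 (ycoord q).
(* Bounding Y and Z separately makes the image of U' a full product of balls; the ball in the chart
   keeps (Y, Z) injective. *)
pose U' := [set q : M | [/\ cdom c q, ball x0 r (Defs.coord c q), ball 0 rho (ycoord q) & ball 0 rho (zcoord q)]].
have U'E q : U' q -> phi (Defs.coord c q) = f q by move=> [cq _ _ _]; rewrite /phi /= cK.
have p0 : U' (cparam c x0).
  have [cp0 cE] := imgr x0 (ballxx _ r0); split=> //.
  - by rewrite cE; exact: ballxx.
  - by rewrite /ycoord /b /phi /= subrr mul0mx; exact: ballxx.
  - by rewrite /zcoord /b /phi /= subrr mul0mx; exact: ballxx.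
have oU' : open U'.
  rewrite openE => q [cq Bq Yq Zq].
  have h1 : \forall q' \near q, cdom c q' by exact: open_nbhs_nbhs.
  have h2 : \forall q' \near q, ball x0 r (Defs.coord c q').
    by apply: (cc q cq); apply: open_nbhs_nbhs; split=> //; exact: ball_open.
  have h3 : \forall q' \near q, ball 0 rho (ycoord q').
    by apply: cy; apply: open_nbhs_nbhs; split=> //; exact: ball_open.
  have h4 : \forall q' \near q, ball 0 rho (zcoord q').
    by apply: cz; apply: open_nbhs_nbhs; split=> //; exact: ball_open.
  by rewrite /interior; near=> q'; split; near: q'.
exists U'; split=> //; first by exists (cparam c x0).
pose Qg : 'M[R]_(1 + k, n.+1) := col_mx N0 Q2.
have graphQ y : graph_param eta y *m Qg = eta y *m N0 + y *m Q2.
  rewrite /graph_param mulmxDl -!mulmxA !mul_row_col.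
  by rewrite !mul1mx !mul0mx addr0 add0r.
have NQ2 : N0 *m Q2^T = 0 by rewrite -[LHS]trmxK trmx_mul trmxK QN trmx0.
have QgQg : Qg *m Qg^T = 1%:M.
  by rewrite /Qg tr_col_mx mul_col_row NN QQ2 QN NQ2 -scalar_mx_block.
have QgQw : Qg *m Qw^T = 0.
  have NQw : N0 *m Qw^T = 0 by rewrite -[LHS]trmxK trmx_mul trmxK QwN trmx0.
  by rewrite /Qg mul_col_mx NQw Q2w col_mx0.
have QwQg : Qw *m Qg^T = 0 by rewrite -[LHS]trmxK trmx_mul trmxK QgQw trmx0.
have fE q : U' q -> f q = graph_param eta (ycoord q) *m Qg + zcoord q *m Qw + b.
  move=> Uq; have [cq Bq Yq Zq] := Uq.
  have := graphE (Defs.coord c q) Bq; rewrite (U'E q Uq) => /(_ Yq Zq) ->.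
  by rewrite graphQ.
have ysK q : U' q -> set_val (ys q) = ycoord q by move=> [_ _ Yq _]; exact: to_ballK.
have near_chart c' x : atlas c' -> cimg c' x -> U' (cparam c' x) ->
    \forall x' \near x, cimg c' x' /\ U' (cparam c' x').
  move=> ac' cx Ux; have [_ oi' _ _ cp'] := manifold_chart ac'.
  have h1 : \forall x' \near x, cimg c' x' by exact: open_nbhs_nbhs.
  have h2 : \forall x' \near x, U' (cparam c' x').
    by apply: (cp' x cx); exact: open_nbhs_nbhs.
  by near=> x'; split; near: x'.
have saff m (A : 'M[R]_(n.+1, m)) c' : atlas c' ->
    smooth (cimg c') (fun x => (f (cparam c' x) - b) *m A).
  move=> ac'; have [_ oi' _ _ _] := manifold_chart ac'.
  apply: (smooth_mulmx oi'); last exact: smooth_cst.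
  apply: (smoothB oi'); last exact: smooth_cst.
  exact: (proj1 (smooth_onP _ oi') (sf c' ac')).
have yse c' e x : atlas c' -> atlas e -> U' (cparam c' x) ->
    (Defs.coord e \o ys \o cparam c') x = ycoord (cparam c' x).
  by move=> _ -> Ux; rewrite /= ysK.
have isoY : product_isometry U' (ball 0 rho) ys zcoord.
  split.
  - split.
    + by move=> q [_ _ _ Zq]; split.
    + move=> q q' /set_mem Uq /set_mem Uq' /= [yE zE].
      have [cq Bq _ _] := Uq; have [cq' Bq' _ _] := Uq'.
      have fy : (phi (Defs.coord c q) - b) *m Q2^T = (phi (Defs.coord c q') - b) *m Q2^T.
        by rewrite (U'E q Uq) (U'E q' Uq') -[LHS](ysK q Uq) -[RHS](ysK q' Uq') yE.
      have fz : (phi (Defs.coord c q) - b) *m Qw^T = (phi (Defs.coord c q') - b) *m Qw^T.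
        by rewrite (U'E q Uq) (U'E q' Uq'); exact: zE.
      by rewrite -(cK q cq) (inj _ _ Bq Bq' fy fz) cK.
    + move=> [y z] [_ /= Zz]; have [x [Bx yE zE]] := surj (set_val y) z (set_val_ball y) Zz.
      have [cx xE] := imgr _ Bx.
      have Yx : ycoord (cparam c x) = set_val y by exact: yE.
      have Zx : zcoord (cparam c x) = z by exact: zE.
      exists (cparam c x); first by split; rewrite ?xE ?Yx ?Zx //; exact: set_val_ball.
      by rewrite /ys Yx Zx set_valK.
  - move=> q Uq; apply: to_ball_continuous_at; last exact: cy.
    have : \forall q' \near q, U' q' by exact: open_nbhs_nbhs.
    by apply: filterS => q' [].
  - move=> c' ac'; have [_ oi' _ _ _] := manifold_chart ac'.
    by apply: (smooth_on_sub oi' _ (saff _ Qw^T c' ac')) => [x []|].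
  - move=> c' e ac' ae; have [_ oi' _ _ _] := manifold_chart ac'.
    apply: (smooth_on_sub oi' _ (saff _ Q2^T c' ac')) => [x []|x [cx [Ux _]]] //.
    by rewrite yse.
  - move=> c' e q ac' ae Uq cq' ce.
    have [_ oi' cK' _ _] := manifold_chart ac'.
    set x := Defs.coord c' q; have cx : cimg c' x by exists q.
    have xq : cparam c' x = q by exact: cK'.
    have Ux : U' (cparam c' x) by rewrite xq.
    pose yx x' := ycoord (cparam c' x'); pose zx x' := zcoord (cparam c' x').
    have dy : differentiable yx x := smooth_differentiable (saff _ Q2^T c' ac') cx.
    have dz : differentiable zx x := smooth_differentiable (saff _ Qw^T c' ac') cx.
    have df : differentiable (f \o cparam c') x :=
      smooth_differentiable (proj1 (smooth_onP _ oi') (sf c' ac')) cx.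
    have Yx : ball 0 rho (yx x) by have [_ _] := Ux.
    have dg : differentiable (graph_param eta) (yx x).
      exact: smooth_differentiable (smooth_graph_param seta) Yx.
    have dgy : differentiable (graph_param eta \o yx) x by exact: differentiable_comp.
    have E : \forall x' \near x, (f \o cparam c') x' =
        (graph_param eta \o yx) x' *m Qg + zx x' *m Qw + b.
      by near=> x'; apply: fE; near: x'; apply: filterS (near_chart _ _ ac' cx Ux) => ? [].
    have Ey : 'J (Defs.coord e \o ys \o cparam c') x = 'J yx x.
      apply/esym/(near_eq_jacobian dy); near=> x'; apply/esym/(yse _ _ _ ac' ae).
      by near: x'; apply: filterS (near_chart _ _ ac' cx Ux) => ? [].
    have dfE : dmap f c' x = 'J yx x *m 'J (graph_param eta) (yx x) *m Qg + 'J zx x *m Qw.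
      rewrite -(jacobian_comp dy dg).
      exact: (jacobian_split dgy dz df E).
    have -> : metric e (Defs.coord e (ys q)) =
        'J (graph_param eta) (yx x) *m ('J (graph_param eta) (yx x))^T.
      have -> : Defs.coord e (ys q) = yx x by rewrite -{1}xq; exact: (yse _ _ _ ac' ae).
      reflexivity.
    have mE : metric c' x = dmap f c' x *m (dmap f c' x)^T by exact: esym (isom c' x ac' cx).
    have zE : induced_metric zcoord c' x = 'J zx x *m ('J zx x)^T by reflexivity.
    (* What remains is matrix algebra: the rows of Qg and Qw together are orthonormal, so the mixed
       terms of df df^T vanish. *)
    move: mE; rewrite dfE; move: Ey zE.
    move: ('J (Defs.coord e \o ys \o cparam c') x) (metric c' x) (induced_metric zcoord c' x) => Je mc mz.
    move: ('J yx x) ('J (graph_param eta) (yx x)) ('J zx x) => Jy Jg Jz -> -> ->.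
    rewrite linearD /= mulmxDl !mulmxDr !trmx_mul !mulmxA.
    rewrite -!(mulmxA _ Qg Qg^T) -!(mulmxA _ Qg Qw^T) -!(mulmxA _ Qw Qg^T) -!(mulmxA _ Qw Qw^T).
    by rewrite QgQg QgQw QwQg QQw !mulmx1 !mulmx0 !mul0mx addr0 add0r.
exists k, d, N, (ball 0 rho), ys, zcoord, (graph_map (rho0 := rho0) (seta := seta) (Y_second_countable := sc)),
  (col_mx Qg Qw), b; split.
- by split.
- by split; [exact: ball_open|exact: isoY].
- exact: graph_isometric.
- by rewrite tr_col_mx mul_col_row QgQg QQw QgQw QwQg -scalar_mx_block.
- by move=> q Uq; rewrite /graph_map ysK // mul_row_col; exact: fE.
Unshelve. all: by end_near. Qed.

End Cylinder.

(** * Variations *)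

Section OneSidedDerivative.
Context {R : realType}.
Variable I : set R.
Hypothesis itvI : is_interval I.
Hypothesis I_nontrivial : exists2 t, I t & t != 0.
Hypothesis I0 : I 0.

(** As 0 may be an end point of I, the derivative is computed on a function H defined on both sides
    that agrees with h on I. *)
Definition is_deriv0 {W : normedModType R} (h : R -> W) (d : W) : Prop :=
  exists H : R -> W, [/\ derivable H 0 1, 'D_1 H 0 = d & \forall t \near (0 : R), I t -> h t = H t].

(** Nonzero points of I accumulate at 0; properness of the filter makes the limit in [deriv0]
    unique. *)
Lemma within_dnbhs_proper : ProperFilter (within I (0 : R)^').
Proof.
apply: Build_ProperFilter_ex => A /nbhs_ballP[e /= e0 He].
have [t It t0] := I_nontrivial.
(* A point between 0 and t, hence in I, with 0 < |s| < e. *)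
pose s := t * (e / (e + `|t|)).
have nt : 0 < `|t| by rewrite normr_gt0.
have q1 : 0 < e / (e + `|t|) < 1.
  by rewrite divr_gt0 ?addr_gt0 //= ltr_pdivrMr ?addr_gt0 // mul1r ltrDl.
have s0 : s != 0 by rewrite mulf_neq0 // gt_eqF //; case/andP: q1.
exists s; apply: He => //.
  rewrite /ball /= sub0r normrN /s normrM (gtr0_norm (proj1 (andP q1))).
  rewrite mulrA ltr_pdivrMr ?addr_gt0 // mulrC ltr_pM2l //.
  by rewrite ltrDr.
case: (ltP 0 t) => tp.
  apply: (itvI I0 It); rewrite /s; apply/andP; split.
    by apply: mulr_ge0; [exact: ltW|apply: ltW; case/andP: q1].
  by rewrite ler_piMr //; [exact: ltW|apply: ltW; case/andP: q1].
apply: (itvI It I0); rewrite /s; apply/andP; split.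
  by rewrite ler_niMr //; apply: ltW; case/andP: q1.
by apply: mulr_le0_ge0 => //; apply: ltW; case/andP: q1.
Qed.

Lemma is_deriv0_eq {W : normedModType R} (h : R -> W) d : is_deriv0 h d -> Defs.deriv0 I h = d.
Proof.
move=> [H [dH <- hH]]; have PF := within_dnbhs_proper.
have h0 : h 0 = H 0 by exact: (nbhs_singleton hH).
apply: cvg_lim => //.
have : (fun t : R => t^-1 *: (H (t *: (1 : R) + 0) - H 0)) @ within I 0^' --> 'D_1 H 0.
  by apply: cvg_trans dH; apply: cvg_app; exact: cvg_within.
apply: cvg_trans; apply: near_eq_cvg.
have : \forall t \near 0^', I t -> h t = H t by exact: cvg_within hH.
by apply: filterS => t hHt It; rewrite h0 hHt // addr0 [t *: _]mulr1.
Qed.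

Lemma is_deriv0_mul m n p (h : R -> 'M[R]_(m, n)) (g : R -> 'M[R]_(p, n)) dh dg :
  is_deriv0 h dh -> is_deriv0 g dg ->
  is_deriv0 (fun t => h t *m (g t)^T) (dh *m (g 0)^T + h 0 *m dg^T).
Proof.
move=> [H [dH <- hH]] [K [dK <- gK]].
have -> : h 0 = H 0 by exact: (nbhs_singleton hH).
have -> : g 0 = K 0 by exact: (nbhs_singleton gK).
exists (fun t => H t *m (K t)^T); split.
- exact: derivable_mulmx dH (derivable_trmx dK).
- by rewrite (derive_mulmx dH (derivable_trmx dK)) (derive_trmx dK).
- by apply: filterS2 hH gK => t ht gt It; rewrite ht // gt.
Qed.

Lemma derive_slice_r {V W : normedModType R} (h : R * V -> W) t y v :
  'D_v (fun z => h (t, z)) y = 'D_((0, v) : R * V) h (t, y).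
Proof.
apply: (congr1 (fun u : R -> W => lim (u @ 0^'))); apply/funext => s /=.
by congr (_ *: (h _ - _)); congr (_, _); rewrite /= ?scaler0 ?add0r.
Qed.

Lemma derive_slice_l {V W : normedModType R} (h : R * V -> W) t y :
  'D_1 (fun s => h (s, y)) t = 'D_((1, 0) : R * V) h (t, y).
Proof.
apply: (congr1 (fun u : R -> W => lim (u @ 0^'))); apply/funext => s /=.
by congr (_ *: (h _ - _)); congr (_, _); rewrite /= ?scaler0 ?add0r.
Qed.

Lemma derivable_slice_l {V W : normedModType R} (h : R * V -> W) t y :
  differentiable h (t, y) -> derivable (fun s => h (s, y)) t 1.
Proof.
move=> dh; have := @diff_derivable _ _ _ _ _ ((1, 0) : R * V) dh.
rewrite /derivable.
set u := (X in X @ _); set u' := (X in _ -> cvg (X @ _)).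
suff -> : u = u' by [].
apply/funext => s; rewrite /u /u' /=.
by congr (_ *: (h _ - _)); congr (_, _); rewrite /= ?scaler0 ?add0r.
Qed.

Lemma pair_r_continuous {S T : topologicalType} (t : S) : continuous (fun y : T => (t, y)).
Proof. by move=> y; apply: cvg_pair => //; exact: cvg_cst. Qed.

Lemma pair_l_continuous {S T : topologicalType} (y : T) : continuous (fun t : S => (t, y)).
Proof. by move=> t; apply: cvg_pair => //; exact: cvg_cst. Qed.

Lemma differentiable_slice_r {V W : normedModType R} (h : R * V -> W) t y :
  differentiable h (t, y) -> differentiable (fun z => h (t, z)) y.
Proof.
by move=> dh; apply: (@differentiable_comp _ _ _ _ (fun z : V => (t, z)) h).
Qed.

Lemma smooth_slice_r {V W : normedModType R} (U : set (R * V)) (A : set V) (h : R * V -> W) t :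
  (forall y, A y -> U (t, y)) -> smooth U h -> smooth A (fun y => h (t, y)).
Proof.
move=> AU sh k; elim: k h sh => [|k IH] h sh.
  move=> y Ay; apply: (@continuous_comp _ _ _ (fun z : V => (t, z)) h); first exact: pair_r_continuous.
  exact: smooth_continuous sh (AU y Ay).
split=> [y Ay|v].
  exact: differentiable_slice_r (smooth_differentiable sh (AU y Ay)).
have -> : (fun y => 'D_v (fun z => h (t, z)) y) = (fun y => 'D_((0, v) : R * V) h (t, y)).
  by apply/funext => y; exact: derive_slice_r.
exact: IH (smooth_derive _ sh).
Qed.

(** The field tau is the t-derivative at 0 of a smooth extension of the family. Symmetry of mixed
    derivatives in the product of R with the chart then makes the Jacobian of tau the t-derivative
    of the Jacobians. *)
Lemma family_deriv0 n m (U : set (R * 'rV[R]_n)) (V : set 'rV[R]_n) (h : R * 'rV[R]_n -> 'rV[R]_m)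
    (g : R -> 'rV[R]_n -> 'rV[R]_m) :
  open U -> smooth U h -> open V -> (forall y, V y -> U (0, y)) ->
  (forall t y, I t -> V y -> U (t, y) -> h (t, y) = g t y) ->
  exists tau : 'rV[R]_n -> 'rV[R]_m,
    [/\ smooth V (g 0), smooth V tau,
      forall y, V y -> is_deriv0 (fun t => g t y) (tau y) &
      forall y, V y -> is_deriv0 (fun t => 'J (g t) y) ('J tau y)].
Proof.
move=> oU sh oV VU hg.
pose e1 : R * 'rV[R]_n := (1, 0).
pose tau y := 'D_e1 h (0, y).
have slice W' (k : R * 'rV[R]_n -> 'M[R]_(1, W')) : smooth U k -> smooth V (fun y => k (0, y)).
  by move=> sk; apply: smooth_slice_r VU sk.
have near0 y : V y -> \forall t \near (0 : R), U (t, y).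
  move=> Vy; apply: (@pair_l_continuous _ _ y (0 : R)); apply: open_nbhs_nbhs; split=> //.
  exact: VU.
have stau : smooth V tau by exact: (slice _ _ (smooth_derive e1 sh)).
exists tau; split=> //.
- by apply: (smooth_ext oV _ (slice _ _ sh)) => y Vy; apply: hg => //; exact: VU.
- move=> y Vy; exists (fun t => h (t, y)); split.
  + by apply: derivable_slice_l; exact: smooth_differentiable sh (VU y Vy).
  + exact: derive_slice_l.
  + by apply: filterS (near0 y Vy) => t Ut It; rewrite hg.
move=> y Vy.
(* The spatial Jacobian as a smooth function on the product, so that it can be differentiated in
   t. *)
pose K (q : R * 'rV[R]_n) : 'M[R]_(n, m) := \matrix_(i, j) ('D_((0, delta_mx 0 i) : R * 'rV[R]_n) h q) 0 j.
have sK : smooth U K.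
  apply/smooth_mxP => // i j.
  have sD := smooth_derive ((0, delta_mx 0 i) : R * 'rV[R]_n) sh.
  apply: (smooth_ext oU _ (proj1 (smooth_mxP _ oU) sD 0 j)) => q Uq.
  by rewrite mxE.
exists (fun t => K (t, y)); split.
- by apply: derivable_slice_l; exact: smooth_differentiable sK (VU y Vy).
- rewrite derive_slice_l; apply/matrixP => i j.
  have dK : derivable K (0, y) e1 by exact: smooth_derivable sK (VU y Vy).
  have sD := smooth_derive ((0, delta_mx 0 i) : R * 'rV[R]_n) sh.
  have dD := smooth_derivable (v := e1) sD (VU y Vy).
  rewrite -(derive_coord i j dK).
  have -> : (fun q => K q i j) = (fun q => ('D_((0, delta_mx 0 i) : R * 'rV[R]_n) h q) 0 j).
    by apply/funext => q; rewrite mxE.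
  rewrite (derive_coord 0 j dD) (jacobianE i j (smooth_differentiable stau Vy)).
  have comm := smooth_derive_comm ((0, delta_mx 0 i) : R * 'rV[R]_n) e1 oU (VU y Vy) sh.
  have slice_tau : 'D_(delta_mx 0 i) tau y = 'D_((0, delta_mx 0 i) : R * 'rV[R]_n) ('D_e1 h) (0, y).
    exact: (derive_slice_r ('D_e1 h) 0 y (delta_mx 0 i)).
  exact: (congr1 (fun X : 'rV[R]_m => X 0 j) (etrans comm (esym slice_tau))).
- apply: filterS (near0 y Vy) => t Ut It.
  have E : \forall z \near y, h (t, z) = g t z.
    have h1 : \forall z \near y, V z by exact: open_nbhs_nbhs.
    have h2 : \forall z \near y, U (t, z).
      by apply: (@pair_r_continuous _ _ t y); exact: open_nbhs_nbhs.
    by apply: filterS2 h1 h2 => z Vz Uz; exact: hg.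
  have dh := smooth_differentiable sh Ut.
  have dht := differentiable_slice_r dh.
  rewrite -(near_eq_jacobian dht E); apply/matrixP => i j.
  by rewrite (jacobianE i j dht) derive_slice_r [RHS]mxE.
Qed.

End OneSidedDerivative.

Section Variation.
Context {R : realType} {n m : nat} {M : manifold R n}.
Variables (I : set R) (F : R -> M -> 'rV[R]_m).
Hypothesis itvI : is_interval I.
Hypothesis I_nontrivial : exists2 t, I t & t != 0.
Hypothesis I0 : I 0.

Lemma chart_family_deriv0 (c : chart R n M) (U : set M) (g : R -> M -> 'rV[R]_m) x0 :
  atlas c -> cimg c x0 -> open U -> U (cparam c x0) -> smooth_family I U g ->
  exists (V : set 'rV[R]_n) (tau : 'rV[R]_n -> 'rV[R]_m),
    [/\ open V, V x0, V `<=` cimg c & V `<=` cparam c @^-1` U] /\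
    [/\ smooth V (g 0 \o cparam c), smooth V tau,
      forall y, V y -> is_deriv0 I (fun t => g t (cparam c y)) (tau y) &
      forall y, V y -> is_deriv0 I (fun t => dmap (g t) c y) ('J tau y)].
Proof.
move=> ac cx oU Ux sg; have [od oi cK cc cpc] := manifold_chart ac.
have [U' [h [oU' U'x sh hg]]] := sg c ac (0, x0) (conj I0 (conj cx Ux)).
pose V0 := [set y | [/\ cimg c y, U (cparam c y) & U' (0, y)]].
have oV0 : open V0.
  rewrite openE => y [cy Uy U'y]; rewrite /interior.
  have h1 : \forall z \near y, cimg c z by exact: open_nbhs_nbhs.
  have h2 : \forall z \near y, U (cparam c z) by apply: (cpc y cy); exact: open_nbhs_nbhs.
  have h3 : \forall z \near y, U' (0, z).
    by apply: (@pair_r_continuous _ _ (0 : R) y); exact: open_nbhs_nbhs.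
  by near=> z; split; near: z.
have V0U y : V0 y -> U' (0, y) by case.
have hgV t y : I t -> V0 y -> U' (t, y) -> h (t, y) = g t (cparam c y).
  by move=> It [cy Uy _] U'y; exact: (hg (t, y) U'y (conj It (conj cy Uy))).
have [tau [s0 stau d1 d2]] := family_deriv0 (g := fun t y => g t (cparam c y)) I0 oU' sh oV0 V0U hgV.
by exists V0, tau; do 2![split=> //] => y [].
Unshelve. all: by end_near. Qed.

Lemma variational_field_smooth : smooth_family I setT F -> smooth_map (variational_field I F).
Proof.
move=> sF c ac x cx; have [V [tau [[oV Vx _ _] [_ stau dtau _]]]] :=
  chart_family_deriv0 ac cx openT Logic.I sF.
exists V, tau; split=> // y Vy _; apply/esym; exact: (is_deriv0_eq itvI I_nontrivial I0 (dtau y Vy)).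
Qed.

End Variation.

Section NormalBending.
Context {R : realType} {n : nat} {M : manifold R n}.

(** The first-order conditions on T itself left by a variation that preserves the Gauss map, with a
    Gauss map N that may depend on the chart and the point. *)
Definition normal_bending (f T : M -> 'rV[R]_n.+1) : Prop :=
  forall (c : chart R n M) x0, atlas c -> cimg c x0 ->
  exists (Om : set 'rV[R]_n) (N : 'rV[R]_n -> 'rV[R]_n.+1),
    [/\ open Om, Om x0, Om `<=` cimg c & smooth Om N] /\
    forall x, Om x ->
      [/\ dmap f c x *m (N x)^T = 0, N x *m (N x)^T = 1%:M, dmap T c x *m (N x)^T = 0 &
        dmap f c x *m (dmap T c x)^T + dmap T c x *m (dmap f c x)^T = 0].

(** The t-derivative at 0 of df_t N_t^T = 0 is dT N^T + df (dN/dt)^T, whose second term vanishes as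
    N is preserved to first order. The bending equation is the derivative of the induced metric. *)
Lemma variational_field_bending (f : M -> 'rV[R]_n.+1) (I : set R) (F : R -> M -> 'rV[R]_n.+1) :
  is_variation f I F -> infinitesimal_variation I F -> preserves_gauss_map I F ->
  normal_bending f (variational_field I F).
Proof.
move=> [[itvI Int] I0 sF F0 immF] infF pgF c x0 ac cx.
have [V [tau [[oV Vx Vc _] [s0 stau dtau dJ]]]] := chart_family_deriv0 I0 ac cx openT Logic.I sF.
have [U [N [oU Ux [sN uN] dN]]] := pgF (cparam c x0).
have [V' [nu [[oV' V'x _ V'U] [sN0 _ dnu _]]]] := chart_family_deriv0 I0 ac cx oU Ux sN.
have CE x : V x -> dmap (variational_field I F) c x = 'J tau x.
  move=> Vy; apply/esym; apply: near_eq_jacobian; first exact: smooth_differentiable stau Vy.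
  have : \forall y \near x, V y by exact: open_nbhs_nbhs.
  by apply: filterS => y Vy'; apply/esym; exact: (is_deriv0_eq itvI Int I0 (dtau y Vy')).
exists (V `&` V'), (N 0 \o cparam c); split.
  split=> //; [exact: openI|by move=> y [/Vc]|].
  by apply: smooth_sub sN0; exact: subIsetr.
move=> x [Vy V'y].
have Uy : U (cparam c x) by exact: V'U.
have [cx' [od oi cK cc cpc]] := (Vc x Vy, manifold_chart ac).
have [p cp px] := cx'; have pE : cparam c x = p by rewrite -px cK.
have cpx : cdom c (cparam c x) by rewrite pE.
have coordx : Defs.coord c (cparam c x) = x by rewrite pE.
have nN t : I t -> dmap (F t) c x *m (N t (cparam c x))^T = 0.
  by move=> It; have [_ /(_ c ac cpx)] := uN t _ It Uy; rewrite coordx.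
split.
- by rewrite -F0; exact: nN.
- by have [] := uN 0 _ I0 Uy.
- have nu0 : nu x = 0 by rewrite -(dN _ Uy); apply/esym; exact: (is_deriv0_eq itvI Int I0 (dnu x V'y)).
  have D := is_deriv0_eq itvI Int I0 (is_deriv0_mul I0 (dJ x Vy) (dnu x V'y)).
  have Z : Defs.deriv0 I (fun t => dmap (F t) c x *m (N t (cparam c x))^T) = 0.
    apply: (is_deriv0_eq itvI Int I0); exists (fun=> 0).
    split; [exact: derivable_cst|exact: derive_cst|].
    by near=> t => It; exact: nN.
  have alg (X Xt B : 'M[R]_(n, n.+1)) (u v : 'rV[R]_n.+1) :
      0 = Xt *m u^T + B *m v^T -> v = 0 -> X = Xt -> X *m u^T = 0.
    by move=> E v0 ->; rewrite E v0 trmx0 mulmx0 addr0.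
  exact: alg (etrans (esym Z) D) nu0 (CE x Vy).
- have D := is_deriv0_eq itvI Int I0 (is_deriv0_mul I0 (dJ x Vy) (dJ x Vy)).
  have Z := infF c x ac cx'.
  have alg (X Xt B B' : 'M[R]_(n, n.+1)) : 0 = Xt *m B^T + B *m Xt^T -> B = B' -> X = Xt ->
      B' *m X^T + X *m B'^T = 0.
    by move=> E <- ->; rewrite addrC.
  exact: alg (etrans (esym Z) D) (congr1 (fun g => dmap g c x) F0) (CE x Vy).
Unshelve. all: by end_near. Qed.

End NormalBending.

(** * Bendings in charts *)

Section Framed.
Context {R : realType} {n : nat}.
Implicit Types (B C : 'rV[R]_n -> 'M[R]_(n, n.+1)) (g : 'rV[R]_n -> 'M[R]_n).

Definition bending_endo B C (x : 'rV[R]_n) : 'M[R]_n :=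
  C x *m (B x)^T *m invmx (B x *m (B x)^T).

(** The hypotheses of the local theory, with the Gauss map and the derivatives hidden behind
    existentials, so that later statements mention only B, C and the metric. *)
Definition framed (Om : set 'rV[R]_n) B C g : Prop :=
  exists (N : 'rV[R]_n -> 'rV[R]_n.+1) (dB dC : 'I_n -> 'rV[R]_n -> 'M[R]_(n, n.+1))
         (dN : 'I_n -> 'rV[R]_n -> 'rV[R]_n.+1),
    [/\ [/\ open Om, has_partials Om B dB, has_partials Om C dC & has_partials Om N dN],
      (forall x i k, Om x -> row i (dB k x) = row k (dB i x)) /\
      (forall x i k, Om x -> row i (dC k x) = row k (dC i x)),
      [/\ forall x, Om x -> B x *m (B x)^T \in unitmx,
        forall x, Om x -> B x *m (N x)^T = 0,
        forall x, Om x -> N x *m (N x)^T = 1%:M,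
        forall x, Om x -> C x *m (N x)^T = 0 &
        forall x, Om x -> B x *m (C x)^T + C x *m (B x)^T = 0] &
      forall x, Om x -> g x = B x *m (B x)^T].

Variables (Om : set 'rV[R]_n) (B C : 'rV[R]_n -> 'M[R]_(n, n.+1)) (g : 'rV[R]_n -> 'M[R]_n).
Hypothesis frm : framed Om B C g.
Let L := bending_endo B C.

Lemma framed_factor x : Om x -> C x = L x *m B x.
Proof.
have [N [dB [dC [dN [[oOm hB hC hN] [dBs dCs] [uBB BN NN CN BC] gE]]]]] := frm.
exact: (local_factor uBB BN NN CN).
Qed.

Lemma framed_skew x : Om x -> (L x *m g x)^T = - (L x *m g x).
Proof.
have [N [dB [dC [dN [[oOm hB hC hN] [dBs dCs] [uBB BN NN CN BC] gE]]]]] := frm.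
by move=> Ox; rewrite gE //; exact: (local_skew uBB BC).
Qed.

Lemma framed_smooth : smooth Om L.
Proof.
have [N [dB [dC [dN [[oOm [sB _] [sC _] _] _ [uBB _ _ _ _] _]]]]] := frm.
have sBt := smooth_trmx oOm sB.
apply: (smooth_mulmx oOm); first exact: smooth_mulmx.
by apply: (smooth_invmx oOm) => //; exact: smooth_mulmx.
Qed.

Lemma framed_cov_deriv k x : Om x -> cov_deriv g L k x = 0.
Proof.
have [N [dB [dC [dN [[oOm hB hC hN] [dBs dCs] [uBB BN NN CN BC] gE]]]]] := frm.
move=> Ox; have [dL hL] := has_partials_ex framed_smooth.
rewrite /cov_deriv (proj2 hL) // (local_christoffel oOm hB dBs _ gE) //.
exact: (local_parallel oOm hB hC dBs dCs uBB BN NN CN BC hL).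
Qed.

Lemma framed_second_form x (nu : 'rV[R]_n.+1) (H : 'M[R]_n) : Om x -> B x *m nu^T = 0 ->
  (forall i j, H i j = (partial j B x *m nu^T) i 0) -> H^T = H /\ (L x *m H)^T = L x *m H.
Proof.
have [N [dB [dC [dN [[oOm hB hC hN] [dBs dCs] [uBB BN NN CN BC] gE]]]]] := frm.
move=> Ox Bnu HE.
apply: (local_second_form oOm hB hC dBs dCs uBB BN NN CN Ox Bnu) => i j.
by rewrite HE (proj2 hB).
Qed.

Lemma framed_zero_parallel x0 : Om x0 ->
  exists r, [/\ 0 < r, ball x0 r `<=` Om &
    forall mu x y, ball x0 r x -> ball x0 r y ->
      (L x = 0 -> L y = 0) /\ (L x *m L x = mu%:M -> L y *m L y = mu%:M)].
Proof.
have [N [dB [dC [dN [[oOm hB hC hN] [dBs dCs] [uBB BN NN CN BC] gE]]]]] := frm.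
exact: (local_zero_parallel oOm hB hC dBs dCs uBB BN NN CN BC).
Qed.

Lemma framed_span k l x0 : Om x0 -> curvature g k l x0 != 0 ->
  exists mu r, [/\ 0 < r, ball x0 r `<=` Om &
    forall (v : 'cV[R]_n.+1) x y, ball x0 r x -> ball x0 r y ->
      (L x *m L x - mu%:M) *m B x *m v = 0 -> (L y *m L y - mu%:M) *m B y *m v = 0].
Proof.
have [N [dB [dC [dN [[oOm hB hC hN] [dBs dCs] [uBB BN NN CN BC] gE]]]]] := frm.
move=> Ox curv.
have W : exists k l, dB l x0 *m (N x0)^T *m (dB k x0 *m (N x0)^T)^T
    - dB k x0 *m (N x0)^T *m (dB l x0 *m (N x0)^T)^T != 0.
  exists k, l; apply: contra_neq curv => w0.
  by rewrite (local_curvature oOm hB hN dBs uBB BN NN _ _ gE Ox) w0 mul0mx.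
have [mu [r [r0 rO hmu]]] := local_eigen_const oOm hB hC hN dBs dCs uBB BN NN CN BC Ox W.
have [r' [r'0 rr' span]] := local_constant_span oOm hB hC dBs dCs uBB BN NN CN BC r0 rO hmu.
by exists mu, r'; split=> // x /rr'/rO.
Qed.

End Framed.

Lemma row_partial_jacobian {R : realType} m n (U : set 'rV[R]_m) (h : 'rV[R]_m -> 'rV[R]_n) x i k :
  open U -> U x -> smooth U h -> row i (partial k (jacobian h) x) = partial k (partial i h) x.
Proof.
move=> oU Ux sh.
have sJ := smooth_jacobian oU sh.
have sD := smooth_derive (delta_mx 0 i : 'rV[R]_m) sh.
have dJ : derivable (jacobian h) x (delta_mx 0 k) := smooth_derivable sJ Ux.
have dD : derivable ('D_(delta_mx 0 i) h) x (delta_mx 0 k) := smooth_derivable sD Ux.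
apply/rowP => j; rewrite mxE.
have E1 := derive_coord i j dJ.
have E2 := derive_coord 0 j dD.
apply: (etrans (esym E1)); apply: (etrans _ E2).
apply: near_eq_derive.
have : \forall y \near x, U y by exact: open_nbhs_nbhs.
by apply: filterS => y Uy; exact: jacobianE (smooth_differentiable sh Uy).
Qed.

Section ChartGeometry.
Context {R : realType} {n : nat} {M : riemannian R n}.
Variables (f T : M -> 'rV[R]_n.+1).
Hypothesis isof : isometric_immersion f.
Hypothesis sT : smooth_map T.
Hypothesis nbT : normal_bending f T.

Lemma smooth_map_chart m (h : M -> 'rV[R]_m) (c : chart R n M) : smooth_map h -> atlas c ->
  smooth (cimg c) (h \o cparam c).
Proof. by move=> sh ac; have [_ oi _ _ _] := manifold_chart ac; apply/smooth_onP => //; exact: sh. Qed.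

Lemma smooth_dmap m (h : M -> 'rV[R]_m) (c : chart R n M) : smooth_map h -> atlas c ->
  smooth (cimg c) (dmap h c).
Proof.
move=> sh ac; have [_ oi _ _ _] := manifold_chart ac.
exact: (smooth_jacobian oi (smooth_map_chart sh ac)).
Qed.

Lemma chart_framed (c : chart R n M) x0 : atlas c -> cimg c x0 ->
  exists Om, [/\ Om x0, Om `<=` cimg c & framed Om (dmap f c) (dmap T c) (metric c)].
Proof.
move=> ac cx; have [_ oi _ _ _] := manifold_chart ac.
have [[sf ff] iso] := isof.
have [Om [N [[oOm Ox Oc sN] H]]] := nbT ac cx.
have sB := smooth_sub Oc (smooth_dmap sf ac).
have sC := smooth_sub Oc (smooth_dmap sT ac).
have [dB hB] := has_partials_ex sB.
have [dC hC] := has_partials_ex sC.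
have [dN hN] := has_partials_ex sN.
exists Om; split=> //; exists N, dB, dC, dN; split.
- by split.
- have sym (h : M -> 'rV[R]_n.+1) dh : smooth_map h -> has_partials Om (dmap h c) dh ->
    forall x i k, Om x -> row i (dh k x) = row k (dh i x).
    move=> sh [_ hh] x i k Oy; rewrite -(hh k x Oy) -(hh i x Oy).
    have sh' := smooth_map_chart sh ac.
    apply: (etrans (row_partial_jacobian i k oi (Oc x Oy) sh')).
    apply: (etrans _ (esym (row_partial_jacobian k i oi (Oc x Oy) sh'))).
    exact: smooth_derive_comm oi (Oc x Oy) sh'.
  by split; [exact: sym hB|exact: sym hC].
- split=> x Oy; have [BN NN CN BC] := H x Oy => //.
  exact: gram_unitmx (ff c x ac (Oc x Oy)).
- by move=> x Oy; rewrite -(iso c x ac (Oc x Oy)).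
Qed.

(** The formula contains no Gauss map, so it is defined on the whole chart; its properties are
    proved on the small domains where a Gauss map exists. *)
Definition bend (c : chart R n M) := bending_endo (dmap f c) (dmap T c).

Lemma bend_factor (c : chart R n M) x : atlas c -> cimg c x -> dmap T c x = bend c x *m dmap f c x.
Proof. by move=> ac cx; have [Om [Ox _ fr]] := chart_framed ac cx; exact: (framed_factor fr). Qed.

Lemma bend_skew (c : chart R n M) x : atlas c -> cimg c x ->
  metric c x *m (bend c x)^T = - (bend c x *m metric c x).
Proof.
move=> ac cx; have [Om [Ox _ fr]] := chart_framed ac cx.
have alg (g L : 'M[R]_n) : g^T = g -> (L *m g)^T = - (L *m g) -> g *m L^T = - (L *m g).
  by move=> gs <-; rewrite trmx_mul gs.
exact: alg (Defs.metric_sym ac cx) (framed_skew fr Ox).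
Qed.

Lemma bend_cov_deriv (c : chart R n M) x k : atlas c -> cimg c x ->
  cov_deriv (metric c) (bend c) k x = 0.
Proof. by move=> ac cx; have [Om [Ox _ fr]] := chart_framed ac cx; exact: (framed_cov_deriv fr). Qed.

Lemma smooth_bend (c : chart R n M) : atlas c -> smooth (cimg c) (bend c).
Proof.
move=> ac k; apply: Ck_local => x cx; have [Om [Ox _ fr]] := chart_framed ac cx.
by exists Om => //; exact: (framed_smooth fr).
Qed.

Lemma near_chart (c : chart R n M) (A : set M) x : atlas c -> cimg c x -> open A -> A (cparam c x) ->
  \forall y \near x, cimg c y /\ A (cparam c y).
Proof.
move=> ac cx oA Ax; have [_ oi _ _ cp] := manifold_chart ac.
have h1 : \forall y \near x, cimg c y by exact: open_nbhs_nbhs.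
have h2 : \forall y \near x, A (cparam c y) by apply: (cp x cx); exact: open_nbhs_nbhs.
exact: filterS2 h1 h2.
Qed.

Lemma chart_change (c d : chart R n M) p : atlas c -> atlas d -> cdom c p -> cdom d p ->
  let Jt := 'J (transition c d) (Defs.coord c p) in
  (forall m (h : M -> 'rV[R]_m), smooth_map h ->
    dmap h c (Defs.coord c p) = Jt *m dmap h d (Defs.coord d p)).
Proof.
move=> ac ad cp dp Jt m h sh.
have [od oi cK cc cpc] := manifold_chart ac; have [od' oi' dK cd cpd] := manifold_chart ad.
set x := Defs.coord c p; have cx : cimg c x by exists p.
have xp : cparam c x = p by exact: cK.
have near_dom : \forall y \near x, cimg c y /\ cdom d (cparam c y).
  by apply: near_chart => //; rewrite xp.
have ov : overlap c d x by exists p.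
have tx : transition c d x = Defs.coord d p by rewrite /transition /= xp.
have dt : differentiable (transition c d) x.
  have [U [t [oU Ux st tE]]] := manifold_transition ac ad ov.
  apply: near_eq_differentiable (smooth_differentiable (st : smooth U t) Ux).
  have hU : \forall y \near x, U y by exact: open_nbhs_nbhs.
  apply: filterS2 hU near_dom => y Uy [cy dy]; apply: tE => //.
  by exists (cparam c y); [split=> //; case: (chart_imgP ac cy)|case: (chart_imgP ac cy)].
have dx : cimg d (transition c d x) by rewrite tx; exists p.
have dh := smooth_differentiable (smooth_map_chart sh ad) dx.
rewrite -tx -(jacobian_comp dt dh); apply/esym.
apply: near_eq_jacobian; first exact: (differentiable_comp dt dh).
by apply: filterS near_dom => y [cy dy]; rewrite /transition /= dK.
Qed.

Lemma row_free_dmap (c : chart R n M) x : atlas c -> cimg c x -> row_free (dmap f c x).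
Proof. by move=> ac cx; have [[_ ff] _] := isof; exact: ff. Qed.

(** By the chain rule df in one chart factors through this Jacobian, and a product of full row rank
    forces its left factor to have full rank. *)
Lemma transition_unit (c d : chart R n M) p : atlas c -> atlas d -> cdom c p -> cdom d p ->
  'J (transition c d) (Defs.coord c p) \in unitmx.
Proof.
move=> ac ad cp dp; have [[sf _] _] := isof.
rewrite -row_free_unit; apply/eqP/eqP.
have cx : cimg c (Defs.coord c p) by exists p.
have := row_free_dmap ac cx; rewrite (chart_change ac ad cp dp sf) /row_free => /eqP rk.
by rewrite eqn_leq rank_leq_row -{1}rk mxrankM_maxl.
Qed.

(** The differentials of f and of T change in the same way; cancelling df, which has independent
    rows, shows that L is a tensor. *)
Lemma bend_change (c d : chart R n M) p : atlas c -> atlas d -> cdom c p -> cdom d p ->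
  let Jt := 'J (transition c d) (Defs.coord c p) in
  bend c (Defs.coord c p) *m Jt = Jt *m bend d (Defs.coord d p).
Proof.
move=> ac ad cp dp Jt; have [[sf _] _] := isof.
have cx : cimg c (Defs.coord c p) by exists p.
have dx : cimg d (Defs.coord d p) by exists p.
apply: (row_free_inj (row_free_dmap ad dx)).
have Ef : dmap f c (Defs.coord c p) = Jt *m dmap f d (Defs.coord d p) := chart_change ac ad cp dp sf.
have ET : dmap T c (Defs.coord c p) = Jt *m dmap T d (Defs.coord d p) := chart_change ac ad cp dp sT.
have alg (J L L' : 'M[R]_n) (X X' Y Y' : 'M[R]_(n, n.+1)) : X = J *m X' -> Y = J *m Y' ->
    Y = L *m X -> Y' = L' *m X' -> L *m J *m X' = J *m L' *m X'.
  by move=> XE YE EY EY'; rewrite -!mulmxA -EY' -XE -EY.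
exact: alg Ef ET (bend_factor ac cx) (bend_factor ad dx).
Qed.

End ChartGeometry.

(** * The complex structure *)

Lemma scalar_mx_inj_pos {R : nzRingType} n (a b : R) : (0 < n)%N -> (a%:M = b%:M :> 'M[R]_n) -> a = b.
Proof. by case: n => // n _ /matrixP/(_ 0 0); rewrite !mxE. Qed.

(** For v with v L nonzero, 0 < <v L, v L> = - <v L^2, v> = - mu <v, v>. *)
Lemma skew_square_neg {R : realFieldType} n (L g : 'M[R]_n) (mu : R) :
  (forall v : 'rV_n, v != 0 -> 0 < (v *m g *m v^T) 0 0) -> g *m L^T = - (L *m g) -> L != 0 ->
  L *m L = mu%:M -> mu < 0.
Proof.
move=> gpos skew L0 LL.
have [i vL0] : exists i, row i L != 0.
  apply: contrapT => H; move/eqP: L0; apply; apply/row_matrixP => i.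
  by rewrite row0; apply: contrapT => /eqP ri; apply: H; exists i.
set v := delta_mx 0 i : 'rV[R]_n.
rewrite rowE -/v in vL0.
have v0 : v != 0 by apply: contra_neq vL0 => ->; rewrite mul0mx.
have := gpos _ vL0; rewrite trmx_mul !mulmxA -(mulmxA (v *m L)) skew.
rewrite mulmxN mulNmx !mulmxA -(mulmxA v L L) LL mul_mx_scalar -!scalemxAl !mxE oppr_gt0.
by rewrite pmulr_llt0 //; have := gpos v v0; rewrite mxE.
Qed.

(** The trace of L A L is - mu tr A by anticommuting and mu tr A by cyclicity. *)
Lemma anticommute_trace {R : realFieldType} n (L A : 'M[R]_n) (mu : R) : mu != 0 ->
  L *m L = mu%:M -> L *m A = - (A *m L) -> \tr A = 0.
Proof.
move=> mu0 LL LA; have E : \tr (L *m A *m L) = - (\tr (L *m A *m L)).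
  have E1 : L *m A *m L = - (mu *: A) by rewrite LA mulNmx -mulmxA LL mul_mx_scalar.
  have E2 : \tr (L *m A *m L) = \tr (mu *: A) by rewrite mxtrace_mulC mulmxA LL mul_scalar_mx.
  by rewrite {1}E1 linearN /= E2.
have : \tr (L *m A *m L) = 0 by lra.
rewrite mxtrace_mulC mulmxA LL mul_scalar_mx linearZ /= => /eqP.
by rewrite mulf_eq0 (negbTE mu0) => /eqP.
Qed.

Section Bending.
Context {R : realType} {n : nat} {M : riemannian R n}.
Variables (f T : M -> 'rV[R]_n.+1).
Hypothesis n0 : (0 < n)%N.
Hypothesis isof : isometric_immersion f.
Hypothesis sT : smooth_map T.
Hypothesis nbT : normal_bending f T.
Hypothesis nontriv : forall U : set M, open U -> U !=set0 -> ~ trivial_bending f U T.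
Hypothesis nonflat : forall p : M, ~ flat_point p.
Hypothesis noncyl : forall U : set M, open U -> U !=set0 -> ~ part_of_cylinder f U.

Let L := bend f T.

Lemma open_chart_preimage (c : chart R n M) (A : set 'rV[R]_n) : atlas c -> open A ->
  open (cdom c `&` Defs.coord c @^-1` A).
Proof.
move=> ac oA; have [od oi cK cc cpc] := manifold_chart ac.
rewrite openE => q [cq Aq]; rewrite /interior.
have h1 : \forall z \near q, cdom c z by exact: open_nbhs_nbhs.
have h2 : \forall z \near q, A (Defs.coord c z) by apply: (cc q cq); exact: open_nbhs_nbhs.
exact: filterS2 h1 h2.
Qed.

Lemma bend_neq0 (c : chart R n M) x : atlas c -> cimg c x -> L c x != 0.
Proof.
move=> ac cx; apply/eqP => L0.
have [Om [Ox Oc fr]] := chart_framed isof sT nbT ac cx.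
have [r [r0 rO zp]] := framed_zero_parallel fr Ox.
have dT0 y : ball x r y -> dmap T c y = 0.
  move=> By; have [Ly _] := zp 0 x y (ballxx _ r0) By.
  have LB (X : 'M[R]_n) (Y Z : 'M[R]_(n, n.+1)) : Y = X *m Z -> X = 0 -> Y = 0.
    by move=> -> ->; rewrite mul0mx.
  exact: LB (framed_factor fr (rO y By)) (Ly L0).
have sTc := smooth_sub (fun y By => Oc y (rO y By)) (smooth_map_chart sT ac).
have hT : has_partials (ball x r) (T \o cparam c) (fun _ _ => 0).
  split=> // k y By; have dd := smooth_differentiable sTc By.
  apply: (etrans (esym (row_jacobian k dd))).
  by apply: (etrans (congr1 (row k) (dT0 y By))); exact: row0.
have [s [s0 sr Tc]] := has_partials_zero_const (ball_open x r) hT (ballxx _ r0).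
have [cpx xE] := chart_imgP ac cx.
pose U := cdom c `&` Defs.coord c @^-1` ball x s.
apply: (nontriv (U := U)).
- by apply: open_chart_preimage => //; exact: ball_open.
- by exists (cparam c x); split=> //=; rewrite xE; exact: ballxx.
- exists 0, (T (cparam c x)); split=> [|q [cq Bq]]; first by rewrite trmx0 oppr0.
  have [_ _ cK _ _] := manifold_chart ac.
  by rewrite mulmx0 add0r -(cK q cq); exact: Tc Bq.
Qed.

Lemma bend_scalar_chart p : exists c mu, [/\ atlas c, cdom c p &
  L c (Defs.coord c p) *m L c (Defs.coord c p) = mu%:M].
Proof.
(* Flatness is tested in all charts, so its failure provides just one chart with a nonzero curvature
   component; the other charts are reached through [bend_change]. *)
have [c [ac cp [k [l curv]]]] : exists c, [/\ atlas c, cdom c p &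
    exists k l, curvature (metric c) k l (Defs.coord c p) != 0].
  apply: contrapT => H; apply: (nonflat (p := p)) => c ac cp k l.
  by apply: contrapT => /eqP kl; apply: H; exists c; split=> //; exists k, l.
set x := Defs.coord c p; have cx : cimg c x by exists p.
have [Om [Ox Oc fr]] := chart_framed isof sT nbT ac cx.
have [mu [r [r0 rO span]]] := framed_span fr Ox curv.
exists c, mu; split=> //; apply: contrapT => LL.
pose Z y := (L c y *m L c y - mu%:M) *m dmap f c y.
have h1 : ball x r `<=` cimg c by move=> y /rO/Oc.
(* Row spaces are compared through annihilators: a vector killed by Z y is killed by Z x, so the
   rows of Z x lie in the span of those of Z y, hence in the tangent space at y. *)
have h2 y : ball x r y -> (Z x <= dmap f c y)%MS.
  move=> By; apply: (@submx_trans _ _ _ _ _ _ (Z y)); last exact: submxMl.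
  have alg (X Y : 'M[R]_(n, n.+1)) (K : 'M[R]_n.+1) :
      (forall v : 'cV_n.+1, X *m v = 0 -> Y *m v = 0) -> X *m K = 0 -> Y *m K = 0.
    move=> XY XK; apply/matrixP => i j.
    have := XY (col j K); rewrite !colE !mulmxA XK mul0mx -colE => /(_ erefl) /matrixP/(_ i 0).
    by rewrite !mxE.
  rewrite submxE; apply/eqP; apply: alg (mulmx_coker (Z y)) => v.
  exact: span By (ballxx x r0).
have h3 : Z x != 0.
  apply/eqP => Z0; apply: LL; apply/eqP; rewrite -subr_eq0; apply/eqP.
  apply: (row_free_inj (row_free_dmap isof ac cx)).
  by rewrite mul0mx; exact: Z0.
have [U' [oU' U'0 cyl]] := cylinder_of_constant_span isof ac (ball_open x r) (ballxx x r0) h1 h2 h3.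
exact: noncyl oU' U'0 cyl.
Qed.

(** The value lam p is chosen at each point separately; it does not depend on the chart because the
    matrices of L in two charts are conjugate by the transition Jacobian. Its regularity is
    established afterwards. *)
Lemma bend_square : exists lam : M -> R, (forall p, 0 < lam p) /\
  forall c x, atlas c -> cimg c x -> L c x *m L c x = (- lam (cparam c x) ^+ 2)%:M.
Proof.
have H p : exists lam : R, 0 < lam /\ forall c, atlas c -> cdom c p ->
    L c (Defs.coord c p) *m L c (Defs.coord c p) = (- lam ^+ 2)%:M.
  have [d [mu [ad dp LLd]]] := bend_scalar_chart p.
  have dx : cimg d (Defs.coord d p) by exists p.
  have mu0 : mu < 0.
    apply: (skew_square_neg _ (bend_skew isof sT nbT ad dx) (bend_neq0 ad dx) LLd).
    by move=> v; exact: (metric_posdef ad dx).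
  exists (Num.sqrt (- mu)); split=> [|c ac cp]; first by rewrite sqrtr_gt0 oppr_gt0.
  have sq : Num.sqrt (- mu) ^+ 2 = - mu by rewrite sqr_sqrtr // oppr_ge0 ltW.
  suff : L c (Defs.coord c p) *m L c (Defs.coord c p) = mu%:M by rewrite sq opprK.
  have ut := transition_unit isof ac ad cp dp.
  have LJ := bend_change isof sT nbT ac ad cp dp.
  have alg (J X Y : 'M[R]_n) : J \in unitmx -> X *m J = J *m Y -> Y *m Y = mu%:M -> X *m X = mu%:M.
    move=> uJ XJ YY; apply: (row_free_inj (A := J)); rewrite ?row_free_unit //.
    by rewrite -mulmxA XJ mulmxA XJ -mulmxA YY mul_mx_scalar mul_scalar_mx.
  exact: alg ut LJ LLd.
have [lam Hlam] := choice H.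
exists lam; split=> [p|c x ac cx]; first by have [] := Hlam p.
have [cp xE] := chart_imgP ac cx.
by have [_ /(_ c ac cp)] := Hlam (cparam c x); rewrite xE.
Qed.

Variable lam : M -> R.
Hypothesis lam_gt0 : forall p, 0 < lam p.
Hypothesis bend_sq : forall c x, atlas c -> cimg c x -> L c x *m L c x = (- lam (cparam c x) ^+ 2)%:M.

Lemma lam_chart_constant (c : chart R n M) x : atlas c -> cimg c x ->
  \forall y \near x, lam (cparam c y) = lam (cparam c x).
Proof.
move=> ac cx; have [Om [Ox Oc fr]] := chart_framed isof sT nbT ac cx.
have [r [r0 rO zp]] := framed_zero_parallel fr Ox.
have : \forall y \near x, ball x r y by exact: nbhsx_ballx.
apply: filterS => y By.
have [_ LLy] := zp (- lam (cparam c x) ^+ 2) x y (ballxx _ r0) By.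
have := etrans (esym (LLy (bend_sq ac cx))) (bend_sq ac (Oc y (rO y By))).
(* A scalar matrix determines its scalar as n > 0, and lam is determined by its square as it is
   positive. *)
move=> /(scalar_mx_inj_pos n0) /oppr_inj /eqP.
by rewrite eqrXn2 ?ltW // => /eqP.
Qed.

Lemma lam_locally_constant p : \forall q \near p, lam q = lam p.
Proof.
have [c ac cp] := manifold_cover p; have [od oi cK cc cpc] := manifold_chart ac.
have cx : cimg c (Defs.coord c p) by exists p.
have h1 : \forall q \near p, cdom c q by exact: open_nbhs_nbhs.
have h2 : \forall q \near p, lam (cparam c (Defs.coord c q)) = lam (cparam c (Defs.coord c p)).
  exact: (cc p cp _ (lam_chart_constant ac cx)).
by apply: filterS2 h1 h2 => q cq; rewrite !cK.
Qed.

Definition bending_structure (c : chart R n M) (x : 'rV[R]_n) : 'M[R]_n :=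
  (lam (cparam c x))^-1 *: L c x.

(** Orthogonality comes from L G L^T = - L^2 G = lam^2 G, and local constancy of lam lets the
    division by it pass through derivatives. *)
Lemma bending_kaehler : kaehler_structure bending_structure.
Proof.
have lamU p : lam p != 0 by rewrite gt_eqF.
split.
- move=> c ac; have [_ oi _ _ _] := manifold_chart ac.
  apply/(smooth_onP _ oi) => k; apply: Ck_local => x cx.
  have [U [oU Ux UE]] : exists U : set 'rV[R]_n, [/\ open U, U x &
      forall y, U y -> cimg c y /\ lam (cparam c y) = lam (cparam c x)].
    have h1 : \forall y \near x, cimg c y by exact: open_nbhs_nbhs.
    have : nbhs x [set y | cimg c y /\ lam (cparam c y) = lam (cparam c x)].
      exact: filterI h1 (lam_chart_constant ac cx).
    move=> /nbhs_ballP[e /= e0 He].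
    by exists (ball x e); split; [exact: ball_open|exact: ballxx|move=> y /He].
  exists U => //; apply: (Ck_ext oU (h := fun y => ((lam (cparam c x))^-1)%:M *m L c y)).
    by move=> y /UE[_ ly]; rewrite /bending_structure ly mul_scalar_mx.
  apply: smooth_mulmx => //; first exact: smooth_cst.
  by apply: smooth_sub (smooth_bend isof sT nbT ac) => y /UE[].
- move=> c d x ac ad [p [cp dp] <-].
  have [_ _ cK _ _] := manifold_chart ac; have [_ _ dK _ _] := manifold_chart ad.
  have := bend_change isof sT nbT ac ad cp dp.
  have -> : transition c d (Defs.coord c p) = Defs.coord d p by rewrite /transition /= cK.
  rewrite /bending_structure cK // dK //.
  by rewrite -scalemxAl -scalemxAr => ->.
- move=> c x ac cx; rewrite /bending_structure -scalemxAl -scalemxAr bend_sq // scalerA scale_scalar_mx.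
  by apply/matrixP => i j; rewrite !mxE -mulNrn; congr (_ *+ _); field.
- move=> c x ac cx; rewrite /bending_structure linearZ /= -scalemxAl -scalemxAl -scalemxAr -mulmxA.
  rewrite (bend_skew isof sT nbT ac cx) mulmxN mulmxA bend_sq // mul_scalar_mx -scaleNr opprK.
  by rewrite !scalerA -[RHS]scale1r; congr (_ *: _); field.
- move=> c x k ac cx.
  have near_lam := lam_chart_constant ac cx.
  have dL : derivable (L c) x (delta_mx 0 k) := smooth_derivable (smooth_bend isof sT nbT ac) cx.
  have E : partial k (bending_structure c) x = (lam (cparam c x))^-1 *: partial k (L c) x.
    apply: (etrans _ (deriveZ (lam (cparam c x))^-1 dL)).
    by apply: near_eq_derive; apply: filterS near_lam => y ly; rewrite /bending_structure ly.
  have alg a (X Y D D' G : 'M[R]_n) : D' = a *: D -> Y = a *: X -> D + X *m G - G *m X = 0 ->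
      D' + Y *m G - G *m Y = 0.
    by move=> -> -> D0; rewrite -scalemxAl -scalemxAr -scalerDr -scalerBr D0 scaler0.
  exact: alg E (erefl (bending_structure c x)) (bend_cov_deriv isof sT nbT k ac cx).
Qed.

Lemma bending_minimal : minimal f.
Proof.
move=> p nu [_ nuP] c ac cp; have Bnu := nuP c ac cp.
set x := Defs.coord c p in Bnu *; have cx : cimg c x by exists p.
have [_ oi _ _ _] := manifold_chart ac; have [[sf _] _] := isof.
have [Om [Ox Oc fr]] := chart_framed isof sT nbT ac cx.
have HE i j : second_form f c nu x i j = (partial j (dmap f c) x *m nu^T) i 0.
  rewrite mxE.
  have sc := smooth_map_chart sf ac.
  have rw := row_partial_jacobian i j oi cx sc.
  have cm := smooth_derive_comm (delta_mx 0 i : 'rV[R]_n) (delta_mx 0 j) oi cx sc.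
  have alg (X Y : 'rV[R]_n.+1) (Z : 'M[R]_(n, n.+1)) : row i Z = X -> X = Y ->
      (Y *m nu^T) 0 0 = (Z *m nu^T) i 0.
    by move=> <- <-; rewrite -row_mul mxE.
  exact: alg rw cm.
have [Hs LHs] := framed_second_form fr Ox Bnu HE.
have skew := bend_skew isof sT nbT ac cx.
have LL := bend_sq ac cx.
have gu : metric c x \in unitmx.
  by have [[_ ff] iso] := isof; rewrite -iso //; exact: gram_unitmx (ff c x ac cx).
rewrite /mean_curvature.
suff -> : \tr (second_form f c nu x *m invmx (metric c x)) = 0 by rewrite mulr0.
have lam2 : - lam (cparam c x) ^+ 2 != 0 by rewrite oppr_eq0 sqrf_eq0 gt_eqF.
apply: (anticommute_trace lam2 LL).
(* Symmetry of X H gives X H = H X^T, and skewness gives X^T g^-1 = - g^-1 X; so X anticommutes with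
   the shape operator H g^-1. *)
have alg (X g H : 'M[R]_n) : g \in unitmx -> g *m X^T = - (X *m g) -> H^T = H ->
    (X *m H)^T = X *m H -> X *m (H *m invmx g) = - (H *m invmx g *m X).
  move=> ug gX Hsym e; rewrite mulmxA -e trmx_mul Hsym.
  have XTg : X^T *m invmx g = - (invmx g *m X).
    by rewrite -[X^T](mulKmx ug) gX mulmxN mulNmx -!mulmxA mulmxV // mulmx1.
  by rewrite -!mulmxA XTg mulmxN.
exact: alg gu skew Hs LHs.
Qed.

End Bending.

(** * The conjugate hypersurface *)

(** Level sets of a locally constant function are open and so are their complements, while the image
    of the segment is connected. *)
Lemma locally_constant_path {R : realType} {S : topologicalType} {K : Type} (u : S -> K) (gam : R -> S) :
  (forall p, \forall q \near p, u q = u p) -> {within `[0, 1], continuous gam} ->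
  u (gam 1) = u (gam 0).
Proof.
move=> uc cgam; set A := gam @` `[0, 1]%classic.
have cA : connected A by apply: connected_continuous_connected cgam; exact: segment_connected.
have o (P : K -> Prop) : open [set q | P (u q)].
  rewrite openE => q Pq; rewrite /interior; apply: filterS (uc q) => z uz.
  by rewrite /= uz.
pose B := A `&` [set q | u q = u (gam 0)].
have BA : B = A.
  apply: cA.
  - by exists (gam 0); split=> //; exists 0 => //=; rewrite in_itv /= lexx ler01.
  - by exists [set q | u q = u (gam 0)] => //; exact: (o (fun k => k = u (gam 0))).
  - exists [set q | u q = u (gam 0)] => //; rewrite -openC.
    exact: (o (fun k => ~ (k = u (gam 0)))).
have : A (gam 1) by exists 1 => //=; rewrite in_itv /= lexx ler01.
by rewrite -BA => -[].
Qed.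

Section CurveIntegral.
Context {R : realType}.

Lemma smooth_integral (u : R -> R) : smooth setT u ->
  (\int[@lebesgue_measure R]_(t in `[0, 1]) ('D_1 u t))%R = u 1 - u 0.
Proof.
move=> su.
have cu t : {for t, continuous u} by exact: smooth_continuous su _.
have cd : continuous ('D_1 u) by move=> t; exact: (smooth_continuous (smooth_derive (1 : R) su) Logic.I).
rewrite /Rintegral (@continuous_FTC2 R ('D_1 u) u 0 1) //.
- exact: continuous_subspaceT.
- split.
  + by move=> t _; exact: smooth_derivable su _.
  + by apply: cvg_at_right_filter; exact: cu.
  + by apply: cvg_at_left_filter; exact: cu.
- by move=> t _; rewrite derive1E.
Qed.

End CurveIntegral.

Section Conjugate.
Context {R : realType} {n : nat} {M : riemannian R n}.

Lemma curve_chart m (T : M -> 'rV[R]_m) (gam : R -> M) (c : chart R n M) :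
  smooth_map T -> smooth_curve gam -> atlas c ->
  [/\ open (gam @^-1` cdom c), smooth (gam @^-1` cdom c) (T \o gam) &
    forall t, cdom c (gam t) ->
      'D_1 (T \o gam) t = 'D_1 (Defs.coord c \o gam) t *m dmap T c (Defs.coord c (gam t))].
Proof.
move=> sT [cgam sgam] ac; have [od oi cK cc cpc] := manifold_chart ac.
have oW : open (gam @^-1` cdom c) by apply: open_comp => // t _; exact: cgam.
have su : smooth (gam @^-1` cdom c) (Defs.coord c \o gam) := proj1 (smooth_onP _ oW) (sgam c ac).
have sv := smooth_map_chart sT ac.
have uv t : cdom c (gam t) -> cimg c (Defs.coord c (gam t)) by exists (gam t).
have E t : cdom c (gam t) -> ((T \o cparam c) \o (Defs.coord c \o gam)) t = (T \o gam) t.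
  by move=> ct; rewrite /= cK.
split=> //.
  move=> k; apply: (Ck_ext oW E); exact: Ck_comp_mx oW oi uv (su k) sv.
move=> t ct.
have du := smooth_differentiable su ct.
have dv := smooth_differentiable sv (uv t ct).
have h : \forall s \near t, (T \o gam) s = ((T \o cparam c) \o (Defs.coord c \o gam)) s.
  have : \forall s \near t, cdom c (gam s) by exact: open_nbhs_nbhs.
  by apply: filterS => s cs; rewrite E.
apply: (etrans (near_eq_derive _ h)); apply: (etrans (derive_comp _ du dv)).
exact: deriveEjacobian dv.
Qed.

Variables (f T : M -> 'rV[R]_n.+1).
Hypothesis sT : smooth_map T.
Hypothesis T_factor : forall (c : chart R n M) x, atlas c -> cimg c x ->
  dmap T c x = bend f T c x *m dmap f c x.

(** The candidate is built from T itself, so no path independence has to be proved: along any curve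
    its derivative is the integrand, since J at angle pi / 2 is L / lam and dT = L df, and the
    fundamental theorem of calculus gives the integral. *)
Lemma bending_conjugate (lam : M -> R) (x0 : M) : (forall p, lam p != 0) ->
  (forall p, lam p = lam x0) ->
  conjugate_hypersurface f (bending_structure f T lam) x0
    (fun p => (lam x0)^-1 *: (T p - T x0)).
Proof.
move=> lam0 lamE gam sgam gam0.
have sTg : smooth setT (T \o gam).
  move=> k; apply: Ck_local => t _; have [c ac ct] := manifold_cover (gam t).
  by have [_ sW _] := curve_chart sT sgam ac; exists (gam @^-1` cdom c).
exists (fun t => (lam x0)^-1 *: 'D_1 (T \o gam) t); split=> [c t _ ac ct|i].
  have [_ _ ->] := curve_chart sT sgam ac => //.
  have cx : cimg c (Defs.coord c (gam t)) by exists (gam t).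
  rewrite cos_pihalf sin_pihalf scale0r add0r scale1r /bending_structure lamE.
  have alg a (D : 'rV[R]_n) (X : 'M[R]_n) (Y Z : 'M[R]_(n, n.+1)) : Y = X *m Z ->
    a *: (D *m Y) = D *m (a *: X *m Z) by move=> ->; rewrite -scalemxAl -scalemxAr.
  exact: alg (T_factor ac cx).
pose u t : R := ((lam x0)^-1 *: (T (gam t))) 0 i.
have sZ : smooth setT (fun t => (lam x0)^-1%:M *m (T \o gam) t).
  by apply: smooth_mulmx; [exact: openT|exact: smooth_cst|exact: sTg].
have su : smooth setT u.
  apply: (smooth_ext openT _ (proj1 (smooth_mxP _ openT) sZ 0 i)) => t _.
  by rewrite mul_scalar_mx.
have dE t : ((lam x0)^-1 *: 'D_1 (T \o gam) t) 0 i = 'D_1 u t.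
  have dT : derivable (T \o gam) t 1 := smooth_derivable sTg Logic.I.
  have dZ := derivableZ (k := (lam x0)^-1) dT.
  apply: (etrans _ (esym (derive_coord 0 i dZ))).
  exact: (congr1 (fun X : 'rV[R]_n.+1 => X 0 i) (esym (deriveZ (lam x0)^-1 dT))).
under eq_Rintegral do rewrite dE.
by rewrite smooth_integral // /u gam0 scalerBr !mxE.
Qed.

End Conjugate.

Theorem theorem1 (R : realType) (n : nat) (M : riemannian R n)
  (f : M -> 'rV[R]_n.+1) (I : set R) (F : R -> M -> 'rV[R]_n.+1)
  (n_ge2 : (2 <= n)%N)
  (f_isometric : isometric_immersion f)
  (F_variation : is_variation f I F)
  (F_infinitesimal : infinitesimal_variation I F)
  (F_nowhere_trivial : nowhere_trivial f I F)
  (F_gauss : preserves_gauss_map I F)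
  (M_nonflat : forall p : M, ~ flat_point p)
  (f_noncylindrical : forall U : set M,
     open U -> U !=set0 -> ~ part_of_cylinder f U) :
  minimal f /\
  exists J : chart R n M -> 'rV[R]_n -> 'M[R]_n,
    kaehler_structure J /\
    (simply_connected R M ->
     forall x0 : M, exists fbar : M -> 'rV[R]_n.+1,
       conjugate_hypersurface f J x0 fbar /\
       exists (c : R) (w : 'rV[R]_n.+1),
         forall p : M, variational_field I F p = c *: fbar p + w).
Proof.
have n_gt0 : (0 < n)%N := ltnW n_ge2.
have [[itvI Int] I0 sF _ _] := F_variation.
have sT := variational_field_smooth itvI Int I0 sF.
have nbT := variational_field_bending F_variation F_infinitesimal F_gauss.
have [lam [lam_gt0 lam_sq]] := bend_square f_isometric sT nbT F_nowhere_trivial M_nonflat f_noncylindrical.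
have lam0 p : lam p != 0 by rewrite gt_eqF.
split; first exact: (bending_minimal f_isometric sT nbT lam_gt0 lam_sq).
exists (bending_structure f (variational_field I F) lam); split.
  exact: (bending_kaehler n_gt0 f_isometric sT nbT lam_gt0 lam_sq).
move=> [_ path_connected _] x0.
have lamE p : lam p = lam x0.
  have [gam [cgam <- <-]] := path_connected x0 p.
  exact: (locally_constant_path (lam_locally_constant n_gt0 f_isometric sT nbT lam_gt0 lam_sq) cgam).
(* Dividing by lam x0 normalises T to the conjugate hypersurface based at x0; hence c = lam x0 and w
   is the value of T at x0. *)
exists (fun p => (lam x0)^-1 *: (variational_field I F p - variational_field I F x0)); split.
  exact: (bending_conjugate sT (fun c x => @bend_factor _ _ _ _ _ f_isometric sT nbT c x) lam0 lamE).
exists (lam x0), (variational_field I F x0) => p.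
by rewrite scalerA mulfV // scale1r subrK.
Qed.
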